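(* Let $(A,\mathfrak m)$ be a non-regular Gorenstein local ring of dimension $d\ge 1$ with residue field $k=A/\mathfrak m$. Let $N$ be a perfect $A$-module of dimension $t\ge 1$ and let $I$ be an ideal of definition of $N$. Let $M$ be a maximal Cohen-Macaulay $A$-module. Then for every integer $i\ge 1$: (i) $r_i^{I,N}(\Omega^d k)=r_1^{I,N}(\Omega^d k)$; (ii) $s^i_{I,N}(\Omega^d k)=s^1_{I,N}(\Omega^d k)$; (iii) $r_1^{I,N}(\Omega^d k)=s^1_{I,N}(\Omega^d k)$; (iv) $r_i^{I,N}(M)\le r_1^{I,N}(\Omega^d k)\le t-1$; (v) $s^i_{I,N}(M)\le s^1_{I,N}(\Omega^d k)\le t-1$.
   Context: All rings are commutative Noetherian and all modules are finitely generated. $\lambda(-)$ denotes length. Over a Cohen-Macaulay local ring, a non-zero module $N$ is perfect if and only if it is Cohen-Macaulay of finite projective dimension. An ideal of definition of $N$ is an ideal $I\subseteq\mathfrak m$ with $\lambda(N/IN)<\infty$. $\Omega^d k$ is the $d$-th syzygy of $k$ (in a minimal free resolution); it is a maximal Cohen-Macaulay $A$-module. For a maximal Cohen-Macaulay $A$-module $M$ and $i\ge 1$, the functions $n\mapsto\lambda(\operatorname{Tor}_i^A(M,N/I^nN))$ and $n\mapsto\lambda(\operatorname{Ext}^i_A(M,N/I^nN))$ are known to agree with polynomials for $n\gg0$; $r_i^{I,N}(M)$ and $s^i_{I,N}(M)$, respectively, denote the degrees of these polynomials. The zero polynomial has degree $-1$. *)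

(* Defs.v *)
From HB Require Import structures.
From mathcomp Require Import all_boot all_order all_algebra.
From mathcomp Require Import boolp classical_sets.

Set Implicit Arguments.
Unset Strict Implicit.
Unset Printing Implicit Defensive.

Import GRing.Theory.
Local Open Scope ring_scope.
Local Open Scope quotient_scope.

Notation ideal A := (submodClosed A%type^o).

Section Submodule.
Variables (A : comNzRingType) (V : lmodType A) (S : submodClosed V).

Record submod : Type := Submod { submod_val :> V; _ : submod_val \in S }.

HB.instance Definition _ := [isSub for submod_val].
HB.instance Definition _ := [Choice of submod by <:].
HB.instance Definition _ := [SubChoice_isSubLmodule of submod by <:].

End Submodule.

Section QuotientModule.
Variables (A : comNzRingType) (V : lmodType A) (S : submodClosed V).

(* [submodClosed] does not inherit from [zmodClosed]. *)
Definition submod_pred : {pred V} := S.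
HB.instance Definition _ := GRing.isZmodClosed.Build V submod_pred
  (GRing.submod_closedB (submodClosedP S)).

Definition quotmod : Type := Quotient.quot submod_pred.
HB.instance Definition _ := GRing.Zmodule.on quotmod.
HB.instance Definition _ : EqQuotient V (Quotient.equiv submod_pred) quotmod :=
  EqQuotient.on quotmod.

Definition quot_scale (a : A) (x : quotmod) : quotmod := \pi_quotmod (a *: repr x).

Lemma quot_addE (v w : V) : \pi_quotmod (v + w) = \pi_quotmod v + \pi_quotmod w.
Proof. by rewrite [RHS]piE. Qed.

Lemma quot_scaleE a (v : V) : quot_scale a (\pi_quotmod v) = \pi_quotmod (a *: v).
Proof.
apply/eqP; rewrite piE /Quotient.equiv -scalerBr.
apply: (rpredZ (s := S)); rewrite -[_ \in _]/(Quotient.equiv submod_pred _ _).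
by rewrite -(eqquotE quotmod) reprK.
Qed.

Fact quot_scaleA a b v : quot_scale a (quot_scale b v) = quot_scale (a * b) v.
Proof. by rewrite -[v]reprK !quot_scaleE scalerA reprK. Qed.

Fact quot_scale1 : left_id 1 quot_scale.
Proof. by move=> v; rewrite -[v]reprK quot_scaleE scale1r. Qed.

Fact quot_scaleDr : right_distributive quot_scale +%R.
Proof.
move=> a v w; rewrite -[v]reprK -[w]reprK -quot_addE !quot_scaleE scalerDr.
by rewrite quot_addE.
Qed.

Fact quot_scaleDl v : {morph quot_scale^~ v : a b / a + b}.
Proof.
by move=> a b; rewrite -[v]reprK !quot_scaleE scalerDl quot_addE.
Qed.

HB.instance Definition _ := GRing.Zmodule_isLmodule.Build A quotmod
  quot_scaleA quot_scale1 quot_scaleDr quot_scaleDl.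

End QuotientModule.

Section SubmoduleConstructions.
Variable A : comNzRingType.

Definition fullsub (V : lmodType A) : {pred V} := predT.

Fact fullsub_closed (V : lmodType A) : submod_closed (@fullsub V).
Proof. by []. Qed.
HB.instance Definition _ V :=
  GRing.isSubmodClosed.Build A V (@fullsub V) (@fullsub_closed V).

Definition kersub (V W : lmodType A) (g : {linear V -> W}) : {pred V} :=
  [pred v | g v == 0].

Fact kersub_closed V W g : submod_closed (@kersub V W g).
Proof.
split=> [|a u v]; rewrite !inE ?linear0 // => /eqP gu /eqP gv.
by rewrite linearP gu gv scaler0 addr0.
Qed.
HB.instance Definition _ V W g :=
  GRing.isSubmodClosed.Build A V (@kersub V W g) (@kersub_closed V W g).

Definition imsub (U V : lmodType A) (f : {linear U -> V}) : {pred V} :=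
  [pred v | `[< exists u, v = f u >]].

Fact imsub_closed U V f : submod_closed (@imsub U V f).
Proof.
split=> [|a u v]; first by apply/asboolP; exists 0; rewrite linear0.
move=> /asboolP [x ->] /asboolP [y ->].
by apply/asboolP; exists (a *: x + y); rewrite linearP.
Qed.
HB.instance Definition _ U V f :=
  GRing.isSubmodClosed.Build A V (@imsub U V f) (@imsub_closed U V f).

Definition bdsub (U V W : lmodType A) (f : {linear U -> V})
    (g : {linear V -> W}) : {pred submod (kersub g)} :=
  [pred z | val z \in imsub f].
Arguments bdsub {U V W} f g.

Fact bdsub_closed (U V W : lmodType A) (f : {linear U -> V})
  (g : {linear V -> W}) : submod_closed (bdsub f g).
Proof.
split=> [|a u v hu hv]; first exact: (rpred0 (imsub f)).
exact: (rpredD (S := imsub f) (@rpredZ _ _ (imsub f) a _ hu) hv).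
Qed.
HB.instance Definition _ (U V W : lmodType A) (f : {linear U -> V})
  (g : {linear V -> W}) := GRing.isSubmodClosed.Build A
  (submod (kersub g)) (bdsub f g) (bdsub_closed f g).

(* ker g / (ker g \cap im f); it is ker g / im f when g \o f = 0. *)
Definition homology (U V W : lmodType A) (f : {linear U -> V})
  (g : {linear V -> W}) : lmodType A := quotmod (bdsub f g).

Definition mulsub (J : ideal A) (V : lmodType A) (S : submodClosed V) :
    {pred V} :=
  [pred v | `[< exists n (a : 'I_n -> A) (x : 'I_n -> V),
     [/\ forall i, a i \in J, forall i, x i \in S
       & v = \sum_i a i *: x i] >]].

Fact mulsub_closed J V S : submod_closed (@mulsub J V S).
Proof.
split=> [|c u v].
  by apply/asboolP; exists 0%N, (fun=> 0), (fun=> 0); split=> [[]|[]|] //;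
     rewrite big_ord0.
move=> /asboolP [n [a [x [aJ xS ->]]]] /asboolP[k [b [y [bJ yS ->]]]].
apply/asboolP; exists (n + k)%N.
exists (fun i => match split i with inl j => c * a j | inr j => b j end).
exists (fun i => match split i with inl j => x j | inr j => y j end).
split=> [i|i|]; first by case: (split i) => j; [apply: (rpredZ c)|].
  by case: (split i).
rewrite big_split_ord scaler_sumr; congr (_ + _); apply: eq_bigr => i _.
  by rewrite (unsplitK (inl i)) scalerA.
by rewrite (unsplitK (inr i)).
Qed.
HB.instance Definition _ J V S :=
  GRing.isSubmodClosed.Build A V (@mulsub J V S) (@mulsub_closed J V S).

Fixpoint idealX (J : ideal A) (n : nat) : ideal A :=
  if n is n'.+1 then mulsub J (idealX J n') else @fullsub A^o.

Definition ann (V : lmodType A) : {pred A^o} :=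
  [pred a : A^o | `[< forall v : V, (a : A) *: v = 0 >]].

Fact ann_closed V : submod_closed (@ann V).
Proof.
split=> [|c a b]; first by apply/asboolP => v; rewrite scale0r.
move=> /asboolP ha /asboolP hb; apply/asboolP => v.
by rewrite scalerDl -scalerA ha hb scaler0 addr0.
Qed.
HB.instance Definition _ V :=
  GRing.isSubmodClosed.Build A A^o (@ann V) (@ann_closed V).

End SubmoduleConstructions.

(* The module V / JV. *)
Notation "V %/m J" := (quotmod (mulsub J (@fullsub _ V)))
  (at level 40, no associativity).

Section CommutativeAlgebra.
Variable A : comNzRingType.
Implicit Types (V N : lmodType A) (J m : ideal A).

Definition generated_by V (n : nat) : Prop :=
  exists g : 'I_n -> V, forall v, exists c : 'I_n -> A, v = \sum_i c i *: g i.

Definition fin_gen V : Prop := exists n, generated_by V n.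

Definition noetherian : Prop := forall J, fin_gen (submod J).

Definition maximal_ideal J : Prop :=
  1 \notin J /\
  forall J' : ideal A, {subset J <= J'} -> 1 \notin J' -> {subset J' <= J}.

Definition local_ring m : Prop :=
  maximal_ideal m /\ forall m', maximal_ideal m' -> m' =i m.

Definition length_ge V (l : nat) : Prop :=
  exists S : nat -> submodClosed V, forall i, (i < l)%N ->
    {subset S i <= S i.+1} /\ ~ {subset S i.+1 <= S i}.

Definition has_length V (l : nat) : Prop := length_ge V l /\ ~ length_ge V l.+1.

Definition dim_ge V (n : nat) : Prop :=
  exists p : nat -> prime_idealr A,
    (forall a : A, a \in ann V -> a \in p 0%N) /\
    forall i, (i < n)%N ->
      {subset p i <= p i.+1} /\ ~ {subset p i.+1 <= p i}.

(* dim N = dim (A / ann N), the Krull dimension of N. *)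
Definition has_dim V (n : nat) : Prop := dim_ge V n /\ ~ dim_ge V n.+1.

Definition ring_dim (n : nat) : Prop := has_dim A^o n.

(* v lies in (x_0, ..., x_(i-1)) V. *)
Definition in_seqmod V (x : nat -> A) (i : nat) (v : V) : Prop :=
  exists y : nat -> V, v = \sum_(j < i) x j *: y j.

Definition regular_seq V (x : nat -> A) (n : nat) : Prop :=
  (forall i, (i < n)%N ->
     forall v : V, in_seqmod x i (x i *: v) -> in_seqmod x i v) /\
  ~ (forall v : V, in_seqmod x n v).

Definition grade_ge J V (n : nat) : Prop :=
  exists x : nat -> A, (forall i, (i < n)%N -> x i \in J) /\ regular_seq V x n.

(* grade (J, V), the maximal length of a V-regular sequence in J; it is
   depth V when J is the maximal ideal of a local ring. *)
Definition has_grade J V (n : nat) : Prop :=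
  grade_ge J V n /\ ~ grade_ge J V n.+1.

(* The grade condition forces V <> 0. *)
Definition max_cohen_macaulay m V : Prop :=
  exists n, [/\ has_dim V n, has_grade m V n & ring_dim n].

Definition regular_local m : Prop :=
  exists n, ring_dim n /\ generated_by (submod m) n.

Definition exact_at (U V W : lmodType A) (f : U -> V) (g : V -> W) : Prop :=
  forall v, g v = 0 <-> exists u, v = f u.

Definition projective V : Prop :=
  forall (X Y : lmodType A) (g : {linear X -> Y}) (f : {linear V -> Y}),
    (forall y, exists x, g x = y) -> exists h : {linear V -> X}, g \o h =1 f.

Definition injective_module V : Prop :=
  forall (X Y : lmodType A) (g : {linear X -> Y}) (f : {linear X -> V}),
    injective g -> exists h : {linear Y -> V}, h \o g =1 f.

Definition projdim_le V (n : nat) : Prop :=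
  exists (P : nat -> lmodType A) (d : forall i, {linear P i.+1 -> P i})
         (e : {linear P 0%N -> V}),
    [/\ forall i, projective (P i),
        forall v, exists x, e x = v,
        exact_at (d 0%N) e,
        forall i, exact_at (d i.+1) (d i)
      & forall i, (n < i)%N -> forall x : P i, x = 0].

Definition has_projdim V (n : nat) : Prop :=
  projdim_le V n /\ forall k, projdim_le V k -> (n <= k)%N.

Definition injdim_le V (n : nat) : Prop :=
  exists (E : nat -> lmodType A) (d : forall i, {linear E i -> E i.+1})
         (e : {linear V -> E 0%N}),
    [/\ forall i, injective_module (E i),
        injective e,
        exact_at e (d 0%N),
        forall i, exact_at (d i) (d i.+1)
      & forall i, (n < i)%N -> forall x : E i, x = 0].

Definition gorenstein : Prop := exists n, injdim_le A^o n.

(* N is perfect: N <> 0 and pd N = grade N, where grade N = grade (ann N, A). *)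
Definition perfect N : Prop :=
  [/\ fin_gen N, exists x : N, x != 0
    & exists n, has_projdim N n /\ has_grade (@ann A N) A^o n].

Definition ideal_of_definition m J N : Prop :=
  {subset J <= m} /\ exists l, has_length (N %/m J) l.

End CommutativeAlgebra.

Section Resolutions.
Variable A : comNzRingType.

(* The matrix D of a map A^p -> A^q (acting on row vectors) induces, after
   - \otimes X, this map X^p -> X^q, and, after Hom (-, X), the map X^q -> X^p
   attached in the same way to the transpose of D. *)
Definition mxmap (X : lmodType A) p q (D : 'M[A]_(p, q))
    (x : {ffun 'I_p -> X}) : {ffun 'I_q -> X} :=
  [ffun j => \sum_i D i j *: x i].
Arguments mxmap X {p q} D x.

Fact mxmap_linear X p q D : linear (@mxmap X p q D).
Proof.
move=> a x y; apply/ffunP => j; rewrite !ffunE scaler_sumr -big_split /=.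
by apply: eq_bigr => i _; rewrite !ffunE scalerDr !scalerA mulrC.
Qed.
HB.instance Definition _ X p q D :=
  GRing.isLinear.Build A _ _ _ (@mxmap X p q D) (@mxmap_linear X p q D).

Record free_resolution (V : lmodType A) := FreeResolution {
  fr_rank : nat -> nat;
  fr_diff : forall i, 'M[A]_(fr_rank i.+1, fr_rank i);
  fr_aug : {linear {ffun 'I_(fr_rank 0%N) -> A^o} -> V};
  fr_aug_surj : forall v, exists x, fr_aug x = v;
  fr_exact0 : exact_at (mxmap A^o (fr_diff 0%N)) fr_aug;
  fr_exactS : forall i,
    exact_at (mxmap A^o (fr_diff i.+1)) (mxmap A^o (fr_diff i)) }.

Definition minimal_resolution (m : ideal A) V (F : free_resolution V) : Prop :=
  forall i j k, fr_diff F i j k \in m.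

(* The i-th syzygy of V, as a submodule of the (i-1)-st free module of F. *)
Definition syzygy V (F : free_resolution V) (i : nat) : lmodType A :=
  if i is i'.+1 then submod (imsub (mxmap A^o (fr_diff F i'))) else V.

(* Tor_i^A(V, X) = H_i(F \otimes X). *)
Definition Tor V (F : free_resolution V) (i : nat) (X : lmodType A) :
    lmodType A :=
  if i is i'.+1
  then homology (mxmap X (fr_diff F i'.+1)) (mxmap X (fr_diff F i'))
  else quotmod (imsub (mxmap X (fr_diff F 0%N))).

(* Ext^i_A(V, X) = H^i(Hom(F, X)). *)
Definition Ext V (F : free_resolution V) (i : nat) (X : lmodType A) :
    lmodType A :=
  if i is i'.+1
  then homology (mxmap X (fr_diff F i')^T) (mxmap X (fr_diff F i'.+1)^T)
  else submod (kersub (mxmap X (fr_diff F 0%N)^T)).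

(* The polynomial function n |-> length (L n), n >> 0, has degree r. The
   degree of p is size p - 1, which is -1 for p = 0. *)
Definition has_length_degree (L : nat -> lmodType A) (r : int) : Prop :=
  exists p : {poly rat},
    (exists n0, forall n, (n0 <= n)%N ->
       exists2 l, has_length (L n) l & l%:R = p.[n%:R]) /\
    r = (size p)%:Z - 1.

(* The junk value 0 is irrelevant: it is only used when the lengths are not
   eventually finite and polynomial. *)
Definition length_degree (L : nat -> lmodType A) : int :=
  xget 0 [set r | has_length_degree L r]%classic.

(* r_i^{I,N}(V) and s^i_{I,N}(V), computed with the resolution F of V. *)
Definition tor_degree (I : ideal A) (N : lmodType A) V
    (F : free_resolution V) (i : nat) : int :=
  length_degree (fun n => Tor F i (N %/m idealX I n)).

Definition ext_degree (I : ideal A) (N : lmodType A) V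
    (F : free_resolution V) (i : nat) : int :=
  length_degree (fun n => Ext F i (N %/m idealX I n)).

End Resolutions.

(* Main.v *)
(* The idea. Over a Gorenstein ring the free resolution D of a maximal
   Cohen-Macaulay module extends to a complete resolution, and the homology of D
   and of its dual with coefficients in N vanishes, N being of finite projective
   dimension. Hence the homology with coefficients in N / I^n N is
   (U \cap I^n V) / I^n U for some submodule U of some V = N^r. By Artin-Rees its
   length is bounded by that of I^n V / I^(n+e) V, so it is a polynomial of degree
   at most t - 1, and every z in m acts nilpotently on it, uniformly in n.

   Let x be a maximal A-regular sequence, of length s <= d. It is regular on all
   the syzygies M in a complete resolution, and A / (x) is artinian. As x_j acts
   nilpotently on Tor_i(M, N / I^n N), the length of the latter is bounded by a
   constant times that of Tor_(i+1)(M / x_j M, N / I^n N). After s such steps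
   M / (x) M has a finite filtration by copies of k, and Tor_i(M, N / I^n N) is
   bounded by a constant times Tor_(i+s)(k, N / I^n N). Shifting the complete
   resolution of M, one may replace i + s by any q > s; the same holds for Ext.
   Applied to the complete resolution of Omega^d k this shows that all the
   degrees r_i(Omega^d k), i >= 1, agree, and applied to its dual, which
   exchanges Tor and Ext, that r_1(Omega^d k) = s^1(Omega^d k). *)
From HB Require Import structures.
From mathcomp Require Import freeg.
Require Import Defs.
From mathcomp Require Import all_boot all_order all_algebra ring lra ring_quotient.
From mathcomp Require Import boolp classical_sets.

Set Implicit Arguments.
Unset Strict Implicit.
Unset Printing Implicit Defensive.

Import GRing.Theory.
Local Open Scope ring_scope.

(** Every module that is measured is a subquotient Z / B of a fixed module, given by two submodules,
    and the length belongs to the pair. Artin-Rees, devissage and long exact sequences then become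
    statements about inclusions, without towers of quotients. Complexes are sequences of matrices:
    dualizing is transposing, and a Boolean [c] lets one proof serve both Tor and Ext. The
    Gorenstein property enters as finite injective dimension of A. Its key consequence is Ext^j(-,
    A) = 0 for all j > s, by descending induction from j beyond that dimension. As s <= d, this
    makes M and Omega^d k totally reflexive; it also makes A / (x) artinian. The inequality s <= d
    comes from a chain of primes built along x. The obstacle is uniformity: the exponents with which
    elements of m act as zero on homology, and all the constants, have to be fixed before the power
    of I. Artin-Rees provides this. *)

Arguments mxmap {A} X {p q} D x.

(** * Submodules and length *)

Section Submodules.
Variable A : comNzRingType.
Implicit Types U V W : lmodType A.

Definition lin V W (f : V -> W) := forall a u v, f (a *: u + v) = a *: f u + f v.

Lemma lin0 V W (f : V -> W) : lin f -> f 0 = 0.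
Proof. by move=> lf; have := lf (-1) 0 0; rewrite scaler0 addr0 scaleN1r addNr. Qed.

Lemma linD V W (f : V -> W) u v : lin f -> f (u + v) = f u + f v.
Proof. by move=> lf; have := lf 1 u v; rewrite !scale1r. Qed.

Lemma linZ V W (f : V -> W) a u : lin f -> f (a *: u) = a *: f u.
Proof. by move=> lf; have := lf a u 0; rewrite !addr0 (lin0 lf) addr0. Qed.

Lemma linN V W (f : V -> W) u : lin f -> f (- u) = - f u.
Proof. by move=> lf; rewrite -!scaleN1r linZ. Qed.

Lemma linB V W (f : V -> W) u v : lin f -> f (u - v) = f u - f v.
Proof. by move=> lf; rewrite linD // linN. Qed.

Lemma lin_scale V (a : A) : lin (fun v : V => a *: v).
Proof. by move=> b u v; rewrite scalerDr !scalerA mulrC. Qed.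

Lemma lin_act V (u : V) : lin (fun a : A^o => (a : A) *: u).
Proof. by move=> b c d; rewrite scalerDl scalerA. Qed.

Lemma linear_lin V W (f : {linear V -> W}) : lin f.
Proof. by move=> a u v; rewrite linearP. Qed.

(** Submodules as propositional predicates: unions, images and colons are formed without Boolean
    reflection, and [subE] turns mutual inclusion into equality. *)
Record sub V := Sub {
  smem :> V -> Prop;
  mem0 : smem 0;
  memP : forall a u v, smem u -> smem v -> smem (a *: u + v) }.

Section SubTheory.
Variables (V : lmodType A) (S : sub V).

Lemma memD u v : S u -> S v -> S (u + v).
Proof. by move=> Su Sv; have := memP 1 Su Sv; rewrite scale1r. Qed.

Lemma memZ a u : S u -> S (a *: u).
Proof. by move=> Su; have := memP a Su (mem0 S); rewrite addr0. Qed.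

Lemma memN u : S u -> S (- u).
Proof. by move=> Su; rewrite -scaleN1r; apply: memZ. Qed.

Lemma memB u v : S u -> S v -> S (u - v).
Proof. by move=> Su Sv; apply/memD/memN. Qed.

Lemma memBr u v : S u -> S (u - v) -> S v.
Proof. by move=> Su Suv; have := memB Su Suv; rewrite opprB addrC subrK. Qed.

Lemma memBl u v : S v -> S (u - v) -> S u.
Proof. by move=> Sv Suv; rewrite -(subrK v u); apply: memD. Qed.

Lemma memDr u v : S u -> S (u + v) -> S v.
Proof. by move=> Su Suv; have := memB Suv Su; rewrite addrC addKr. Qed.

Lemma mem_sum I (r : seq I) (P : pred I) (F : I -> V) :
  (forall i, P i -> S (F i)) -> S (\sum_(i <- r | P i) F i).
Proof. by move=> SF; elim/big_rec: _ => [|i x Pi]; [exact: mem0|apply/memD/SF]. Qed.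

End SubTheory.

Definition sle V (S T : sub V) := forall v, S v -> T v.

Lemma subE V (S T : sub V) : (forall v, S v <-> T v) -> S = T.
Proof.
case: S T => [S S0 SP] [T T0 TP] /= ST.
have E : S = T by apply/funext => v; apply/propext.
by case: _ / E in T0 TP ST *; congr Sub; apply: Prop_irrelevance.
Qed.

Lemma sle_anti V (S T : sub V) : sle S T -> sle T S -> S = T.
Proof. by move=> ST TS; apply: subE => v; split; [exact: ST | exact: TS]. Qed.

Lemma sle_trans V (T S U : sub V) : sle S T -> sle T U -> sle S U.
Proof. by move=> ST TU v /ST /TU. Qed.

Lemma sle_refl V (S : sub V) : sle S S. Proof. by []. Qed.

Definition bot V : sub V.
Proof.
by exists (fun v => v = 0) => // a u v -> ->; rewrite scaler0 addr0.
Defined.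

Definition top V : sub V.
Proof. by exists (fun _ => True). Defined.

Lemma sle_top V (S : sub V) : sle S (top V).
Proof. by []. Qed.

Definition sadd V (S T : sub V) : sub V.
Proof.
exists (fun v => exists2 s, S s & T (v - s)).
  by exists 0; rewrite ?subr0; apply: mem0.
move=> a u v [s Ss Tus] [t St Tvt]; exists (a *: s + t); first exact: memP.
by rewrite opprD addrACA -scalerBr; apply: memP.
Defined.

Definition scap V (S T : sub V) : sub V.
Proof.
exists (fun v => S v /\ T v); first by split; apply: mem0.
by move=> a u v [Su Tu] [Sv Tv]; split; apply: memP.
Defined.

Definition spre V W (f : V -> W) (lf : lin f) (S : sub W) : sub V.
Proof.
exists (fun v => S (f v)); first by rewrite lin0 //; apply: mem0.
by move=> a u v Su Sv; rewrite lf; apply: memP.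
Defined.

Definition sim V W (f : V -> W) (lf : lin f) (S : sub V) : sub W.
Proof.
exists (fun w => exists2 v, S v & w = f v).
  by exists 0; [exact: mem0 | rewrite lin0].
move=> a _ _ [u Su ->] [v Sv ->].
by exists (a *: u + v); [exact: memP | rewrite lf].
Defined.

Arguments smem : simpl never.

Definition sscale V a (S : sub V) := sim (@lin_scale V a) S.
Definition scol V a (S : sub V) := spre (@lin_scale V a) S.
Definition scyc V (u : V) : sub V := sim (lin_act u) (top A^o).
(** The colon ideal (S : u), the annihilator of the class of u in V / S. *)
Definition sann V (S : sub V) (u : V) : sub A^o := spre (lin_act u) S.

Lemma spreE V W (f : V -> W) (lf : lin f) (S : sub W) v : spre lf S v = S (f v).
Proof. by []. Qed.

Lemma scolE V a (S : sub V) v : scol a S v = S (a *: v).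
Proof. by []. Qed.

Lemma sannE V (S : sub V) (u : V) (a : A) : sann S u a = S (a *: u).
Proof. by []. Qed.

Lemma sadd_l V (S T : sub V) : sle S (sadd S T).
Proof. by move=> v Sv; exists v; rewrite ?subrr //; apply: mem0. Qed.

Lemma sadd_r V (S T : sub V) : sle T (sadd S T).
Proof. by move=> v Tv; exists 0; rewrite ?subr0 //; apply: mem0. Qed.

Arguments sadd_l {V S T} [v] _.
Arguments sadd_r {V S T} [v] _.

Lemma sadd_lub V (S T U : sub V) : sle S U -> sle T U -> sle (sadd S T) U.
Proof. by move=> SU TU v [s /SU Us /TU Uvs]; apply: memBl Us Uvs. Qed.

Lemma saddI V (S T : sub V) u v : S u -> T v -> sadd S T (u + v).
Proof. by move=> Su Tv; exists u => //; rewrite addrC addKr. Qed.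

Lemma sadd_mono V (S S' T T' : sub V) :
  sle S S' -> sle T T' -> sle (sadd S T) (sadd S' T').
Proof.
move=> SS TT; apply: sadd_lub; first exact: sle_trans SS sadd_l.
exact: sle_trans TT sadd_r.
Qed.

Lemma scyc_mem V (u : V) : scyc u u.
Proof. by exists 1 => //; rewrite scale1r. Qed.

Lemma scycP V (u v : V) : scyc u v -> exists a : A, v = a *: u.
Proof. by case=> a _ ->; exists a. Qed.

Lemma scyc_le V (u : V) (S : sub V) : S u -> sle (scyc u) S.
Proof. by move=> Su v /scycP[a ->]; apply: memZ. Qed.

Lemma sadd_cyc V (S : sub V) (u v : V) :
  sadd S (scyc u) v <-> exists a : A, S (v - a *: u).
Proof.
split=> [[s Ss /scycP [a e]]|[a Sva]].
  by exists a; rewrite -e opprB addrC subrK.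
by exists (v - a *: u) => //; rewrite opprB addrC subrK; apply/memZ/scyc_mem.
Qed.

Fixpoint spn V (l : seq V) : sub V :=
  if l is u :: l' then sadd (scyc u) (spn l') else bot V.

(** The product (l) S with the ideal generated by the list. *)
Fixpoint gen V (l : seq A) (S : sub V) : sub V :=
  if l is a :: l' then sadd (sscale a S) (gen l' S) else bot V.

Lemma gen_mono V l (S T : sub V) : sle S T -> sle (gen l S) (gen l T).
Proof.
move=> ST; elim: l => [|a l IH] //=; apply: sadd_mono => // _ [v /ST Tv ->].
by exists v.
Qed.

Lemma gen_le V l (S T : sub V) :
  (forall a v, a \in l -> S v -> T (a *: v)) -> sle (gen l S) T.
Proof.
elim: l => [|a l IH] ST /=; first by move=> _ ->; apply: mem0.
apply: sadd_lub => [_ [v Sv ->]|]; first by apply: ST; rewrite ?mem_head.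
by apply: IH => b v bl; apply: ST; rewrite inE bl orbT.
Qed.

Lemma gen_in V l (S : sub V) a v : a \in l -> S v -> gen l S (a *: v).
Proof.
elim: l => //= b l IH; rewrite inE => /orP[/eqP->|al] Sv.
  by apply: sadd_l; exists v.
by apply: sadd_r; apply: IH.
Qed.

Lemma gen_sub V l (S : sub V) : sle (gen l S) S.
Proof. by apply: gen_le => a v _; apply: memZ. Qed.

Lemma gen_sim V W (f : V -> W) (lf : lin f) l (S : sub V) :
  sim lf (gen l S) = gen l (sim lf S).
Proof.
apply: sle_anti => [_ [v gv ->]|].
  have: sle (gen l S) (spre lf (gen l (sim lf S))).
    by apply: gen_le => a u al Su; rewrite spreE linZ //; apply: gen_in => //; exists u.
  by apply.
apply: gen_le => a _ al [u Su ->]; exists (a *: u); rewrite ?linZ //.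
exact: gen_in.
Qed.

Lemma gen_sadd V l (S T : sub V) : gen l (sadd S T) = sadd (gen l S) (gen l T).
Proof.
apply: sle_anti; last first.
  by apply: sadd_lub; apply: gen_mono; [exact: sadd_l | exact: sadd_r].
apply: gen_le => a v al [s Ss Tvs]; exists (a *: s); first exact: gen_in.
by rewrite -scalerBr; apply: gen_in.
Qed.

(* (l)^n S *)
Definition pow V l n (S : sub V) : sub V := iter n (gen l) S.

Lemma powS V l n (S : sub V) : pow l n.+1 S = gen l (pow l n S).
Proof. by []. Qed.

Lemma powD V l n k (S : sub V) : pow l (n + k) S = pow l n (pow l k S).
Proof. exact: iterD. Qed.

Lemma pow_mono V l n (S T : sub V) : sle S T -> sle (pow l n S) (pow l n T).
Proof. by move=> ST; elim: n => //= n IH; apply: gen_mono. Qed.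

Lemma pow_sub V l n (S : sub V) : sle (pow l n S) S.
Proof. by elim: n => //= n IH; apply: sle_trans (@gen_sub _ _ _) IH. Qed.

Lemma pow_le V l n k (S : sub V) : (n <= k)%N -> sle (pow l k S) (pow l n S).
Proof. by move=> nk; rewrite -(subnKC nk) addnC powD; apply: pow_sub. Qed.

Lemma pow_sim V W (f : V -> W) (lf : lin f) l n (S : sub V) :
  sim lf (pow l n S) = pow l n (sim lf S).
Proof. by elim: n => //= n IH; rewrite gen_sim IH. Qed.

End Submodules.

Arguments bot {A V}.
Arguments top {A V}.
Arguments smem : simpl never.
#[global] Hint Resolve sle_refl : core.
Arguments sadd_l {A V S T} [v] _.
Arguments sadd_r {A V S T} [v] _.

Section Length.
Variable A : comNzRingType.
Implicit Types V W : lmodType A.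

(** A strict chain of n steps ending in Z. It may start at any submodule above B, which makes the
    notion monotone in both B and Z. *)
Fixpoint clen V (B : sub V) n (Z : sub V) : Prop :=
  if n is n'.+1 then
    exists Y, [/\ clen B n' Y, sle Y Z & ~ sle Z Y]
  else sle B Z.

Definition fin V (B Z : sub V) := exists N, forall n, clen B n Z -> (n <= N)%N.

Definition is_len V (B Z : sub V) n :=
  clen B n Z /\ forall k, clen B k Z -> (k <= n)%N.

(* The length of Z / B; the junk value 0 is taken when it is infinite. *)
Definition ln V (B Z : sub V) : nat := xget 0%N [set n | is_len B Z n]%classic.

Lemma clen_sle V (B Z : sub V) n : clen B n Z -> sle B Z.
Proof.
elim: n Z => //= n IH Z [Y [cY YZ _]]; exact: sle_trans (IH _ cY) YZ.
Qed.

Lemma clen_mono V (B Z Z' : sub V) n : sle Z Z' -> clen B n Z -> clen B n Z'.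
Proof.
case: n => [|n] /= ZZ; first by move=> BZ; apply: sle_trans ZZ.
case=> Y [cY YZ ZY]; exists Y; split=> //; first exact: sle_trans ZZ.
by move=> ZY'; apply: ZY; apply: sle_trans ZY'.
Qed.

Lemma clen_monol V (B B' Z : sub V) n : sle B B' -> clen B' n Z -> clen B n Z.
Proof.
move=> BB; elim: n Z => [|n IH] Z /=; first exact: sle_trans.
by case=> Y [/IH cY YZ ZY]; exists Y.
Qed.

Lemma clen_pred V (B Z : sub V) n k : (k <= n)%N -> clen B n Z -> clen B k Z.
Proof.
move=> kn; rewrite -(subnKC kn) addnC; elim: (n - k)%N => //= j IH.
by case=> Y [cY YZ _]; apply/IH/(clen_mono YZ).
Qed.

Lemma is_len_uniq V (B Z : sub V) n n' : is_len B Z n -> is_len B Z n' -> n = n'.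
Proof. by move=> [c h] [c' h']; apply/eqP; rewrite eqn_leq h ?h'. Qed.

Lemma is_lenP V (B Z : sub V) n : is_len B Z n -> ln B Z = n.
Proof.
move=> h; rewrite /ln; case: xgetP => [k -> h'|/(_ n)//].
exact: is_len_uniq h' h.
Qed.

Lemma ln_len V (B Z : sub V) : sle B Z -> fin B Z -> is_len B Z (ln B Z).
Proof.
move=> BZ [N hN].
have ex : exists n, `[<clen B n Z>] by exists 0%N; apply/asboolP.
have bd n : `[<clen B n Z>] -> (n <= N)%N by move/asboolP/hN.
have [n /asboolP cn mn] := ex_maxnP ex bd.
have h : is_len B Z n by split=> // k ck; apply: mn; apply/asboolP.
by rewrite (is_lenP h).
Qed.

Lemma clen_cat V (B Y Z : sub V) n k :
  clen B n Y -> clen Y k Z -> clen B (k + n) Z.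
Proof.
move=> cY; elim: k Z => [|k IH] Z /=; first by move=> YZ; apply: clen_mono cY.
by case=> X [/IH cX XZ ZX]; exists X.
Qed.

(** By the modular law, a strict inclusion X < Z stays strict after intersecting with Y or after
    adding Y, so each step of the chain survives on at least one side. *)
Lemma clen_split V (B Y Z : sub V) n : sle B Y -> clen B n Z ->
  exists n1 n2, [/\ (n <= n1 + n2)%N, clen B n1 (scap Z Y) & clen Y n2 (sadd Z Y)].
Proof.
move=> BY; elim: n Z => [|n IH] Z /= => [BZ|[X [cX XZ ZX]]].
  exists 0%N, 0%N; split=> //=; last exact: sadd_r.
  by move=> v Bv; split; [exact: BZ|exact: BY].
have [n1 [n2 [len c1 c2]]] := IH _ cX.
have capm : sle (scap X Y) (scap Z Y) by move=> v [/XZ].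
have addm : sle (sadd X Y) (sadd Z Y) by apply: sadd_mono.
have [h|h] := pselect (sle (scap Z Y) (scap X Y)); last first.
  exists n1.+1, n2; split; first by rewrite addSn ltnS.
    by exists (scap X Y).
  exact: clen_mono c2.
exists n1, n2.+1; split; first by rewrite addnS ltnS.
  exact: clen_mono c1.
exists (sadd X Y); split=> // h'; apply: ZX => v Zv.
have [x Xx Yvx] := h' _ (@sadd_l _ _ Z Y v Zv).
have [] := h (v - x) _; first by split=> //; apply: memB => //; apply: XZ.
by move=> Xvx _; apply: memBl Xx Xvx.
Qed.

Lemma ln_add V (Y B Z : sub V) : sle B Y -> sle Y Z -> fin B Y -> fin Y Z ->
  fin B Z /\ ln B Z = (ln B Y + ln Y Z)%N.
Proof.
move=> BY YZ f1 f2; have BZ := sle_trans BY YZ.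
have [c1 m1] := ln_len BY f1; have [c2 m2] := ln_len YZ f2.
have bd n : clen B n Z -> (n <= ln B Y + ln Y Z)%N.
  move=> /(clen_split BY) [n1 [n2 [len d1 d2]]]; apply: leq_trans len _.
  apply: leq_add; first by apply/m1/(clen_mono _ d1) => v [].
  by apply/m2/(clen_mono _ d2)/sadd_lub.
have fBZ : fin B Z by exists (ln B Y + ln Y Z)%N.
split=> //; apply: is_lenP; split=> //.
by rewrite addnC; apply: clen_cat c1 c2.
Qed.

Lemma fin_sub V (B B' Z Z' : sub V) : sle B B' -> sle Z' Z -> fin B Z -> fin B' Z'.
Proof.
move=> BB ZZ [N hN]; exists N => n /(clen_monol BB) /(clen_mono ZZ).
exact: hN.
Qed.

Lemma ln_mono V (B B' Z Z' : sub V) : sle B B' -> sle B' Z' -> sle Z' Z ->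
  fin B Z -> (ln B' Z' <= ln B Z)%N.
Proof.
move=> BB BZ' ZZ f; have f' := fin_sub BB ZZ f.
have [_ m] := ln_len (sle_trans BB (sle_trans BZ' ZZ)) f.
have [c _] := ln_len BZ' f'.
exact/m/(clen_mono ZZ)/(clen_monol BB).
Qed.

Lemma ln_id V (B : sub V) : fin B B /\ ln B B = 0%N.
Proof.
have h n : clen B n B -> n = 0%N.
  by case: n => // n [Y [/clen_sle BY _]].
by split; [exists 0%N => n /h -> | apply: is_lenP; split=> // k /h ->].
Qed.

(* f induces an isomorphism Z/B -> Z'/B'. *)
Record qiso V W (f : V -> W) (B Z : sub V) (B' Z' : sub W) : Prop := Qiso {
  qiso_lin : lin f;
  qiso_sub : forall v, Z v -> Z' (f v);
  qiso_iff : forall v, Z v -> (B v <-> B' (f v));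
  qiso_surj : forall w, Z' w -> exists2 v, Z v & B' (w - f v);
  qiso_le : sle B Z;
  qiso_le' : sle B' Z' }.

Lemma qiso_clen V W (f : V -> W) B Z B' Z' : qiso f B Z B' Z' ->
  forall n, clen B n Z <-> clen B' n Z'.
Proof.
case=> lf fZ fB fs BZ BZ' n; split=> [c|c].
- suff H Y : sle Y Z -> clen B n Y -> clen B' n (sadd (sim lf Y) B').
    apply: clen_mono (H Z (@sle_refl _ _ _) c); apply: sadd_lub => // _ [v Zv ->].
    exact: fZ.
  elim: n Y {c} => [|n IH] Y YZ /=; first by move=> _; apply: sadd_r.
  case=> X [cX XY YX]; exists (sadd (sim lf X) B'); split.
  + by apply: IH cX; apply: sle_trans YZ.
  + by apply: sadd_mono => // _ [v Xv ->]; exists v => //; apply: XY.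
  + move=> h; apply: YX => y Yy.
    have /h [_ [x Xx ->]] : sadd (sim lf Y) B' (f y) by apply: sadd_l; exists y.
    rewrite -linB // => B'yx.
    have Zyx : Z (y - x) by apply: memB; apply: YZ => //; apply: XY.
    by apply: (memBl Xx); apply: (clen_sle cX); apply/fB.
- suff H Y : sle Y Z' -> clen B' n Y -> clen B n (scap Z (spre lf Y)).
    by apply: clen_mono (H Z' (@sle_refl _ _ _) c) => v [].
  elim: n Y {c} => [|n IH] Y YZ /=.
    by move=> B'Y v Bv; split; [exact: BZ | apply: B'Y; apply/fB => //; apply: BZ].
  case=> X [cX XY YX]; exists (scap Z (spre lf X)); split.
  + by apply: IH cX; apply: sle_trans YZ.
  + by move=> v [Zv Xv]; split=> //; apply: XY.
  + move=> h; apply: YX => y Yy; have [v Zv B'v] := fs _ (YZ _ Yy).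
    have Xyv := clen_sle cX B'v.
    have /h [_ Xv] : scap Z (spre lf Y) v.
      by split=> //=; apply: memBr Yy _; apply: XY.
    exact: (@memBl _ _ X y (f v)).
Qed.

Lemma qiso_ln V W (f : V -> W) B Z B' Z' : qiso f B Z B' Z' ->
  (fin B Z <-> fin B' Z') /\ ln B Z = ln B' Z'.
Proof.
move=> q; have h := qiso_clen q; split.
  by split=> -[N hN]; exists N => n /h; apply: hN.
rewrite /ln; congr xget; apply/funext => n /=; apply/propext.
by split=> -[/h c m]; split=> // k /h; apply: m.
Qed.

End Length.

(** * Noetherian modules *)

Section Noetherian.
Variable A : comNzRingType.
Implicit Types V W X : lmodType A.

Lemma spn_mem V (l : seq V) u : u \in l -> spn l u.
Proof.
elim: l => //= w l IH; rewrite inE => /orP[/eqP->|ul].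
  by apply: sadd_l; apply: scyc_mem.
by apply: sadd_r; apply: IH.
Qed.

Lemma spn_le V (l : seq V) (S : sub V) : (forall u, u \in l -> S u) -> sle (spn l) S.
Proof.
elim: l => [|w l IH] lS /=; first by move=> _ ->; apply: mem0.
apply: sadd_lub; first by apply: scyc_le; apply: lS; rewrite mem_head.
by apply: IH => u ul; apply: lS; rewrite inE ul orbT.
Qed.

Lemma spn_sub V (l l' : seq V) : {subset l <= l'} -> sle (spn l) (spn l').
Proof. by move=> ll; apply: spn_le => u /ll; apply: spn_mem. Qed.

Lemma spnP V (l : seq V) v : spn l v <->
  exists c : 'I_(size l) -> A, v = \sum_i c i *: nth 0 l i.
Proof.
split; last first.
  by case=> c ->; apply: mem_sum => i _; apply/memZ/spn_mem/mem_nth.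
elim: l v => [|u l IH] v /=.
  by move=> ->; exists (fun=> 0); rewrite big_ord0.
case=> _ /scycP [a ->] /IH [c e].
exists (fun i => oapp c a (unlift ord0 i)).
rewrite big_ord_recl unlift_none /= -(subrK (a *: u) v) e addrC; congr (_ + _).
by apply: eq_bigr => i _; rewrite liftK.
Qed.

Definition noeth V := forall S : sub V, exists l : seq V, S = spn l.

Lemma noeth_acc V (S : nat -> sub V) : noeth V ->
  (forall n, sle (S n) (S n.+1)) -> exists k, forall n, sle (S n) (S k).
Proof.
move=> nV inc.
have mono n k : (n <= k)%N -> sle (S n) (S k).
  move=> nk; rewrite -(subnKC nk); elim: (k - n)%N => [|j IH]; rewrite ?addn0 //.
  by rewrite addnS; apply: sle_trans IH (inc _).
have [U UE] : exists U : sub V, forall v, U v <-> exists n, S n v.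
  unshelve eexists; first exists (fun v => exists n, S n v).
  - by exists 0%N; apply: mem0.
  - move=> a u v [n Su] [k Sv]; exists (maxn n k).
    by apply: memP; [apply: mono Su | apply: mono Sv]; rewrite ?leq_maxl ?leq_maxr.
  - by [].
have [l Ul] := nV U.
have [k lk] : exists k, forall u, u \in l -> S k u.
  have: forall u, u \in l -> exists n, S n u.
    by move=> u ul; apply/UE; rewrite Ul; apply: spn_mem.
  elim: {Ul} l => [|u l IH] h; first by exists 0%N.
  have [k hk] : exists k, forall u, u \in l -> S k u.
    by apply: IH => w wl; apply: h; rewrite inE wl orbT.
  have [n hn] := h u (mem_head _ _); exists (maxn k n) => w.
  rewrite inE => /orP[/eqP->|/hk]; first by apply: mono hn; rewrite leq_maxr.
  by apply: mono; rewrite leq_maxl.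
exists k => n v Sv; apply: (spn_le lk); rewrite -Ul; apply/UE; by exists n.
Qed.

(** A failing S would have a strictly larger failing T, and dependent choice would then give an
    infinite ascending chain. *)
Lemma noeth_ind V (P : sub V -> Prop) : noeth V ->
  (forall S, (forall T, sle S T -> ~ sle T S -> P T) -> P S) -> forall S, P S.
Proof.
move=> nV step S0; apply: contrapT => nPS0.
have next (x : {S | ~ P S}) : exists y : {S | ~ P S},
    sle (projT1 x) (projT1 y) /\ ~ sle (projT1 y) (projT1 x).
  case: x => S nPS /=; apply: contrapT => h; apply: nPS; apply: step => T ST TS.
  by apply: contrapT => nPT; apply: h; exists (exist _ T nPT).
have [f hf] := choice next.
pose S n := projT1 (iter n f (exist _ S0 nPS0)).
have [k hk] := noeth_acc (S := S) nV (fun n => (hf _).1).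
exact: (hf (iter k f (exist _ S0 nPS0))).2 (hk k.+1).
Qed.

Lemma noeth_max V (P : sub V -> Prop) : noeth V -> (exists S, P S) ->
  exists2 S, P S & forall T, P T -> sle S T -> sle T S.
Proof.
move=> nV [S0 PS0]; apply: contrapT => h.
suff: forall S, ~ P S by move/(_ S0).
apply: noeth_ind => // S IH PS; apply: h; exists S => // T PT ST.
by apply: contrapT => TS; apply: IH ST TS PT.
Qed.

(** Induction on the generators: for S inside Au + (l), the coefficients of u form an ideal J. Lifts
    of generators of J, together with generators of the part of S inside (l), generate S. *)
Lemma noeth_fg V : noeth A^o -> (exists l : seq V, forall v, spn l v) -> noeth V.
Proof.
move=> nA [l hl] S.
suff: exists l', scap S (spn l) = spn l'.
  case=> l' e; exists l'; rewrite -e; apply: sle_anti; last by move=> v [].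
  by move=> v Sv; split.
elim: l {hl} => [|u l [l' IH]].
  by exists [::]; apply: subE => v; split=> [[]|e] //; split=> //; rewrite [v]e; exact: mem0.
have [J hJ] : exists J : sub A^o, forall a : A,
    J a <-> exists2 w, spn l w & S (a *: u + w).
  unshelve eexists; first exists (fun a => exists2 w, spn l w & S ((a : A) *: u + w)).
  - by exists 0; rewrite ?scale0r ?addr0; apply: mem0.
  - move=> a b c [w lw Sw] [w' lw' Sw']; exists (a *: w + w'); first exact: memP.
    by rewrite scalerDl -scalerA addrACA -scalerDr; apply: memP.
  - by [].
have [k Jk] := nA J.
have /choice [f hf] : forall a : A^o, exists w, J a ->
    spn l w /\ S ((a : A) *: u + w).
  move=> a; have [/hJ [w lw Sw]|na] := pselect (J a); first by exists w.
  by exists 0 => /na.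
exists ([seq (a : A) *: u + f a | a <- k] ++ l'); apply: sle_anti; last first.
  apply: spn_le => v; rewrite mem_cat => /orP[/mapP[a ak ->]|vl'].
    have [laf Saf] : spn l (f a) /\ S ((a : A) *: u + f a).
      by apply: hf; rewrite Jk; apply: spn_mem.
    by split=> //; apply: saddI => //; apply/memZ/scyc_mem.
  have [] : scap S (spn l) v by rewrite IH; apply: spn_mem.
  by move=> Sv lv; split=> //; apply: sadd_r.
move=> v [Sv [_ /scycP [a ->] lw]].
have Ja : J a by apply/hJ; exists (v - a *: u) => //; rewrite addrC subrK.
have [w lw' kw] : exists2 w, spn l w &
    spn [seq (b : A) *: u + f b | b <- k] (a *: u + w).
  move: Ja; rewrite Jk.
  have : forall b : A^o, b \in k -> J b by move=> b; rewrite Jk; apply: spn_mem.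
  elim: k a {Jk lw} => [|b k IHk] a hk /=.
    by move=> ->; exists 0; rewrite ?scale0r ?addr0 //; apply: mem0.
  case=> _ /scycP[c ->] kac.
  have [//|w lw kw] := IHk _ _ kac.
    by move=> d dk; apply: hk; rewrite inE dk orbT.
  have [lb _] := hf _ (hk _ (mem_head _ _)).
  exists (c *: f b + w); first exact: memP.
  have -> : a *: u + (c *: f b + w) =
      c *: ((b : A) *: u + f b) + ((a - c *: b) *: u + w).
    by rewrite scalerDr scalerA addrACA -scalerDl -[c *: b]/(c * b) (addrC (c * b)) subrK.
  by apply: saddI => //; apply/memZ/scyc_mem.
have kv' : forall z, spn [seq (b : A) *: u + f b | b <- k] z -> S z.
  apply: spn_le => _ /mapP[b bk ->]; have [] // := hf b.
  by rewrite Jk; apply: spn_mem.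
rewrite -(subrK (a *: u + w) v); apply: memD.
  apply: (@spn_sub _ l') => [z zl'|]; first by rewrite mem_cat zl' orbT.
  rewrite -IH; split; first by apply: memB => //; apply: kv'.
  by rewrite opprD addrA; apply: memB.
by apply: spn_sub kw => z zk; rewrite mem_cat zk.
Qed.

Definition delta V n (i : 'I_n) (u : V) : {ffun 'I_n -> V} :=
  [ffun j => if j == i then u else 0].

Lemma delta_lin V n (i : 'I_n) : lin (@delta V n i).
Proof.
move=> a u v; apply/ffunP => j; rewrite !ffunE; case: eqP => // _.
by rewrite scaler0 addr0.
Qed.

Lemma delta_sum V n (x : {ffun 'I_n -> V}) : x = \sum_i delta i (x i).
Proof.
apply/ffunP => j; rewrite sum_ffunE (bigD1 j) //= ffunE eqxx big1 ?addr0 // => i ij.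
by rewrite ffunE eq_sym (negPf ij).
Qed.

Lemma noeth_ffun V n : noeth A^o -> noeth V -> noeth {ffun 'I_n -> V}.
Proof.
move=> nA nV; apply: noeth_fg => //; have [l hl] := nV top.
exists [seq delta i u | i <- enum 'I_n, u <- l] => x; rewrite [x]delta_sum.
apply: mem_sum => i _; set S := spn _.
have : sle (spn l) (spre (@delta_lin V n i) S).
  apply: spn_le => u ul; apply: spn_mem; apply/allpairsP.
  by exists (i, u); rewrite mem_enum.
by apply; rewrite -hl.
Qed.

End Noetherian.


(** * Matrices acting on powers of a module *)

Section MatrixMaps.
Variable A : comNzRingType.
Implicit Types V W X Y : lmodType A.

Definition fmap X Y (f : X -> Y) n (x : {ffun 'I_n -> X}) : {ffun 'I_n -> Y} :=
  [ffun i => f (x i)].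

Lemma fmap_lin X Y (f : X -> Y) n : lin f -> lin (@fmap X Y f n).
Proof. by move=> lf a u v; apply/ffunP => i; rewrite !ffunE lf. Qed.

Lemma mxmap_lin X p q (D : 'M[A]_(p, q)) : lin (mxmap X D).
Proof. exact: linear_lin. Qed.

Lemma mxmap_fmap X Y (f : X -> Y) p q (D : 'M[A]_(p, q)) x : lin f ->
  mxmap Y D (fmap f x) = fmap f (mxmap X D x).
Proof.
move=> lf; apply/ffunP => j; rewrite !ffunE.
elim/big_rec2: _ => [|i y1 y2 _ ->]; first by rewrite lin0.
by rewrite lf ffunE.
Qed.

Lemma mxmapM X p q r (P : 'M[A]_(p, q)) (Q : 'M_(q, r)) x :
  mxmap X (P *m Q) x = mxmap X Q (mxmap X P x).
Proof.
apply/ffunP => k; rewrite !ffunE.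
under eq_bigr => i _ do rewrite mxE scaler_suml.
rewrite exchange_big; apply: eq_bigr => j _; rewrite ffunE scaler_sumr.
by apply: eq_bigr => i _; rewrite scalerA mulrC.
Qed.

Lemma mxmapDl X p q (P Q : 'M[A]_(p, q)) x :
  mxmap X (P + Q) x = mxmap X P x + mxmap X Q x.
Proof.
apply/ffunP => k; rewrite !ffunE -big_split; apply: eq_bigr => i _.
by rewrite mxE scalerDl.
Qed.

Lemma mxmap0l X p q x : mxmap X (0 : 'M[A]_(p, q)) x = 0.
Proof. by apply/ffunP => k; rewrite !ffunE big1 // => i _; rewrite mxE scale0r. Qed.

Lemma mxmapNl X p q (P : 'M[A]_(p, q)) x : mxmap X (- P) x = - mxmap X P x.
Proof. by apply/eqP; rewrite -addr_eq0 -mxmapDl addNr mxmap0l. Qed.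

Lemma mxmap_scalar X n (a : A) (x : {ffun 'I_n -> X}) : mxmap X a%:M x = a *: x.
Proof.
apply/ffunP => k; rewrite !ffunE (bigD1 k) //= mxE eqxx big1 ?addr0 // => i ik.
by rewrite mxE (negPf ik) scale0r.
Qed.

Lemma mxmap1 X n (x : {ffun 'I_n -> X}) : mxmap X (1%:M : 'M[A]_n) x = x.
Proof. by rewrite mxmap_scalar scale1r. Qed.

Definition rowf p q (P : 'M[A]_(p, q)) (i : 'I_p) : {ffun 'I_q -> A^o} :=
  [ffun j => P i j].

Lemma rowf_mul p q r (P : 'M[A]_(p, q)) (Q : 'M_(q, r)) i :
  rowf (P *m Q) i = mxmap A^o Q (rowf P i).
Proof.
by apply/ffunP => k; rewrite !ffunE mxE; apply: eq_bigr => j _; rewrite ffunE mulrC.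
Qed.

Lemma rowf_inj p q (P Q : 'M[A]_(p, q)) : (forall i, rowf P i = rowf Q i) -> P = Q.
Proof.
by move=> h; apply/matrixP => i j; have /ffunP/(_ j) := h i; rewrite !ffunE.
Qed.

Lemma mxmap_rowf p q (P : 'M[A]_(p, q)) (x : {ffun 'I_p -> A^o}) :
  mxmap A^o P x = \sum_i (x i : A) *: rowf P i.
Proof.
apply/ffunP => j; rewrite sum_ffunE ffunE; apply: eq_bigr => i _.
by rewrite !ffunE -[_ *: _]/(_ * _) mulrC.
Qed.

(* X^p -> X^q -> X^r is exact in the middle, given P Q = 0. *)
Definition exact_on X p q r (P : 'M[A]_(p, q)) (Q : 'M[A]_(q, r)) :=
  forall x, mxmap X Q x = 0 -> exists y, x = mxmap X P y.

Lemma mx_rows p q r (P : 'M[A]_(p, q)) (V : 'M[A]_(r, q)) :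
  (forall i, exists y, rowf V i = mxmap A^o P y) -> exists U, V = U *m P.
Proof.
move=> /choice [f hf]; exists (\matrix_(i, j) (f i j : A)).
apply: rowf_inj => i; rewrite rowf_mul hf; congr mxmap.
by apply/ffunP => j; rewrite !ffunE mxE.
Qed.

(** Projectivity of free modules in matrix form: the rows of V are cycles, and each is lifted along
    P separately. *)
Lemma ex_mx p q r k (P : 'M[A]_(p, q)) (Q : 'M[A]_(q, r)) (V : 'M_(k, q)) :
  exact_on A^o P Q -> V *m Q = 0 -> exists U, V = U *m P.
Proof.
move=> e VQ; apply: mx_rows => i; apply: e; rewrite -rowf_mul VQ.
by apply/ffunP => j; rewrite !ffunE mxE.
Qed.

Lemma spn_mx q (S : sub {ffun 'I_q -> A^o}) : noeth A^o ->
  exists p (P : 'M[A]_(p, q)), forall x, S x <-> exists y, x = mxmap A^o P y.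
Proof.
move=> nA; have [l ->] := noeth_ffun nA nA (n := q) S.
exists (size l), (\matrix_(i, j) (nth 0 l i j : A)) => x.
have E (y : {ffun 'I_(size l) -> A^o}) :
    mxmap A^o (\matrix_(i, j) (nth 0 l i j : A)) y = \sum_i (y i : A) *: nth 0 l i.
  rewrite mxmap_rowf; apply: eq_bigr => i _; congr (_ *: _).
  by apply/ffunP => j; rewrite ffunE mxE.
split=> [/spnP [c ->]|[y ->]]; last by rewrite E; apply/spnP; exists y.
by exists [ffun i => c i : A^o]; rewrite E; apply: eq_bigr => i _; rewrite ffunE.
Qed.

Lemma ker_mx q r (Q : 'M[A]_(q, r)) : noeth A^o ->
  exists p (P : 'M[A]_(p, q)), P *m Q = 0 /\ exact_on A^o P Q.
Proof.
move=> nA; have [p [P h]] := spn_mx (spre (mxmap_lin Q) bot) nA.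
exists p, P; split=> [|x]; last by move=> xQ; apply/h.
apply: rowf_inj => i; rewrite rowf_mul.
have : spre (mxmap_lin Q) bot (rowf P i).
  apply/h; exists (delta i 1); rewrite mxmap_rowf (bigD1 i) //= ffunE eqxx scale1r.
  by rewrite big1 ?addr0 // => j ji; rewrite ffunE (negPf ji) scale0r.
by rewrite spreE => ->; apply/ffunP => j; rewrite !ffunE mxE.
Qed.

End MatrixMaps.

Arguments fmap {A X Y} f {n} x.

(** * Hilbert functions *)

Section GradedNoetherian.
Variables (A : comNzRingType) (V : lmodType A).
Hypothesis nV : noeth V.

Definition stable (l : seq A) (S : nat -> sub V) :=
  forall a n v, a \in l -> S n v -> S n.+1 (a *: v).

(** Finite generation of a graded module: as each graded piece is noetherian, it means that no new
    generators appear beyond some degree. *)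
Definition generates (l : seq A) (S B : nat -> sub V) :=
  exists n0, forall n, (n0 <= n)%N -> sle (S n.+1) (sadd (gen l (S n)) (B n.+1)).

Lemma stable_sub l l' S : {subset l <= l'} -> stable l' S -> stable l S.
Proof. by move=> ll st a n v /ll; apply: st. Qed.

Lemma stable_gen l S n : stable l S -> sle (gen l (S n)) (S n.+1).
Proof. by move=> st; apply: gen_le => a v al; apply: st. Qed.

Lemma stable_exp l S a k n v : stable l S -> a \in l -> S n v ->
  S (k + n)%N (a ^+ k *: v).
Proof.
move=> st al Sv; elim: k => [|k IH]; first by rewrite expr0 scale1r.
by rewrite addSn exprS -scalerA; apply: st.
Qed.

Lemma generates_mono l S B B' : (forall n, sle (B n) (B' n)) ->
  generates l S B -> generates l S B'.
Proof.
move=> BB [n0 g]; exists n0 => n /g h; apply: sle_trans h _.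
by apply: sadd_mono.
Qed.

(* Noetherianity of the module \bigoplus Z_n / B_n over A[X_1, ..., X_r], where
   X_j acts by the j-th element of l: for the last element a, the images of
   (L : a^k) in Z / (B + aZ) increase with k, hence are stationary, and L is
   recovered from the finitely many of them by induction on the degree. *)
Theorem graded_noeth l Z B L : stable l Z -> stable l B -> stable l L ->
  (forall n, sle (B n) (L n)) -> (forall n, sle (L n) (Z n)) ->
  generates l Z B -> generates l L B.
Proof.
elim: l Z B L => [|a l IH] Z B L sZ sB sL BL LZ [n0 gZ].
  by exists n0 => n hn v /LZ /(gZ _ hn).
have aal : a \in a :: l by rewrite mem_head.
have lal : {subset l <= a :: l} by move=> x xl; rewrite inE xl orbT.
have sZl : stable l Z by apply: stable_sub sZ.
(* Multiplication by a raises the degree by one, so its image is zero in degree 0. *)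
pose aZ n := if n is n'.+1 then sscale a (Z n') else bot.
pose B' n := sadd (B n) (aZ n).
have saZ : stable l aZ.
  move=> b [|n] v bl; first by move=> ->; rewrite scaler0; apply: mem0.
  case=> u Zu ->; exists (b *: u); first by apply: sZ => //; apply: lal.
  by rewrite !scalerA mulrC.
have sB' : stable l B'.
  move=> b n v bl [s Bs avs]; exists (b *: s); first by apply: sB => //; apply: lal.
  by rewrite -scalerBr; apply: saZ.
have aZZ n : sle (aZ n) (Z n).
  case: n => [|n] v; first by move=> ->; apply: mem0.
  by case=> u Zu ->; apply: sZ.
have B'Z n : sle (B' n) (Z n).
  by apply: sadd_lub => //; apply: sle_trans (BL n) (LZ n).
pose Lk k n := scap (Z n) (spre (@lin_scale _ V (a ^+ k)) (L (k + n)%N)).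
pose L' k n := sadd (Lk k n) (B' n).
have LkP k n v : Lk k n v <-> Z n v /\ L (k + n)%N (a ^+ k *: v) by [].
have Lk_inc k k' n : (k <= k')%N -> sle (Lk k n) (Lk k' n).
  move=> kk v /LkP [Zv Lv]; apply/LkP; split=> //.
  by rewrite -(subnK kk) -addnA exprD -scalerA; apply: stable_exp sL _ Lv.
have sLk k : stable l (Lk k).
  move=> b n v bl /LkP [Zv Lv]; apply/LkP; split; first by apply: sZ => //; apply: lal.
  rewrite scalerA mulrC -scalerA addnS.
  by apply: sL => //; apply: lal.
have sL' k : stable l (L' k).
  move=> b n v bl [s Ls Bs]; exists (b *: s); first exact: sLk.
  by rewrite -scalerBr; apply: sB'.
have L'Z k n : sle (L' k n) (Z n) by apply: sadd_lub => // v /LkP[].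
have gZ' : generates l Z B'.
  exists n0 => n hn; apply: sle_trans (gZ _ hn) _; apply: sadd_lub; last first.
    by apply: sle_trans (@sadd_r _ _ _ _); apply: sadd_l.
  apply: sadd_lub; last exact: sadd_l.
  by apply: sle_trans (@sadd_r _ _ _ _); apply: sadd_r.
have L'inc k k' n : (k <= k')%N -> sle (L' k n) (L' k' n).
  by move=> kk; apply: sadd_mono => //; apply: Lk_inc.
have [Loo LooE] : exists Loo : nat -> sub V, forall n v, Loo n v <-> exists k, L' k n v.
  unshelve eexists; first (move=> n; exists (fun v => exists k, L' k n v)).
  - by exists 0%N; apply: mem0.
  - move=> c u v [k Lu] [k' Lv]; exists (maxn k k').
    by apply: memP; [apply: L'inc Lu | apply: L'inc Lv]; rewrite ?leq_maxl ?leq_maxr.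
  - by [].
have [n1 gLoo] : generates l Loo B'.
  apply: (IH Z) => //.
  - by move=> b n v bl /(LooE _ _) [k Lv]; apply/(LooE _ _).2; exists k; apply: sL'.
  - by move=> n v B'v; apply/(LooE _ _).2; exists 0%N; apply: sadd_r.
  - by move=> n v /(LooE _ _) [k]; apply: L'Z.
(* One k0 for all degrees: the ascending chain condition settles each degree up to n1, and beyond n1
   the union [Loo] is generated from below. *)
have [k0 hk0] : exists k0, forall n, sle (Loo n) (L' k0 n).
  have [k0 hk0] : exists k0, forall n, (n <= n1)%N -> sle (Loo n) (L' k0 n).
    elim: {gLoo} n1 => [|n [k0 hk0]].
      have [k hk] := noeth_acc (S := L' ^~ 0%N) nV (fun k => L'inc _ _ _ (leqnSn k)).
      by exists k => n; rewrite leqn0 => /eqP -> v /(LooE _ _) [j]; apply: hk.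
    have [k hk] := noeth_acc (S := L' ^~ n.+1) nV (fun k => L'inc _ _ _ (leqnSn k)).
    exists (maxn k0 k) => j; rewrite leq_eqVlt => /orP[/eqP -> v /(LooE _ _) [i]|jn].
      by move=> /hk; apply: L'inc; rewrite leq_maxr.
    by apply: sle_trans (hk0 _ jn) _; apply: L'inc; rewrite leq_maxl.
  exists k0 => n; have [/hk0 //|/ltnW n1n] := leqP n n1.
  rewrite -(subnKC n1n); elim: (n - n1)%N => [|j IHj]; rewrite ?addn0 ?addnS; first exact: hk0.
  apply: sle_trans (gLoo _ (leq_addr _ _)) _; apply: sadd_lub; last exact: sadd_r.
  by apply: sle_trans (gen_mono IHj) _; apply: stable_gen.
have [n2 hn2] : exists n2, forall k n, (k <= k0)%N -> (n2 <= n)%N ->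
    sle (L' k n.+1) (sadd (gen l (L' k n)) (B' n.+1)).
  have gL' k : generates l (L' k) B'.
    by apply: (IH Z) => // n; apply: sadd_r.
  elim: k0 {hk0} => [|k0 [n2 hn2]].
    have [n2 hn2] := gL' 0%N; exists n2 => k n; rewrite leqn0 => /eqP ->; exact: hn2.
  have [n3 hn3] := gL' k0.+1; exists (maxn n2 n3) => k n.
  rewrite geq_max leq_eqVlt => /orP[/eqP -> /andP[_]|kk /andP[n2n _]]; first exact: hn3.
  exact: hn2.
pose R N := sadd (gen (a :: l) (L N)) (B N.+1).
have RL N : sle (R N) (L N.+1) by apply: sadd_lub => //; apply: stable_gen.
have stepw k n w : Lk k n w -> R (k + n)%N (a ^+ k.+1 *: w).
  by move=> /LkP[_ Lw]; apply: sadd_l; rewrite exprS -scalerA; apply: gen_in.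
have stepb k n b : B n.+1 b -> R (k + n)%N (a ^+ k *: b).
  by move=> Bb; apply: sadd_r; rewrite -addnS; apply: stable_exp sB _ Bb.
(* Here a^k z = a^k w + a^k b + a^(k+1) z'. The first two terms lie in R, hence z' lies in (L :
   a^(k+1)), one degree lower: k grows while the degree drops. *)
have step k n z w : Lk k n.+1 z -> B' n.+1 (z - w) -> R (k + n)%N (a ^+ k *: w) ->
    (forall z', Lk k.+1 n z' -> R (k + n)%N (a ^+ k.+1 *: z')) ->
    R (k + n)%N (a ^+ k *: z).
  move=> /LkP[Zz Lz] [b Bb [z' Zz' e]] Rw h.
  have E : a ^+ k *: z = a ^+ k *: w + a ^+ k *: b + a ^+ k.+1 *: z'.
    rewrite exprSr -scalerA -e -!scalerDr -(addrA z) -opprD.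
    by rewrite [_ + (z - _)]addrC subrK.
  rewrite E; apply: memD; first by apply: memD => //; apply: stepb.
  apply: h; apply/LkP; split=> //; rewrite addSn.
  apply: (@memDr _ _ _ (a ^+ k *: w + a ^+ k *: b)); rewrite -?E -?addnS //.
  by rewrite addnS; apply: RL; apply: memD => //; apply: stepb.
(* Beyond k0 the colon modules have stabilised modulo B', so w can be taken in (L : a^(k-1)), and
   a^k w is a times an element of L. *)
have big n k z : (k0 < k)%N -> Lk k n.+1 z -> R (k + n)%N (a ^+ k *: z).
  elim: n k z => [|n IHn] [//|k] z k0k Lz.
    have [w Lw B'zw] : L' k0 1%N z by apply: hk0; apply/(LooE _ _).2; exists k.+1; apply: sadd_l.
    apply: (step _ _ _ w) => //; first by rewrite addSnnS; apply: stepw; apply: Lk_inc Lw.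
    move=> z' Lz'; have [w' Lw' [b Bb e]] : L' k0 0%N z'.
      by apply: hk0; apply/(LooE _ _).2; exists k.+2; apply: sadd_l.
    have -> : z' = w' + b by apply/eqP; rewrite -subr_eq0 opprD addrA; apply/eqP.
    rewrite scalerDr; apply: memD; first by apply: stepw; apply: Lk_inc Lw'; apply: ltnW.
    by apply: sadd_r; rewrite -addSn; apply: stable_exp sB _ Bb.
  have [w Lw B'zw] : L' k0 n.+2 z by apply: hk0; apply/(LooE _ _).2; exists k.+1; apply: sadd_l.
  apply: (step _ _ _ w) => //; first by rewrite addSnnS; apply: stepw; apply: Lk_inc Lw.
  by move=> z' Lz'; rewrite -addSnnS; apply: IHn => //; apply: ltnW.
(* For k <= k0 the generation bound n2 is used. Each of the j steps that lead from k to k0 + 1 costs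
   one degree, hence the margin n2 + j. *)
have small j k n z : (k + j = k0.+1)%N -> (n2 + j <= n)%N -> Lk k n.+1 z ->
    R (k + n)%N (a ^+ k *: z).
  elim: j k n z => [|j IHj] k n z; first by rewrite addn0 => -> _; apply: big.
  rewrite addnS => -[kj]; case: n => [|n]; first by rewrite addnS ltn0.
  rewrite addnS ltnS => hn Lz.
  have kk0 : (k <= k0)%N by rewrite -kj leq_addr.
  have hnn : (n2 <= n.+1)%N by apply: leq_trans (leq_trans (leq_addr _ _) hn) _.
  have [y gy B'zy] := hn2 k n.+1 kk0 hnn z (@sadd_l _ _ (Lk k n.+2) (B' n.+2) z Lz).
  rewrite gen_sadd in gy; case: gy => w gw B'yw.
  apply: (step _ _ _ w) => //.
  - rewrite -(subrK y z) -addrA; apply: memD => //.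
    by apply: stable_gen sB' _ B'yw.
  - apply: sadd_l; have : sle (gen l (Lk k n.+1))
        (spre (@lin_scale _ V (a ^+ k)) (gen (a :: l) (L (k + n.+1)%N))).
      apply: gen_le => b u bl /LkP[_ Lu]; rewrite spreE scalerA mulrC -scalerA.
      by apply: gen_in => //; apply: lal.
    by apply.
  - move=> z' Lz'; rewrite addnS -addSn; apply: IHj => //; by rewrite addSn kj.
exists (n2 + k0.+1)%N => n hn v Lv.
have := @small k0.+1 0%N n v erefl hn; rewrite expr0 scale1r add0n; apply.
by apply/LkP; rewrite expr0 scale1r; split=> //; apply: LZ.
Qed.

End GradedNoetherian.

(** * Rational polynomials and their values at large natural numbers *)

Section PolynomialGrowth.
Import Num.Theory Order.TTheory.
Implicit Types p q : {poly rat}.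

(** The binomial expansion of (n+1)^(k+1) - n^(k+1) has top term (k+1) n^k; the lower powers are
    handled by strong induction. *)
Lemma poly_antidiff q : exists p, forall n : nat, p.[n.+1%:R] - p.[n%:R] = q.[n%:R].
Proof.
have H k : exists p, forall n : nat, p.[n.+1%:R] - p.[n%:R] = n%:R ^+ k :> rat.
  elim/ltn_ind: k => k IH.
  have /choice [f hf] : forall i : 'I_k, exists p, forall n : nat,
    p.[n.+1%:R] - p.[n%:R] = n%:R ^+ i :> rat by move=> i; apply: IH.
  exists (k.+1%:R^-1 *: ('X^(k.+1) - \sum_(i < k) ('C(k.+1, i))%:R *: f i)) => n.
  rewrite !(hornerZ, hornerD, hornerN, hornerXn, horner_sum) -mulrBr.
  apply: (@mulfI _ k.+1%:R); first by rewrite pnatr_eq0.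
  rewrite mulrA divff ?mul1r ?pnatr_eq0 //.
  have e : n.+1%:R ^+ k.+1 = \sum_(i < k.+2) (n%:R ^+ i *+ 'C(k.+1, i)) :> rat.
    by rewrite -natr1 addrC exprDn; apply: eq_bigr => i _; rewrite expr1n mul1r.
  rewrite e big_ord_recr big_ord_recr /= binn mulr1n binSn.
  have -> : \sum_(i < k) ('C(k.+1, i)%:R *: f i).[n.+1%:R] =
     \sum_(i < k) ('C(k.+1, i)%:R *: f i).[n%:R] + \sum_(i < k) (n%:R ^+ i *+ 'C(k.+1, i)).
    rewrite -big_split; apply: eq_bigr => i _ /=.
    have /eqP := hf i n; rewrite subr_eq => /eqP; rewrite !hornerZ => ->.
    by rewrite mulrDr addrC mulr_natl.
  by rewrite -[X in _ + X + _]mulr_natl; ring.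
have [P hP] := choice H.
exists (\sum_(i < size q) q`_i *: P i) => n.
rewrite !horner_sum -sumrB horner_coef; apply: eq_bigr => i _.
by rewrite !hornerZ -mulrBr hP.
Qed.

Lemma poly_of_diff (f : nat -> nat) q n0 :
  (forall n, (n0 <= n)%N -> (f n.+1)%:R - (f n)%:R = q.[n%:R] :> rat) ->
  exists p, forall n, (n0 <= n)%N -> (f n)%:R = p.[n%:R] :> rat.
Proof.
move=> h; have [p hp] := poly_antidiff q.
exists (p + ((f n0)%:R - p.[n0%:R])%:P) => n n0n.
rewrite hornerD hornerC -(subnKC n0n); elim: (n - n0)%N => [|k IH].
  by rewrite addn0 addrC subrK.
have /eqP := h (n0 + k)%N (leq_addr _ _); rewrite subr_eq addnS => /eqP ->.
by rewrite IH -hp; ring.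
Qed.

(** Horner induction. A bound e > 0, and not just positivity, makes p(n) n absorb the next constant
    term for large n. *)
Lemma lead_coef_gt0 p : 0 < lead_coef p ->
  exists e n0, 0 < e /\ forall n : nat, (n0 <= n)%N -> e <= p.[n%:R].
Proof.
elim/poly_ind: p => [|p c IH]; first by rewrite lead_coef0 ltxx.
have [->|p0] := eqVneq p 0.
  rewrite mul0r add0r lead_coefC => c0; exists c, 0%N; split=> // n _.
  by rewrite hornerC.
rewrite lead_coefDl; last first.
  rewrite size_polyC size_mulX //; apply: leq_ltn_trans (leq_b1 _) _.
  by rewrite ltnS size_poly_gt0.
rewrite lead_coefMX => /IH [e [n0 [e0 h]]].
have [n1 hn1] : exists n1 : nat, (e - c) / e <= n1%:R.
  have h' := archi_boundP (normr_ge0 ((e - c) / e)).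
  by exists (Num.bound `|(e - c) / e|); apply/ltW/(le_lt_trans (ler_norm _))/h'.
exists e, (maxn n0 n1); split=> // n; rewrite geq_max => /andP[hn0 hn].
rewrite hornerD hornerC hornerMX -lerBlDr.
apply: (@le_trans _ _ (e * n%:R)); last by rewrite ler_wpM2r ?h.
by rewrite mulrC -ler_pdivrMr //; apply: le_trans hn1 _; rewrite ler_nat.
Qed.

Lemma lead_coef_ge0 p n0 : (forall n : nat, (n0 <= n)%N -> 0 <= p.[n%:R]) ->
  0 <= lead_coef p.
Proof.
move=> h; rewrite leNgt; apply/negP => l0.
have [|e [n1 [e0 h1]]] := @lead_coef_gt0 (- p).
  by rewrite lead_coefN oppr_gt0.
have := h1 _ (leq_maxr n0 n1); rewrite hornerN => h2.
by have := h _ (leq_maxl n0 n1); lra.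
Qed.

(** Otherwise C q - p would be eventually nonnegative with the negative leading coefficient of -
    p. *)
Lemma size_dominated p q (C : nat) n0 :
  (forall n : nat, (n0 <= n)%N -> 0 <= p.[n%:R] <= C%:R * q.[n%:R]) ->
  (size p <= size q)%N.
Proof.
move=> h; rewrite leqNgt; apply/negP => qp.
have p0 : p != 0 by rewrite -size_poly_gt0; apply: leq_ltn_trans qp.
have lp : 0 <= lead_coef p by apply: (@lead_coef_ge0 _ n0) => n /h /andP[].
have : 0 <= lead_coef (C%:R *: q - p).
  apply: (@lead_coef_ge0 _ n0) => n /h /andP[_].
  by rewrite !hornerE subr_ge0.
rewrite lead_coefDr ?lead_coefN ?size_polyN; last first.
  exact: leq_ltn_trans (size_scale_leq _ _) qp.
by rewrite oppr_ge0 => lp'; have := lead_coef_eq0 p; rewrite (negPf p0) eq_le lp lp'.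
Qed.

Lemma poly_nat_eq p q n0 : (forall n : nat, (n0 <= n)%N -> p.[n%:R] = q.[n%:R]) ->
  p = q.
Proof.
move=> h; apply/eqP; rewrite -subr_eq0; apply/negPn/negP => d0.
have := @max_poly_roots _ (p - q) [seq (n0 + i)%:R | i <- iota 0 (size (p - q))] d0.
rewrite size_map size_iota ltnn => H; apply/notF/H.
  by apply/allP => _ /mapP[i _ ->]; rewrite rootE !hornerE h ?subrr ?leq_addr.
rewrite map_inj_in_uniq ?iota_uniq // => i j _ _ /eqP.
by rewrite eqr_nat eqn_add2l => /eqP.
Qed.

(** A shift preserves the leading coefficient, so the difference loses one degree. This is the
    source of t - 1 in the final bounds. *)
Lemma size_shift_diff p (e : nat) :
  (size (p \Po ('X + e%:R%:P) - p)%R <= (size p).-1)%N.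
Proof.
have [->|p0] := eqVneq p 0; first by rewrite comp_poly0 subrr size_poly0.
have sp : (0 < size p)%N by rewrite size_poly_gt0.
have s2 : size ('X + (e%:R : rat)%:P) = 2 by rewrite size_XaddC.
have sc : size (p \Po ('X + e%:R%:P)) = size p by rewrite size_comp_poly2.
apply/leq_sizeP => j hj; rewrite coefB.
have [sj|] := ltnP (size p).-1 j.
  by rewrite !nth_default ?subrr ?sc // -(prednK sp).
move=> js; have -> : j = (size p).-1 by apply/eqP; rewrite eqn_leq js hj.
have -> : p`_(size p).-1 = lead_coef p by [].
have -> : (p \Po ('X + e%:R%:P))`_(size p).-1 = lead_coef (p \Po ('X + e%:R%:P)).
  by rewrite lead_coefE sc.
rewrite lead_coef_comp ?s2 //.
have -> : lead_coef ('X + (e%:R : rat)%:P) = 1.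
  by rewrite -(opprK (e%:R)%:P) -polyCN lead_coefXsubC.
by rewrite expr1n mulr1 subrr.
Qed.

End PolynomialGrowth.

Section LengthTools.
Variable A : comNzRingType.
Implicit Types V W : lmodType A.

(** Surjections of subquotients: enlarging B to the full kernel [B1] makes f an isomorphism. *)
Lemma ln_iso_ge V W (f : V -> W) (B Z : sub V) (B' Z' : sub W) : lin f ->
  sle B Z -> sle B' Z' -> (forall v, B v -> B' (f v)) -> (forall v, Z v -> Z' (f v)) ->
  (forall w, Z' w -> exists2 v, Z v & B' (w - f v)) -> fin B Z ->
  fin B' Z' /\ (ln B' Z' <= ln B Z)%N.
Proof.
move=> lf BZ BZ' fB fZ fs fBZ; pose B1 := scap Z (spre lf B').
have BB1 : sle B B1 by move=> v Bv; split; [exact: BZ | exact: fB].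
have B1Z : sle B1 Z by move=> v [].
have q : qiso f B1 Z B' Z' by split=> // v Zv; split=> [[]|].
have [fi e] := qiso_ln q; rewrite -e; split.
  by apply/fi; apply: fin_sub fBZ.
exact: ln_mono fBZ.
Qed.

(** Injections of subquotients: Z / B is isomorphic to the image [Z1] modulo B'. *)
Lemma ln_inj_le V W (f : V -> W) (B Z : sub V) (B' Z' : sub W) : lin f ->
  sle B Z -> sle B' Z' -> (forall v, Z v -> Z' (f v)) ->
  (forall v, Z v -> (B v <-> B' (f v))) -> fin B' Z' ->
  fin B Z /\ (ln B Z <= ln B' Z')%N.
Proof.
move=> lf BZ BZ' fZ fB f'; pose Z1 := sadd (sim lf Z) B'.
have B'Z1 : sle B' Z1 by exact: sadd_r.
have Z1Z' : sle Z1 Z' by apply: sadd_lub => // _ [v Zv ->]; apply: fZ.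
have q : qiso f B Z B' Z1.
  split=> //; first by move=> v Zv; apply: sadd_l; exists v.
  by move=> w [_ [v Zv ->] h]; exists v.
have [fi e] := qiso_ln q; rewrite e; split.
  by apply/fi; apply: fin_sub f'.
exact: ln_mono f'.
Qed.

End LengthTools.

Section HilbertSerre.
Import Num.Theory Order.TTheory.
Variables (A : comNzRingType) (V : lmodType A).
Hypothesis nV : noeth V.

(* Induction on l: the kernel and the cokernel of the last generator are again of
   the form Z / B, for fewer generators. *)
Theorem hilbert_serre (l : seq A) (Z B : nat -> sub V) :
  stable l Z -> stable l B -> (forall n, sle (B n) (Z n)) -> generates l Z B ->
  (forall n, fin (B n) (Z n)) ->
  exists (p : {poly rat}) n0, forall n, (n0 <= n)%N -> (ln (B n) (Z n))%:R = p.[n%:R].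
Proof.
elim: l Z B => [|a l IH] Z B sZ sB BZ gZ fZ.
  have [n0 h] := gZ; exists 0, n0.+1 => -[//|n] n0n; rewrite horner0.
  have ZB : sle (Z n.+1) (B n.+1).
    by apply: sle_trans (h n n0n) _; apply: sadd_lub => // v ->; apply: mem0.
  have -> : Z n.+1 = B n.+1 by apply: sle_anti.
  by rewrite (ln_id _).2.
have lal : {subset l <= a :: l} by move=> x xl; rewrite inE xl orbT.
have aal : a \in a :: l by rewrite mem_head.
pose K n := scap (Z n) (scol a (B n.+1)).
pose C n := sadd (sscale a (Z n)) (B n.+1).
have BK n : sle (B n) (K n) by move=> v Bv; split; [exact: BZ | apply: sB].
have KZ n : sle (K n) (Z n) by move=> v [].
have CZ n : sle (C n) (Z n.+1).
  by apply: sadd_lub => // _ [v Zv ->]; apply: sZ.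
have BC n : sle (B n.+1) (C n) by apply: sadd_r.
have sK : forall b n v, b \in a :: l -> K n v -> K n.+1 (b *: v).
  move=> b n v bl [Zv Bv]; split; first exact: sZ.
  by rewrite scolE scalerA mulrC -scalerA; apply: sB.
have [|k [n1 hk]] := IH K B (stable_sub lal sK) (stable_sub lal sB) BK _
    (fun n => fin_sub (@sle_refl _ _ _) (KZ n) (fZ n)).
  (* The kernel is finitely generated over all of a :: l; as a maps K into B, only the generators in
     l contribute. *)
  have [n1 gK] := graded_noeth nV sZ sB sK BK KZ gZ.
  exists n1 => n /gK h; apply: sle_trans h _; apply: sadd_lub; last exact: sadd_r.
  apply: sadd_lub; last exact: sadd_l.
  by move=> _ [v [_ Bv] ->]; apply: sadd_r.
have [| | |c [n2 hc]] := IH (fun n => Z n.+1) C _ _ CZ _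
    (fun n => fin_sub (BC n) (@sle_refl _ _ _) (fZ n.+1)).
- by move=> b n v bl; apply: sZ; apply: lal.
- move=> b n v bl [_ [u Zu ->] Bv]; exists (a *: (b *: u)).
    by exists (b *: u) => //; apply: sZ => //; apply: lal.
  by rewrite scalerA [a * b]mulrC -scalerA -scalerBr; apply: sB => //; apply: lal.
- have [n2 g] := gZ; exists n2 => n n2n; apply: sle_trans (g n.+1 (leqW n2n)) _.
  apply: sadd_lub; last by apply: sle_trans (@BC _) (@sadd_r _ _ _ _).
  apply: sadd_lub; last exact: sadd_l.
  by move=> v h; apply: sadd_r; apply: sadd_l.
have [|p hp] := @poly_of_diff (fun n => ln (B n) (Z n)) (c - k) (maxn n1 n2).
  move=> n; rewrite geq_max => /andP[/hk ek /hc ec].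
  have [_ e1] := ln_add (@BK n) (@KZ n) (fin_sub (@sle_refl _ _ _) (KZ n) (fZ n))
    (fin_sub (BK n) (@sle_refl _ _ _) (fZ n)).
  have [_ e2] := ln_add (@BC n) (@CZ n) (fin_sub (@sle_refl _ _ _) (CZ n) (fZ n.+1))
    (fin_sub (BC n) (@sle_refl _ _ _) (fZ n.+1)).
  (* Since a identifies Z_n / K_n with C_n / B_(n+1), consecutive lengths differ by cokernel minus
     kernel. *)
  have q : qiso (fun v => a *: v) (K n) (Z n) (B n.+1) (C n).
    split=> //; first exact: lin_scale.
    - by move=> v Zv; apply: sadd_l; exists v.
    - by move=> v Zv; split=> [[]|].
    - by move=> w [_ [v Zv ->] h]; exists v.
  have [_ e3] := qiso_ln q.
  by rewrite e1 e2 -e3 !natrD ek ec !hornerE; ring.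
by exists p, (maxn n1 n2).
Qed.

End HilbertSerre.

(** * Nakayama and finite length over a local ring *)

Section LocalLength.
Variables (A : comNzRingType) (m : sub A^o).
Hypothesis m1 : ~ m 1.
Hypothesis m_unit : forall a : A, ~ m a -> exists b : A, b * a = 1.
Hypothesis nA : noeth A^o.
Implicit Types V W : lmodType A.

Definition prime_sub (p : sub A^o) :=
  ~ p 1 /\ forall a b : A, p (a * b) -> p a \/ p b.

Lemma m_prime : prime_sub m.
Proof.
split=> // a b mab; apply: contrapT => /not_orP [/m_unit [a' ea] /m_unit [b' eb]].
apply: m1; have -> : (1 : A) = (a' * b') * (a * b) by rewrite mulrACA ea eb mulr1.
exact: (memZ (S := m)).
Qed.

Lemma proper_le_m (J : sub A^o) : ~ J 1 -> sle J m.
Proof.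
move=> J1 a Ja; apply: contrapT => /m_unit [b ba]; apply: J1; rewrite -ba.
exact: (memZ (S := J)).
Qed.

Lemma prime_exp (p : sub A^o) (z : A) e : prime_sub p -> p (z ^+ e) -> p z.
Proof.
by case=> p1 pM; elim: e => [|e IH]; rewrite ?expr0 // exprS => /pM [].
Qed.

(* A maximal annihilator is prime. *)
Lemma assoc_prime V (S T : sub V) : ~ sle T S ->
  exists u, [/\ T u, ~ S u & prime_sub (sann S u)].
Proof.
move=> TS.
have [|J [u [Tu Su ->]] mx] := @noeth_max _ _
    (fun J => exists u, [/\ T u, ~ S u & J = sann S u]) nA.
  have [u /not_implyP [Tu Su]] : exists u, ~ (T u -> S u).
    by apply/existsNP => h; apply: TS.
  by exists (sann S u), u.
exists u; split=> //; split=> [|a b Sab]; first by rewrite sannE scale1r.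
have [Sb|Sb] := pselect (S (b *: u)); first by right.
left; apply: (mx (sann S (b *: u))).
- by exists (b *: u); split=> //; apply: memZ.
- move=> c; rewrite !sannE scalerA mulrC -scalerA; exact: memZ.
- by rewrite sannE scalerA.
Qed.

(** Take T maximal among the submodules that contain B but not Z. For y in Z outside T one has Z <=
    T + Ay, so (1 - x a) y lies in T for some a, with 1 - x a a unit. *)
Lemma nakayama V (B Z : sub V) (x : A) : noeth V -> m x ->
  sle Z (sadd B (sscale x Z)) -> sle Z B.
Proof.
move=> nV mx ZB; apply: contrapT => nZB.
have [|T [BT nZT] Tm] := @noeth_max _ _ (fun T => sle B T /\ ~ sle Z T) nV.
  by exists B; split=> // v.
have [y /not_implyP [Zy nTy]] : exists u, ~ (Z u -> T u) by apply/existsNP => h; apply: nZT.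
have ZT : sle Z (sadd T (scyc y)).
  apply: contrapT => h; have /Tm/(_ (@sadd_l _ _ _ _)) :
      sle B (sadd T (scyc y)) /\ ~ sle Z (sadd T (scyc y)).
    by split=> //; apply: sle_trans BT _; apply: sadd_l.
  by move/(_ y (sadd_r (scyc_mem y))).
have [b Bb [z Zz e]] := ZB _ Zy.
have /sadd_cyc [a Tza] := ZT _ Zz.
have Ty : T ((1 - x * a) *: y).
  have -> : (1 - x * a) *: y = b + x *: (z - a *: y).
    by rewrite scalerBl scale1r scalerBr scalerA -e addrA [b + _]addrC subrK.
  by apply: memD; [exact: BT | exact: memZ].
have [|c ec] := m_unit (a := 1 - x * a).
  move=> h; apply: m1; have -> : (1 : A) = (1 - x * a) + x * a by rewrite subrK.
  by apply: memD => //; rewrite mulrC; apply: (memZ (S := m)).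
by apply: nTy; rewrite -[y]scale1r -ec -scalerA; apply: memZ.
Qed.

(** (S + Au) / S is a quotient of A / m, so it has length at most 1. *)
Lemma fin_step V (S : sub V) (u : V) : (forall z : A, m z -> S (z *: u)) ->
  fin S (sadd S (scyc u)).
Proof.
move=> mu; have H Y : sle S Y -> sle Y (sadd S (scyc u)) ->
    sle Y S \/ sle (sadd S (scyc u)) Y.
  move=> SY YS; have [|/existsNP [v /not_implyP [Yv Sv]]] := pselect (sle Y S); first by left.
  right; apply: sadd_lub => //; apply: scyc_le.
  have /sadd_cyc [a Sva] := YS _ Yv.
  have [ma|/m_unit [b ba]] := pselect (m a).
    by case: Sv; apply: memBl Sva; apply: mu.
  rewrite -[u]scale1r -ba -scalerA; apply: memZ; apply: memBr Yv _.
  exact: SY.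
exists 1%N => -[|[|n]] // [Y [[Y' [/clen_sle SY' Y'Y YY']] YZ ZY]].
have SY := sle_trans SY' Y'Y.
case: (H Y SY YZ) => // YS; case: YY'.
exact: sle_trans YS SY'.
Qed.

(** If u has prime annihilator modulo S, that prime contains a power of each element of m, hence m
    itself; so S + Au adds finite length, and noetherian induction continues from there. *)
Lemma fin_nilp V (S T : sub V) : noeth V -> sle S T ->
  (forall z : A, m z -> exists e, forall v, T v -> S (z ^+ e *: v)) -> fin S T.
Proof.
move=> nV; move: S; apply: noeth_ind => // S IH ST h.
have [TS|/assoc_prime [u [Tu Su pu]]] := pselect (sle T S).
  have -> : S = T by apply: sle_anti.
  by case: (ln_id T).
have SuT : sle (sadd S (scyc u)) T by apply: sadd_lub => //; apply: scyc_le.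
have f1 : fin S (sadd S (scyc u)).
  apply: fin_step => z /h [e he].
  by have := @prime_exp _ z e pu; apply; apply: he.
have f2 : fin (sadd S (scyc u)) T.
  apply: IH => //; first exact: sadd_l.
    by move/(_ _ (sadd_r (scyc_mem u))).
  by move=> z /h [e he]; exists e => v /he; apply: sadd_l.
exact: (ln_add (@sadd_l _ _ _ _) SuT f1 f2).1.
Qed.

End LocalLength.

(** * Dimension and Hilbert-Samuel functions *)

Section Growth.
Import Num.Theory Order.TTheory.
Variables (A : comNzRingType) (m : sub A^o).
Hypothesis m1 : ~ m 1.
Hypothesis m_unit : forall a : A, ~ m a -> exists b : A, b * a = 1.
Hypothesis nA : noeth A^o.
Variable l : seq A.
Implicit Types V W : lmodType A.

Lemma gen_act V (S : sub V) (c : A) v : gen l (@top A A^o) c -> S v -> gen l S (c *: v).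
Proof.
move=> lc Sv; have : sle (gen l (@top A A^o)) (spre (lin_act v) (gen l S)).
  apply: gen_le => a b al _; rewrite spreE -[_ *: b]/(a * _) -scalerA.
  by apply: gen_in => //; apply: memZ.
by apply.
Qed.

(* m is nilpotent modulo (S : W) + (l). *)
Definition nilmod W (S : sub W) := forall z : A, m z ->
  exists e (c : A), gen l (@top A A^o) c /\ forall w, S ((z ^+ e - c) *: w).

Lemma nilmod_le W (S T : sub W) : sle S T -> nilmod S -> nilmod T.
Proof. by move=> ST h z /h [e [c [lc Sc]]]; exists e, c; split=> // w; apply/ST/Sc. Qed.

Lemma nilmod_pow W (S U : sub W) (z : A) n : nilmod S -> m z ->
  exists e, forall v, U v -> sadd S (pow l n U) (z ^+ e *: v).
Proof.
move=> h /h [e [c [lc Sc]]]; exists (n * e)%N => v Uv; elim: n => [|n IH].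
  by rewrite mul0n expr0 scale1r; apply: sadd_r.
rewrite mulSn exprD -scalerA; case: IH => s Ss.
move: (z ^+ (n * e) *: v) => w Lw.
have -> : z ^+ e *: w = (z ^+ e *: s + (z ^+ e - c) *: (w - s)) + c *: (w - s).
  by rewrite -addrA -scalerDl subrK -scalerDr [s + _]addrC subrK.
apply: saddI; first by apply: memD; [apply: memZ | apply: Sc].
exact: gen_act.
Qed.

Lemma nilmod_fin W (S : sub W) n : noeth W -> nilmod S -> fin (sadd S (pow l n top)) top.
Proof.
move=> nW h; apply: (fin_nilp m_unit nA nW) => // z mz.
by have [e he] := nilmod_pow top n h mz; exists e => v _; apply: he.
Qed.

Definition prime_chain (J : sub A^o) k (p : nat -> sub A^o) :=
  [/\ sle J (p 0%N), forall i, (i <= k)%N -> prime_sub (p i)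
    & forall i, (i < k)%N -> sle (p i) (p i.+1) /\ ~ sle (p i.+1) (p i)].

(** The dimension of A / J is less than k; for k = 0, no prime contains J. *)
Definition nochain J k := forall p, ~ prime_chain J k p.

Lemma nochain_le J J' k : sle J J' -> nochain J k -> nochain J' k.
Proof.
move=> JJ h p [Jp pp pi]; apply: (h p); split=> //; exact: sle_trans Jp.
Qed.

(** The annihilator of W / S. *)
Definition colon W (S : sub W) : sub A^o.
Proof.
exists (fun a => forall w, S ((a : A) *: w)).
  by move=> w; rewrite scale0r; apply: mem0.
move=> a u v hu hv w; rewrite scalerDl -scalerA; apply: memP; first exact: hu.
exact: hv.
Defined.

Lemma nochain0 W (S : sub W) : nochain (colon S) 0 -> sle top S.
Proof.
move=> h w _; apply: contrapT => Sw; apply: (h (fun=> m)); split=> //.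
  by apply: (proper_le_m m_unit) => h1; apply: Sw; rewrite -[w]scale1r; apply: h1.
by move=> i _; apply: (m_prime m1 m_unit).
Qed.

Lemma pow_gen n : (0 < n)%N -> sle (pow l n (@top A A^o)) (gen l top).
Proof. by case: n => // n _; rewrite powS; apply: gen_mono. Qed.

(** The growth allowed in dimension less than k, of degree k - 1. In dimension less than 0 the
    module vanishes. *)
Let bound (C k n : nat) := if k is k'.+1 then (C * n ^ k')%N else 0%N.

(* For a in (l) outside of p, multiplication by a maps A / (p + I^n) to
   A / (p + I^(n+1)) with cokernel A / (p + aA + I^(n+1)). *)
Lemma growth_prime k (p : sub A^o) : prime_sub p -> nilmod p -> nochain p k.+1 ->
  (forall S : sub A^o, nilmod S -> nochain S k ->
     exists C, forall n, (ln (sadd S (pow l n top)) top <= bound C k n)%N) ->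
  exists C, forall n, (ln (sadd p (pow l n top)) top <= C * n ^ k)%N.
Proof.
move=> pp np ncp IH; have fp n := nilmod_fin n nA np.
(* If (l) lies in p, then p + (l)^n = p for n > 0 and the length is constant; for n = 0 it is
   zero. *)
have [lp|/existsNP [a /not_implyP [al pa]]] := pselect (forall a, a \in l -> p a).
  exists (ln p top) => -[|n].
    by rewrite (_ : sadd p _ = top) ?(ln_id top).2 //; apply: sle_anti => // v _; apply: sadd_r.
  have E : sadd p (pow l n.+1 top) = p.
    apply: sle_anti; last exact: sadd_l.
    apply: sadd_lub => //; apply: sle_trans (pow_gen _) _ => //.
    by apply: gen_le => b v bl _; rewrite -[_ *: v]/(b * v) mulrC; apply: memZ; apply: lp.
  by rewrite E leq_pmulr // expn_gt0.
pose q := sadd p (scyc (a : A^o)).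
have qa : q a by apply: sadd_r; apply: scyc_mem.
have [||C hC] := IH q; first by apply: nilmod_le np; apply: sadd_l.
  (* A chain above q can be prolonged downwards by p, as a lies in q but not in p. *)
  move=> c [qc cp ci]; apply: (ncp (fun i => if i is i'.+1 then c i' else p)).
  split=> // [[|i]|[|i]] //; first exact: cp.
    split; first by apply: sle_trans qc; apply: sadd_l.
    by move=> h; apply: pa; apply: h; apply: qc.
  exact: ci.
have step n : (ln (sadd p (pow l n.+1 top)) top <=
    ln (sadd p (pow l n top)) top + ln (sadd q (pow l n.+1 top)) top)%N.
  have le1 : sle (sadd p (pow l n.+1 (@top A A^o))) (sadd q (pow l n.+1 top)).
    by apply: sadd_mono => //; apply: sadd_l.
  have [_ ->] := ln_add le1 (@sle_top _ _ _) (fin_sub (@sle_refl _ _ _) (@sle_top _ _ _) (fp n.+1))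
    (fin_sub le1 (@sle_refl _ _ _) (fp n.+1)).
  rewrite leq_add2r.
  apply: (ln_iso_ge (f := fun b : A^o => (b : A) *: (a : A^o)) _ _ le1 _ _ _ (fp n)).2 => //.
  - exact: lin_act.
  - have : sle (sadd p (pow l n top)) (spre (lin_act (a : A^o)) (sadd p (pow l n.+1 top))).
      apply: sadd_lub => v hv; rewrite spreE -[_ *: _]/(v * a) mulrC.
        by apply: sadd_l; apply: (memZ (S := p)).
      by apply: sadd_r; rewrite powS; apply: gen_in.
    by apply.
  - by move=> v _; apply: sadd_l; apply: (memZ (S := q)).
  - move=> w [s [p' pp' /scycP [b e]] h]; exists b => //; exists p' => //.
    by rewrite -e opprB addrA addrAC addrK.
exists C; case: k ncp IH hC => [|k] _ _ hC; rewrite /bound in hC.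
  elim=> [|n IHn].
    by rewrite (_ : sadd p _ = top) ?(ln_id top).2 //; apply: sle_anti => // v _; apply: sadd_r.
  rewrite expn0 muln1 in IHn *.
  by apply: leq_trans (step n) _; have := hC n.+1; rewrite leqn0 => /eqP ->; rewrite addn0.
(* The increments add up by n^(k+1) + (n+1)^k <= (n+1)^(k+1). *)
elim=> [|n IHn].
  by rewrite (_ : sadd p _ = top) ?(ln_id top).2 //; apply: sle_anti => // v _; apply: sadd_r.
apply: leq_trans (step n) _; apply: leq_trans (leq_add IHn (hC n.+1)) _.
rewrite -mulnDr leq_mul2l [X in _ || (_ <= X)%N]expnS mulSn addnC leq_add2l expnS.
by rewrite leq_mul ?orbT //; case: (k) => // j; rewrite leq_exp2r.
Qed.

(** Devissage, by induction on k and, inside, noetherian induction on S: with p = (S : u) prime, the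
    step from S to S + Au contributes at most the length for A / p, which [growth_prime] bounds. *)
Lemma growth_bound k W (S : sub W) : noeth W -> nilmod S -> nochain (colon S) k ->
  exists C, forall n, (ln (sadd S (pow l n top)) top <= bound C k n)%N.
Proof.
elim: k W S => [|k IHk] W S nW.
  move=> _ /nochain0 TS; exists 0%N => n; rewrite leqn0.
  by rewrite (_ : sadd S _ = top) ?(ln_id top).2 //; apply: sle_anti => // v _; apply: sadd_l; apply: TS.
move: S; apply: noeth_ind => // S IHS nS ncS; have fS n := nilmod_fin n nW nS.
have [TS|/(assoc_prime nA) [u [_ Su pu]]] := pselect (sle top S).
  exists 0%N => n.
  by rewrite (_ : sadd S _ = top) ?(ln_id top).2 //; apply: sle_anti => // v _; apply: sadd_l; apply: TS.
pose S' := sadd S (scyc u); pose p := sann S u.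
have SS' : sle S S' by apply: sadd_l.
have [C1 h1] : exists C, forall n, (ln (sadd S' (pow l n top)) top <= bound C k.+1 n)%N.
  apply: IHS => //; first by move/(_ _ (sadd_r (scyc_mem u))).
    exact: nilmod_le nS.
  by apply: nochain_le ncS => a ha w; apply: SS'; apply: ha.
have [| | |C2 h2] := growth_prime (p := p) (k := k) pu.
- move=> z /nS [e [c [lc Sc]]]; exists e, c; split=> // w.
  by rewrite /p sannE -scalerA; apply: Sc.
- by apply: nochain_le ncS => a ha; rewrite /p sannE; apply: ha.
- move=> J nJ ncJ; apply: IHk => //; apply: nochain_le ncJ => a ja w.
  by rewrite -[_ *: w]/(a * w) mulrC; apply: memZ.
exists (C1 + C2)%N => n; rewrite /bound mulnDl.
have le1 : sle (sadd S (pow l n top)) (sadd S' (pow l n top)) by apply: sadd_mono.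
have [_ ->] := ln_add le1 (@sle_top _ _ _) (fin_sub (@sle_refl _ _ _) (@sle_top _ _ _) (fS n))
    (fin_sub le1 (@sle_refl _ _ _) (fS n)).
rewrite addnC; apply: leq_add (h1 n) _; apply: leq_trans (h2 n).
have np : nilmod p.
  move=> z /nS [e [c [lc Sc]]]; exists e, c; split=> // w.
  by rewrite /p sannE -scalerA; apply: Sc.
apply: (ln_iso_ge (f := fun b : A^o => (b : A) *: u) _ _ le1 _ _ _ (nilmod_fin n nA np)).2 => //.
- exact: lin_act.
- have : sle (sadd p (pow l n top)) (spre (lin_act u) (sadd S (pow l n top))).
    apply: sadd_lub => v hv; rewrite spreE; first by apply: sadd_l.
    apply: sadd_r; have : sle (pow l n (@top A A^o)) (spre (lin_act u) (pow l n top)).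
      move=> w hw; rewrite spreE; have : sim (lin_act u) (pow l n top) (w *: u) by exists w.
      by rewrite pow_sim; apply: pow_mono.
    exact.
  by apply.
- by move=> v _; apply: sadd_l; apply: sadd_r; apply/memZ/scyc_mem.
- move=> w [s [s' Ss' /scycP [b e]] h]; exists b => //; exists s' => //.
  by rewrite -e opprB addrA addrAC addrK.
Qed.

Theorem growth k W (S : sub W) : noeth W -> nilmod S -> nochain (colon S) k.+1 ->
  exists C, forall n, (ln (sadd S (pow l n top)) top <= C * n ^ k)%N.
Proof. exact: (@growth_bound k.+1). Qed.

End Growth.

(** * Artin-Rees and the length of (U \cap I^n V) / I^n U *)

Section ReesLength.
Import Num.Theory Order.TTheory.
Variables (A : comNzRingType) (m : sub A^o).
Hypothesis m1 : ~ m 1.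
Hypothesis m_unit : forall a : A, ~ m a -> exists b : A, b * a = 1.
Hypothesis nA : noeth A^o.
Variables (l : seq A) (V : lmodType A) (U : sub V).
Hypothesis nV : noeth V.
Hypothesis nilV : nilmod m l (bot : sub V).

Let Z n := scap U (pow l n top).
Let B n := pow l n U.

Lemma rees_le n : sle (pow l n U) (scap U (pow l n top)).
Proof. by move=> v h; split; [apply: pow_sub h | apply: pow_mono h]. Qed.

(** The U \cap I^n V form a graded submodule of the Rees module of V, which is generated in degree
    0. *)
Lemma rees_generates : generates l Z (fun=> bot).
Proof.
have sT : stable l (fun n => pow l n (@top _ V)).
  by move=> a n v al h; rewrite powS; apply: gen_in.
apply: (graded_noeth nV sT).
- by move=> a n v _ ->; rewrite scaler0; apply: mem0.
- by move=> a n v al [Uv hv]; split; [apply: memZ | apply: sT].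
- by move=> n v ->; apply: mem0.
- by move=> n v [].
- by exists 0%N => n _; rewrite powS; apply: sadd_l.
Qed.

Lemma artin_rees : exists n0, forall k, sle (Z (k + n0)%N) (pow l k (Z n0)).
Proof.
have [n0 h] := rees_generates; exists n0; elim=> [|k IH] //.
rewrite addSn powS; apply: sle_trans (h _ (leq_addl _ _)) _.
by apply: sadd_lub => [|v ->]; [apply: gen_mono | apply: mem0].
Qed.

Lemma pow_nilp (S : sub V) z n : m z ->
  exists e, forall v, S v -> pow l n S (z ^+ e *: v).
Proof.
move=> mz; have [e he] := nilmod_pow S n nilV mz; exists e => v /he [s -> ].
by rewrite subr0.
Qed.

(** With n0 the Artin-Rees number, it is enough that z^e U lies in I^n0 U: the exponent depends on
    n0 and not on n. *)
Lemma rees_kill z : m z ->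
  exists e, forall n v, scap U (pow l n top) v -> pow l n U (z ^+ e *: v).
Proof.
move=> mz; have [n0 h] := artin_rees; have [e he] := pow_nilp U n0 mz.
exists e => n v Zv; have [n0n|/ltnW nn0] := leqP n0 n.
  rewrite -(subnK n0n) in Zv *; rewrite powD.
  have /h hv := Zv.
  have : sim (@lin_scale _ V (z ^+ e)) (pow l (n - n0) (Z n0)) (z ^+ e *: v) by exists v.
  rewrite pow_sim; apply: pow_mono => _ [w [Uw _] ->]; exact: he.
by apply: pow_le nn0 _ _; apply: he; case: Zv.
Qed.

Lemma rees_fin n : fin (pow l n U) (scap U (pow l n top)).
Proof.
apply: (fin_nilp m_unit nA nV); first exact: rees_le.
by move=> z /rees_kill [e he]; exists e => v; apply: he.
Qed.

Lemma pow_fin n k : (n <= k)%N -> fin (pow l k (@top _ V)) (pow l n top).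
Proof.
move=> nk; apply: (fin_nilp m_unit nA nV); first exact: pow_le.
move=> z mz; have [e he] := pow_nilp top k mz; exists e => v _; exact: he.
Qed.

(** The Hilbert-Samuel polynomial Q of V has degree at most t by [growth]. With n0 the Artin-Rees
    number, Q(n + n0) - Q(n) dominates the length in question and has one degree less. *)
Theorem rees_hilbert t : nochain (colon (bot : sub V)) t.+1 ->
  exists p : {poly rat}, (size p <= t)%N /\ exists n0, forall n, (n0 <= n)%N ->
    (ln (pow l n U) (scap U (pow l n top)))%:R = p.[n%:R].
Proof.
move=> nc; have [n0 AR] := artin_rees.
have sT : stable l (fun n => pow l n (@top _ V)).
  by move=> a n v al h; rewrite powS; apply: gen_in.
have sZ : stable l Z by move=> a n v al [Uv hv]; split; [apply: memZ | apply: sT].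
have sB : stable l B by move=> a n v al h; rewrite /B powS; apply: gen_in.
have ZB k : sle (Z (k + n0)%N) (B k).
  by apply: sle_trans (AR k) _; apply: pow_mono => v [].
have [|p [n1 hp]] := hilbert_serre nV sZ sB rees_le _ rees_fin.
  by apply: generates_mono rees_generates => n v ->; apply: mem0.
have [||||h [n2 hh]] := @hilbert_serre A V nV l (fun n => pow l n top) (fun n => pow l n.+1 top) sT.
- by move=> a n v al hv; rewrite powS; apply: gen_in.
- by move=> n; apply: pow_le.
- by exists 0%N => n _; rewrite powS; apply: sadd_l.
- by move=> n; apply: pow_fin.
pose f n := ln (pow l n top) (@top _ V).
have fD n k : f (n + k)%N = (ln (pow l (n + k) top) (pow l n (@top _ V)) + f n)%N.
  by apply: (ln_add _ (@sle_top _ _ _) _ (pow_fin (leq0n n))).2;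
    [apply: pow_le; apply: leq_addr | apply: pow_fin; apply: leq_addr].
have [|Q hQ] := @poly_of_diff f h n2.
  by move=> n /hh <-; rewrite -addn1 fD addn1 natrD addrK.
have [C hC] := growth m1 m_unit nA nV nilV nc.
have sQ : (size Q <= t.+1)%N.
  rewrite -(size_polyXn rat t); apply: (@size_dominated _ _ C n2) => n /hQ <-.
  rewrite ler0n hornerXn -natrX -natrM ler_nat; apply: leq_trans (hC n).
  by rewrite (_ : sadd bot _ = pow l n top) //; apply: sle_anti;
    [apply: sadd_lub => // v ->; apply: mem0 | apply: sadd_r].
exists p; split; last by exists n1.
have sd := size_shift_diff Q n0.
apply: (@leq_trans (size (Q \Po ('X + n0%:R%:P) - Q)%R)); last first.
  by apply: leq_trans sd _; case: (size Q) sQ.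
apply: (@size_dominated _ _ 1 (maxn n1 n2)) => n; rewrite geq_max => /andP[/hp <- n2n].
rewrite ler0n mul1r hornerD hornerN horner_comp hornerD hornerX hornerC -natrD -!hQ //;
  last exact: leq_trans n2n (leq_addr _ _).
rewrite fD natrD addrK ler_nat /=.
have le1 : sle (Z (n + n0)%N) (Z n).
  by move=> v [Uv hv]; split=> //; apply: pow_le hv; apply: leq_addr.
apply: (@leq_trans (ln (Z (n + n0)%N) (Z n))).
  apply: ln_mono => //; first exact: rees_le.
  apply: (ln_inj_le (f := id) _ le1 (pow_le (leq_addr n0 n)) _ _ (pow_fin (leq_addr n0 n))).1 => //.
    by move=> v [].
  by move=> v [Uv hv]; split=> [[]|].
apply: (ln_inj_le (f := id) _ le1 (pow_le (leq_addr n0 n)) _ _ (pow_fin (leq_addr n0 n))).2 => //.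
  by move=> v [].
by move=> v [Uv hv]; split=> [[]|].
Qed.

End ReesLength.

(** Dependent choice for stages of varying type; the invariant P records that one more stage can be
    built. *)
Lemma dep_choice (T : nat -> Type) (P : forall j, T j -> Prop)
    (R : forall j, T j -> T j.+1 -> Prop) (x0 : T 0%N) :
  P 0%N x0 -> (forall j x, P j x -> exists2 y, P j.+1 y & R j x y) ->
  exists f : forall j, T j, [/\ f 0%N = x0, forall j, P j (f j)
    & forall j, R j (f j) (f j.+1)].
Proof.
move=> P0 step.
have next j (x : {x | P j x}) : {y : {y | P j.+1 y} | R j (projT1 x) (projT1 y)}.
  apply: cid; have [y Py Rxy] := step _ _ (projT2 x).
  by exists (exist _ y Py).
pose g := fix g j : {x | P j x} :=
  if j is j'.+1 then projT1 (next j' (g j')) else exist _ x0 P0.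
exists (fun j => projT1 (g j)); split=> // j; first exact: projT2.
exact: (projT2 (next j (g j))).
Qed.

(** * Free resolutions and their comparison *)

Section Complexes.
Variable A : comNzRingType.
Implicit Types L V W X : lmodType A.

Record cx := Cx { rk : nat -> nat; df : forall i, 'M[A]_(rk i.+1, rk i) }.
Implicit Types D : cx.

(* D_(-1) = 0. *)
Definition rk_in (b : nat -> nat) j := if j is j'.+1 then b j' else 0%N.

Definition df_in D j : 'M[A]_(rk D j, rk_in (rk D) j) :=
  match j return 'M_(rk D j, rk_in (rk D) j) with 0%N => 0 | j'.+1 => df D j' end.

Definition iscx D := forall j, df D j *m df_in D j = 0.

Definition acyc D := iscx D /\ forall j, exact_on A^o (df D j.+1) (df D j).

(* The chain complex D (c = true) and its dual (c = false) around position j. *)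
Definition rin (c : bool) D j := if c then rk D j.+1 else rk_in (rk D) j.
Definition rout (c : bool) D j := if c then rk_in (rk D) j else rk D j.+1.

Definition inM c D j : 'M[A]_(rin c D j, rk D j) :=
  match c return 'M_(rin c D j, rk D j) with true => df D j | false => (df_in D j)^T end.

Definition outM c D j : 'M[A]_(rk D j, rout c D j) :=
  match c return 'M_(rk D j, rout c D j) with true => df_in D j | false => (df D j)^T end.

Definition spB c D j X : sub {ffun 'I_(rk D j) -> X} :=
  sim (mxmap_lin (X := X) (inM c D j)) top.

Definition spZ c D j X : sub {ffun 'I_(rk D j) -> X} :=
  spre (mxmap_lin (X := X) (outM c D j)) bot.

Definition exact c D j X := sle (spZ c D j X) (spB c D j X).

Lemma spZP c D j X x : spZ c D j X x <-> mxmap X (outM c D j) x = 0.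
Proof. by []. Qed.

Lemma spBP c D j X x : spB c D j X x <-> exists y, x = mxmap X (inM c D j) y.
Proof. by split=> [[y _ ->]|[y ->]]; exists y. Qed.

Lemma exactP c D j X : exact c D j X <-> exact_on X (inM c D j) (outM c D j).
Proof.
split=> h x.
  by move=> /spZP/h /spBP.
by move=> /spZP/h /spBP.
Qed.

Lemma inM_outM c D j : iscx D -> inM c D j *m outM c D j = 0.
Proof.
by move=> /(_ j) h; case: c => //=; rewrite -trmx_mul h trmx0.
Qed.

Lemma spBZ c D j X : iscx D -> sle (spB c D j X) (spZ c D j X).
Proof.
by move=> cD x /spBP [y ->]; apply/spZP; rewrite -mxmapM inM_outM // mxmap0l.
Qed.

(* A map between the complexes (P, Q) and (P', Q') with a left inverse up to
   homotopy; the condition is stable under transposition. *)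
Definition spot_retract p q r p' q' r' (P : 'M[A]_(p, q)) (Q : 'M[A]_(q, r))
    (P' : 'M[A]_(p', q')) (Q' : 'M[A]_(q', r')) : Prop :=
  exists (a : 'M_(q, q')) (a1 : 'M_(p, p')) (a2 : 'M_(r, r'))
    (b : 'M_(q', q)) (b1 : 'M_(p', p)) (b2 : 'M_(r', r)) (h : 'M_(r, q)) (k : 'M_(q, p)),
    [/\ P *m a = a1 *m P' /\ a *m Q' = Q *m a2, P' *m b = b1 *m P,
        b *m Q = Q' *m b2 & a *m b = 1%:M + Q *m h + k *m P].

Lemma spot_retract_tr p q r p' q' r' (P : 'M_(p, q)) (Q : 'M_(q, r))
    (P' : 'M_(p', q')) (Q' : 'M_(q', r')) :
  spot_retract P Q P' Q' -> spot_retract Q^T P^T Q'^T P'^T.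
Proof.
case=> a [a1 [a2 [b [b1 [b2 [h [k [[e1 e2] e3 e4 e5]]]]]]]].
exists b^T, b2^T, b1^T, a^T, a2^T, a1^T, k^T, h^T.
by rewrite -!trmx_mul e1 e2 e3 e4 e5 !linearD /= !trmx_mul trmx1 addrAC.
Qed.

Lemma spot_retract_exact p q r p' q' r' (P : 'M_(p, q)) (Q : 'M_(q, r))
    (P' : 'M_(p', q')) (Q' : 'M_(q', r')) X :
  spot_retract P Q P' Q' -> forall x, mxmap X Q x = 0 ->
    exists x', mxmap X Q' x' = 0 /\
      ((exists y, x' = mxmap X P' y) -> exists y, x = mxmap X P y).
Proof.
case=> a [a1 [a2 [b [b1 [b2 [h [k [[e1 e2] e3 e4 e5]]]]]]]] x Qx.
exists (mxmap X a x); split.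
  by rewrite -mxmapM e2 mxmapM Qx (lin0 (mxmap_lin _)).
case=> y e; exists (mxmap X b1 y - mxmap X k x).
rewrite (linB _ _ (mxmap_lin _)) -!mxmapM -e3 [in X in X - _]mxmapM -e -mxmapM e5.
by rewrite !mxmapDl mxmap1 [mxmap X (Q *m h) x]mxmapM Qx (lin0 (mxmap_lin _)) addr0 addrK.
Qed.

Definition hom_equiv D D' := forall j,
  spot_retract (df D j) (df_in D j) (df D' j) (df_in D' j).

Lemma hom_equiv_sp D D' c j : hom_equiv D D' ->
  spot_retract (inM c D j) (outM c D j) (inM c D' j) (outM c D' j).
Proof. by move=> /(_ j) h; case: c => //=; apply: spot_retract_tr. Qed.

Lemma hom_equiv_exact D D' c j X : hom_equiv D D' -> exact c D' j X -> exact c D j X.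
Proof.
move=> /(hom_equiv_sp c j) h /exactP e; apply/exactP => x Qx.
by have [x' [/e Qx' H]] := spot_retract_exact h Qx; apply: H.
Qed.

Lemma hom_equiv_ln D D' c j X : iscx D -> iscx D' -> hom_equiv D D' ->
  fin (spB c D' j X) (spZ c D' j X) ->
  fin (spB c D j X) (spZ c D j X) /\
  (ln (spB c D j X) (spZ c D j X) <= ln (spB c D' j X) (spZ c D' j X))%N.
Proof.
move=> cD cD' /(hom_equiv_sp c j) h f'.
case: (h) => a [a1 [a2 [b [b1 [b2 [h1 [k [[e1 e2] e3 e4 e5]]]]]]]].
apply: (ln_inj_le (f := mxmap X a)) => //.
- exact: mxmap_lin.
- exact: spBZ.
- exact: spBZ.
- by move=> x /spZP Qx; apply/spZP; rewrite -mxmapM e2 mxmapM Qx (lin0 (mxmap_lin _)).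
move=> x /spZP Qx; split=> [/spBP [y ->]|/spBP [y e]]; apply/spBP.
  by exists (mxmap X a1 y); rewrite -!mxmapM e1.
exists (mxmap X b1 y - mxmap X k x).
rewrite (linB _ _ (mxmap_lin _)) -!mxmapM -e3 [in X in X - _]mxmapM -e -mxmapM e5.
by rewrite !mxmapDl mxmap1 [mxmap X (outM c D j *m h1) x]mxmapM Qx (lin0 (mxmap_lin _)) addr0 addrK.
Qed.

Lemma df_in_exact D j k (M : 'M[A]_(k, rk D j.+1)) : acyc D -> M *m df_in D j.+1 = 0 ->
  exists U, M = U *m df D j.+1.
Proof. by case=> _ e; apply: ex_mx. Qed.

Lemma chain_lift D D' (a0 : 'M[A]_(rk D 0%N, rk D' 0%N)) : iscx D -> acyc D' ->
  (exists b, df D 0%N *m a0 = b *m df D' 0%N) ->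
  exists a : forall j, 'M[A]_(rk D j, rk D' j),
    a 0%N = a0 /\ forall j, df D j *m a j = a j.+1 *m df D' j.
Proof.
move=> cD aD' h0.
have [|f [f0 _ fR]] := @dep_choice (fun j => 'M[A]_(rk D j, rk D' j))
   (fun j a => exists b, df D j *m a = b *m df D' j)
   (fun j a b => df D j *m a = b *m df D' j) a0 h0; last by exists f.
move=> j a [b e]; exists b => //; apply: df_in_exact => //.
by rewrite -mulmxA /= -e mulmxA (cD j.+1) mul0mx.
Qed.

Lemma null_homotopy D (f : forall j, 'M[A]_(rk D j)) : acyc D ->
  (forall j, df D j *m f j = f j.+1 *m df D j) ->
  (exists k, f 0%N = k *m df D 0%N) ->
  forall j, exists h k, f j = df_in D j *m h + k *m df D j.
Proof.
move=> aD fD [k0 f0]; elim=> [|j [h [k e]]].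
  by exists 0, k0; rewrite f0 mulmx0 add0r.
have [|k' e'] := @df_in_exact D j _ (f j.+1 - df D j *m k) aD.
  rewrite mulmxBl /= -fD e mulmxDr mulmxA (aD.1 j) mul0mx add0r !mulmxA.
  by rewrite subrr.
by exists k, k'; rewrite -e' /= addrC subrK.
Qed.

Definition lc L n (e : 'I_n -> L) (x : {ffun 'I_n -> A^o}) : L :=
  \sum_i (x i : A) *: e i.

Lemma lc_lin L n (e : 'I_n -> L) : lin (lc e).
Proof.
move=> a u v; rewrite /lc scaler_sumr -big_split; apply: eq_bigr => i _ /=.
by rewrite !ffunE scalerDl scalerA.
Qed.

Lemma lc_mem L (S : sub L) n (e : 'I_n -> L) x : (forall i, S (e i)) -> S (lc e x).
Proof. by move=> h; apply: mem_sum => i _; apply/memZ. Qed.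

Lemma lc_mxmap L p q (e : 'I_q -> L) (P : 'M[A]_(p, q)) x :
  lc e (mxmap A^o P x) = lc (fun i => lc e (rowf P i)) x.
Proof.
rewrite mxmap_rowf /lc; under [RHS]eq_bigr => i _ do rewrite scaler_sumr.
rewrite exchange_big; apply: eq_bigr => j _ /=; rewrite sum_ffunE scaler_suml.
by apply: eq_bigr => i _; rewrite !ffunE scalerA.
Qed.

Lemma lc_delta L n (e : 'I_n -> L) i : lc e (delta i (1 : A^o)) = e i.
Proof.
rewrite /lc (bigD1 i) //= ffunE eqxx scale1r big1 ?addr0 // => j ji.
by rewrite ffunE (negPf ji) scale0r.
Qed.

Lemma lc_sub L (S : sub L) n (e e' : 'I_n -> L) x :
  (forall i, S (e i - e' i)) -> S (lc e x - lc e' x).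
Proof.
move=> h; rewrite /lc -sumrB; apply: mem_sum => i _; rewrite -scalerBr; exact: memZ.
Qed.

Lemma lc_fmap L W (f : L -> W) n (e : 'I_n -> L) x : lin f -> f (lc e x) = lc (f \o e) x.
Proof.
move=> lf; rewrite /lc; elim/big_rec2: _ => [|i y z _ <-]; first exact: lin0.
by rewrite lf.
Qed.

(* D is a free resolution of T / S, augmented by e. *)
Definition augments L (S T : sub L) D (e : 'I_(rk D 0%N) -> L) : Prop :=
  [/\ forall i, T (e i),
      forall x, S (lc e x) <-> exists u, x = mxmap A^o (df D 0%N) u
    & forall v, T v -> exists x, S (v - lc e x)].

Definition res L (S T : sub L) D := acyc D /\ exists e, augments S T (D := D) e.

Lemma aug_lift L (S T : sub L) D e k (g : 'I_k -> L) : augments S T (D := D) e ->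
  (forall i, T (g i)) -> exists a : 'M[A]_(k, rk D 0%N), forall i, S (g i - lc e (rowf a i)).
Proof.
case=> _ _ h Tg; have /choice [f hf] : forall i, exists x, S (g i - lc e x).
  by move=> i; apply: h.
exists (\matrix_(i, j) (f i j : A)) => i; rewrite (_ : rowf _ i = f i) //.
by apply/ffunP => j; rewrite !ffunE mxE.
Qed.

Lemma aug_ker L (S T : sub L) D e k (M : 'M[A]_(k, rk D 0%N)) :
  augments S T (D := D) e -> (forall i, S (lc e (rowf M i))) ->
  exists U, M = U *m df D 0%N.
Proof. by case=> _ h _ SM; apply: mx_rows => i; apply/h. Qed.

Lemma rowf_delta p q (P : 'M[A]_(p, q)) i : rowf P i = mxmap A^o P (delta i (1 : A^o)).
Proof.
rewrite mxmap_rowf (bigD1 i) //= ffunE eqxx scale1r big1 ?addr0 // => j ji.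
by rewrite ffunE (negPf ji) scale0r.
Qed.

Lemma aug_df L (S T : sub L) D e i : augments S T (D := D) e ->
  S (lc e (rowf (df D 0%N) i)).
Proof. by case=> _ h _; apply/h; exists (delta i 1); rewrite rowf_delta. Qed.

(** The comparison theorem: a lift of the identity followed by a lift back differs from 1 by a map
    over 0, which is null-homotopic. A retraction up to homotopy at each spot makes homology inject,
    and exchanging D and D' gives the other inequality of lengths. *)
Theorem res_equiv L (S T : sub L) D D' : res S T D -> res S T D' -> hom_equiv D D'.
Proof.
move=> [aD [e he]] [aD' [e' he']].
have lift D1 D2 e1 e2 : acyc D1 -> acyc D2 -> augments S T (D := D1) e1 ->
    augments S T (D := D2) e2 ->
    exists a : forall j, 'M[A]_(rk D1 j, rk D2 j),
      (forall i, S (e1 i - lc e2 (rowf (a 0%N) i))) /\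
      forall j, df D1 j *m a j = a j.+1 *m df D2 j.
  move=> aD1 aD2 h1 h2; have [a0 ha0] := aug_lift h2 (let: And3 h _ _ := h1 in h).
  have [|a [ea ha]] := chain_lift (a0 := a0) aD1.1 aD2; last by exists a; rewrite ea.
  apply: (aug_ker h2) => i; rewrite rowf_mul lc_mxmap.
  apply: memBr (aug_df i h1) _; exact: lc_sub.
have [a [ha aE]] := lift _ _ _ _ aD aD' he he'.
have [b [hb bC]] := lift _ _ _ _ aD' aD he' he.
(* The square on the outgoing side; at j = 0 its outer terms are zero. *)
have prv D1 D2 (f : forall j, 'M[A]_(rk D1 j, rk D2 j)) j :
    (forall j, df D1 j *m f j = f j.+1 *m df D2 j) ->
    exists g : 'M_(rk_in (rk D1) j, rk_in (rk D2) j), f j *m df_in D2 j = df_in D1 j *m g.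
  by case: j => [|j] h; [exists 0; rewrite /= !mulmx0 | exists (f j); rewrite /= h].
have H : forall j, exists h k, a j *m b j - 1%:M = df_in D j *m h + k *m df D j.
  apply: null_homotopy => // [j|].
    by rewrite mulmxBr mulmxBl mulmxA aE -!mulmxA bC mul1mx mulmx1.
  apply: (aug_ker he) => i; rewrite !rowf_delta.
  have -> : mxmap A^o (a 0%N *m b 0%N - 1%:M) (delta i 1) =
     mxmap A^o (b 0%N) (mxmap A^o (a 0%N) (delta i 1)) - delta i 1.
    by rewrite mxmapDl mxmapNl mxmap1 mxmapM.
  rewrite (linB _ _ (lc_lin e)) lc_delta -rowf_delta.
  have h1 := ha i.
  have h2 : S (lc e' (rowf (a 0%N) i) - lc e (mxmap A^o (b 0%N) (rowf (a 0%N) i))).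
    by rewrite lc_mxmap; apply: lc_sub.
  rewrite -opprB; apply: memN; rewrite -(subrK (lc e' (rowf (a 0%N) i)) (e i)) -addrA.
  exact: memD.
move=> j; have [h [k E]] := H j.
have [a2 ea2] := prv _ _ _ j aE; have [b2 eb2] := prv _ _ _ j bC.
exists (a j), (a j.+1), a2, (b j), (b j.+1), b2, h, k; split=> //.
by rewrite -addrA -E addrC subrK.
Qed.

End Complexes.

Section Resolutions.
Variable A : comNzRingType.
Implicit Types L V W X : lmodType A.
Implicit Types D : cx A.

Lemma res_push L W (f : L -> W) S T S' T' D :
  qiso f S T S' T' -> res S T D -> res S' T' D.
Proof.
case=> lf fT fS fs _ _ [aD [e [eT eS eG]]]; split=> //; exists (f \o e).
have E x : lc (f \o e) x = f (lc e x) by rewrite lc_fmap.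
split=> [i|x|w /fs [v Tv S'wv]]; first exact: fT.
  by rewrite E -eS -fS //; apply: lc_mem.
have [x Sx] := eG _ Tv; exists x; rewrite E -(subrK (f v) w) -addrA -linB //.
apply: memD => //; apply/fS => //; apply: memB => //; exact: lc_mem.
Qed.

Lemma res_pull L W (f : L -> W) S T S' T' D :
  qiso f S T S' T' -> res S' T' D -> res S T D.
Proof.
case=> lf fT fS fs ST ST' [aD [e' [eT eS eG]]]; split=> //.
have /choice [e he] : forall i, exists v, T v /\ S' (e' i - f v).
  by move=> i; have [v Tv h] := fs _ (eT i); exists v.
have E x : S' (lc e' x - f (lc e x)).
  by rewrite lc_fmap //; apply: lc_sub => i; case: (he i).
have eT' i : T (e i) by case: (he i).
exists e; split=> // [x|v Tv].
  rewrite fS; last exact: lc_mem.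
  by rewrite -eS; split=> h; [apply: memBl h (E x) | apply: memBr h (E x)].
have [x S'x] := eG _ (fT _ Tv); exists x.
apply/fS; first by apply: memB => //; apply: lc_mem.
by rewrite linB // -(subrK (lc e' x) (f v)) -addrA; apply: memD.
Qed.

Lemma res_exists L (S T : sub L) : noeth A^o -> noeth L -> exists D, res S T D.
Proof.
move=> nA nL; have [l hl] := nL T; pose e (i : 'I_(size l)) := nth 0 l i.
have [p [P hP]] := spn_mx (spre (lc_lin e) S) nA.
(* A state packs a matrix with both its sizes, so that plain recursion can produce the dependently
   typed differentials. *)
have ker (x : {p & {q & 'M[A]_(p, q)}}) : {p' & {M : 'M[A]_(p', projT1 x) |
    M *m projT2 (projT2 x) = 0 /\ exact_on A^o M (projT2 (projT2 x))}}.
  case: x => q [r Q] /=.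
  have /cid [p' /cid [M h]] := ker_mx Q nA; by exists p', M.
pose next x : {p & {q & 'M[A]_(p, q)}} :=
  existT _ (projT1 (ker x)) (existT _ (projT1 x) (projT1 (projT2 (ker x)))).
pose st := fix st i := if i is i'.+1 then next (st i') else
  existT (fun p => {q & 'M[A]_(p, q)}) p (existT _ (size l) P).
pose D := @Cx A (fun i => projT1 (projT2 (st i))) (fun i => projT2 (projT2 (st i))).
have DP j : df D j.+1 *m df D j = 0 /\ exact_on A^o (df D j.+1) (df D j).
  by have := projT2 (projT2 (ker (st j))).
exists D; split.
  by split=> [[|j]|j]; [rewrite /= mulmx0 | exact: (DP j).1 | exact: (DP j).2].
exists e; split.
- by move=> i; rewrite hl; apply/spn_mem/mem_nth.
- by move=> x; rewrite -hP.
- move=> v; rewrite hl => /spnP [c ->]; exists [ffun i => c i : A^o].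
  rewrite [lc _ _](_ : _ = \sum_i c i *: nth 0 l i) ?subrr; first exact: mem0.
  by apply: eq_bigr => i _; rewrite ffunE.
Qed.

End Resolutions.

(** * Twisted extensions of complexes, the horseshoe lemma and cones *)

Section Blocks.
Variable A : comNzRingType.
Implicit Types L V W X : lmodType A.
Implicit Types D : cx A.

Definition lf X a b (x : {ffun 'I_(a + b) -> X}) : {ffun 'I_a -> X} :=
  [ffun i => x (lshift b i)].
Definition rf X a b (x : {ffun 'I_(a + b) -> X}) : {ffun 'I_b -> X} :=
  [ffun i => x (rshift a i)].
Definition fcat X a b (y : {ffun 'I_a -> X}) (z : {ffun 'I_b -> X}) :
    {ffun 'I_(a + b) -> X} :=
  [ffun i => match split i with inl j => y j | inr j => z j end].

Lemma lf_lin X a b : lin (@lf X a b).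
Proof. by move=> c u v; apply/ffunP => i; rewrite !ffunE. Qed.

Lemma rf_lin X a b : lin (@rf X a b).
Proof. by move=> c u v; apply/ffunP => i; rewrite !ffunE. Qed.

Lemma fcatK_l X a b y z : @lf X a b (fcat y z) = y.
Proof. by apply/ffunP => i; rewrite !ffunE (unsplitK (inl i)). Qed.

Lemma fcatK_r X a b y z : @rf X a b (fcat y z) = z.
Proof. by apply/ffunP => i; rewrite !ffunE (unsplitK (inr i)). Qed.

Lemma fcat_lr X a b (x : {ffun 'I_(a + b) -> X}) : fcat (lf x) (rf x) = x.
Proof.
apply/ffunP => i; rewrite ffunE; case: (splitP i) => j e; rewrite ffunE; congr (x _);
  exact: val_inj.
Qed.

Lemma fcat_inj X a b (x x' : {ffun 'I_(a + b) -> X}) :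
  lf x = lf x' -> rf x = rf x' -> x = x'.
Proof. by move=> e1 e2; rewrite -[x]fcat_lr e1 e2 fcat_lr. Qed.

Lemma lf_mxmap X p1 p2 q1 q2 (a : 'M[A]_(p1, q1)) (b : 'M_(p1, q2)) (c : 'M_(p2, q1))
  (d : 'M_(p2, q2)) x :
  lf (mxmap X (block_mx a b c d) x) = mxmap X a (lf x) + mxmap X c (rf x).
Proof.
apply/ffunP => j; rewrite !ffunE big_split_ord /=; congr (_ + _);
  by apply: eq_bigr => i _; rewrite ffunE ?block_mxEul ?block_mxEdl.
Qed.

Lemma rf_mxmap X p1 p2 q1 q2 (a : 'M[A]_(p1, q1)) (b : 'M_(p1, q2)) (c : 'M_(p2, q1))
  (d : 'M_(p2, q2)) x :
  rf (mxmap X (block_mx a b c d) x) = mxmap X b (lf x) + mxmap X d (rf x).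
Proof.
apply/ffunP => j; rewrite !ffunE big_split_ord /=; congr (_ + _);
  by apply: eq_bigr => i _; rewrite ffunE ?block_mxEur ?block_mxEdr.
Qed.

(** As matrices act on row vectors, D1 is the subcomplex and D2 the quotient; [blk_comp] below is
    the condition on the twist t for consecutive differentials to compose to zero. *)
Definition blk D1 D2 (t : forall j, 'M[A]_(rk D2 j.+1, rk D1 j)) : cx A :=
  @Cx A (fun j => rk D1 j + rk D2 j)%N
    (fun j => block_mx (df D1 j) 0 (t j) (df D2 j)).

Definition blk_comp D1 D2 (t : forall j, 'M[A]_(rk D2 j.+1, rk D1 j)) :=
  forall j, t j.+1 *m df D1 j = - (df D2 j.+1 *m t j).

Lemma blk_iscx D1 D2 (t : forall j, 'M[A]_(rk D2 j.+1, rk D1 j)) :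
  iscx D1 -> iscx D2 -> blk_comp t -> iscx (blk t).
Proof.
move=> c1 c2 ct [|j] /=; first by rewrite mulmx0.
rewrite mulmx_block (c1 j.+1) (c2 j.+1) ct !mulmx0 !mul0mx !addr0 addNr.
by rewrite /block_mx !row_mx0 col_mx0.
Qed.

Definition baug L D1 D2 (e1 : 'I_(rk D1 0%N) -> L) (e2 : 'I_(rk D2 0%N) -> L)
   (i : 'I_(rk D1 0%N + rk D2 0%N)) : L :=
  match split i with inl j => e1 j | inr j => e2 j end.

Lemma lc_baug L D1 D2 (e1 : 'I_(rk D1 0%N) -> L) (e2 : 'I_(rk D2 0%N) -> L) x :
  lc (baug e1 e2) x = lc e1 (lf x) + lc e2 (rf x).
Proof.
rewrite /lc big_split_ord /=; congr (_ + _); apply: eq_bigr => i _;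
  by rewrite ffunE /baug ?(unsplitK (inl i)) ?(unsplitK (inr i)).
Qed.

(* The horseshoe lemma for 0 -> Y/S -> T/S -> T/Y -> 0. *)
Lemma horseshoe L (S Y T : sub L) D1 D2 : sle S Y -> sle Y T ->
  res S Y D1 -> res Y T D2 ->
  exists t, blk_comp (D1 := D1) (D2 := D2) t /\ res S T (blk t).
Proof.
move=> SY YT [a1 [e1 h1]] [a2 [e2 h2]].
have [Te1 k1 g1] := h1; have [Te2 k2 g2] := h2.
(* The boundaries of D2 in degree 0 are augmented into Y rather than S; [t0] compensates for this
   through D1. *)
have [t0 ht0] := aug_lift h1 (g := fun i => - lc e2 (rowf (df D2 0%N) i))
   (fun i => memN (aug_df i h2)).
have ht0' w : S (lc e1 (mxmap A^o t0 w) + lc e2 (mxmap A^o (df D2 0%N) w)).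
  rewrite !lc_mxmap -[X in S X]opprK; apply: memN; rewrite opprD addrC -sumrN.
  have -> : \sum_i - ((w i : A) *: lc e2 (rowf (df D2 0%N) i)) =
     lc (fun i => - lc e2 (rowf (df D2 0%N) i)) w.
    by apply: eq_bigr => i _; rewrite scalerN.
  exact: lc_sub.
have [||t [et _ ht]] := @dep_choice (fun j => 'M[A]_(rk D2 j.+1, rk D1 j))
  (fun j t => exists t', t' *m df D1 j = - (df D2 j.+1 *m t))
  (fun j t t' => t' *m df D1 j = - (df D2 j.+1 *m t)) t0.
- have [|U eU] := aug_ker (M := df D2 1%N *m t0) h1.
    move=> i; rewrite rowf_mul.
    have := ht0' (rowf (df D2 1%N) i); rewrite -(rowf_mul _ (df D2 0%N)) (a2.1 1%N).
    rewrite (_ : rowf 0 i = 0) ?(lin0 (lc_lin _)) ?addr0 //.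
    by apply/ffunP => j; rewrite !ffunE mxE.
  by exists (- U); rewrite mulNmx -eU.
- move=> j t' [t'' e]; exists t'' => //.
  have [|U eU] := df_in_exact (j := j) (M := df D2 j.+2 *m t'') a1.
    by rewrite /= -mulmxA e mulmxN mulmxA (a2.1 j.+2) mul0mx oppr0.
  by exists (- U); rewrite mulNmx -eU.
exists t; split=> //; split.
  split; first exact: blk_iscx a1.1 a2.1 ht.
  move=> j x /= h.
  have := congr1 (@rf _ _ _) h; rewrite rf_mxmap mxmap0l add0r => hr.
  have [|w ew] := a2.2 j (rf x); first by rewrite hr; apply/ffunP => i; rewrite !ffunE.
  have := congr1 (@lf _ _ _) h; rewrite lf_mxmap => hl.
  have [|u eu] := a1.2 j (lf x - mxmap A^o (t j.+1) w).
    rewrite (linB _ _ (mxmap_lin _)) -mxmapM ht mxmapNl opprK mxmapM -ew hl.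
    by apply/ffunP => i; rewrite !ffunE.
  exists (fcat u w); apply: fcat_inj.
    by rewrite lf_mxmap fcatK_l fcatK_r -eu subrK.
  by rewrite rf_mxmap fcatK_l fcatK_r mxmap0l add0r.
exists (baug e1 e2); split.
- move=> i; rewrite /baug; case: (split i) => j //; exact: YT.
- move=> x; rewrite lc_baug; split=> [h|[u ->]]; last first.
    rewrite lf_mxmap rf_mxmap mxmap0l add0r (linD _ _ (lc_lin _)) -addrA.
    apply: memD; last by rewrite et; apply: ht0'.
    by apply/k1; exists (lf u).
  have [w ew] : exists w, rf x = mxmap A^o (df D2 0%N) w.
    by apply/k2; apply: memDr (SY _ h); apply: lc_mem.
  have [u eu] : exists u, lf x - mxmap A^o (t 0%N) w = mxmap A^o (df D1 0%N) u.
    apply/k1; rewrite (linB _ _ (lc_lin _)).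
    have := memB h (ht0' w); rewrite -et -ew opprD addrACA subrr addr0.
    by [].
  exists (fcat u w); apply: fcat_inj.
    by rewrite lf_mxmap fcatK_l fcatK_r -eu subrK.
  by rewrite rf_mxmap fcatK_l fcatK_r mxmap0l add0r.
- move=> v /g2 [z Yz]; have [y Sy] := g1 _ Yz; exists (fcat y z).
  by rewrite lc_baug fcatK_l fcatK_r opprD [- _ - _]addrC addrA.
Qed.

Definition shift D : cx A := @Cx A (rk_in (rk D)) (fun j => df_in D j).

(** The mapping cone of multiplication by a; the sign makes the twist anticommute with the
    differentials, as [blk_comp] asks. *)
Definition cone D (a : A) : cx A :=
  @blk D (shift D) (fun j => ((-1) ^+ j * a)%:M).

Lemma shift_iscx D : iscx D -> iscx (shift D).
Proof. by move=> cD [|j] /=; [rewrite mulmx0 | exact: cD]. Qed.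

Lemma cone_comp D a : @blk_comp D (shift D) (fun j => ((-1) ^+ j * a)%:M).
Proof.
move=> j /=; rewrite mul_scalar_mx mul_mx_scalar exprS -mulrA mulN1r scaleNr.
by [].
Qed.

Lemma cone_iscx D a : iscx D -> iscx (cone D a).
Proof. by move=> cD; apply: blk_iscx (cone_comp D a) => //; apply: shift_iscx. Qed.

Lemma cone_res L (S T : sub L) D (a : A) : sle S T -> (forall v, T v -> S (a *: v) -> S v) ->
  res S T D -> res (sadd S (sscale a T)) T (cone D a).
Proof.
move=> ST reg [aD [e [Te ke ge]]].
have ereg x : (exists u, a *: x = mxmap A^o (df D 0%N) u) ->
    exists u, x = mxmap A^o (df D 0%N) u.
  by move=> /ke h; apply/ke; apply: reg; [apply: lc_mem | rewrite -linZ //; exact: lc_lin].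
split.
  split; first exact: cone_iscx aD.1.
  move=> j x /= h.
  have := congr1 (@rf _ _ _) h; rewrite rf_mxmap mxmap0l add0r => hr.
  have := congr1 (@lf _ _ _) h; rewrite lf_mxmap mxmap_scalar => hl.
  have l0 (n k : nat) : @lf A^o n k 0 = 0 by apply/ffunP => i; rewrite !ffunE.
  have r0 (n k : nat) : @rf A^o n k 0 = 0 by apply/ffunP => i; rewrite !ffunE.
  rewrite l0 in hl; rewrite r0 in hr.
  (* In the lowest degree this is the regularity of a on T / S; in higher degrees it is the
     acyclicity of D. *)
  have [w ew] : exists w, rf x = mxmap A^o (df D j) w.
    case: j x {h} hr hl => [|j] x hr hl; last exact: aD.2.
    apply: ereg; exists (- lf x); rewrite expr0 mul1r in hl.
    by rewrite (linN _ (mxmap_lin _)); apply/eqP; rewrite -addr_eq0 addrC hl.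
  have [|u eu] := aD.2 j (lf x - mxmap A^o (((-1) ^+ j.+1 * a)%:M) w).
    rewrite (linB _ _ (mxmap_lin _)) -[X in _ - X]mxmapM (cone_comp D a j) mxmapNl opprK.
    by rewrite mxmapM -ew mxmap_scalar.
  exists (fcat u w); apply: fcat_inj.
    by rewrite lf_mxmap fcatK_l fcatK_r -eu subrK.
  by rewrite rf_mxmap fcatK_l fcatK_r mxmap0l add0r.
exists (@baug L D (shift D) e (fun i : 'I_0 => 0)).
have lc0 (z : {ffun 'I_0 -> A^o}) : lc (fun=> 0 : L) z = 0 by rewrite /lc big_ord0.
split.
- by move=> i; rewrite /baug; case: (split i) => [j|[]].
- move=> x; rewrite lc_baug lc0 addr0; split=> [[s Ss [v Tv e1]]|[u ->]].
    have [y Sy] := ge _ Tv.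
    have [u eu] : exists u, lf x - a *: y = mxmap A^o (df D 0%N) u.
      apply/ke; rewrite (linB _ _ (lc_lin _)) (linZ _ _ (lc_lin _)).
      rewrite -(subrK s (lc e (lf x))) e1 addrAC -scalerBr.
      by apply: memD => //; apply: memZ.
    exists (fcat u y); apply: fcat_inj; last by apply/ffunP => -[].
    by rewrite lf_mxmap fcatK_l fcatK_r mxmap_scalar expr0 mul1r -eu subrK.
  rewrite lf_mxmap mxmap_scalar expr0 mul1r (linD _ _ (lc_lin _)).
  apply: saddI; first by apply/ke; exists (lf u).
  by exists (lc e (rf u)); [apply: lc_mem | rewrite linZ //; apply: lc_lin].
- move=> v /ge [x Sx]; exists (fcat x 0); rewrite lc_baug fcatK_l lc0 addr0.
  exact: sadd_l.
Qed.

End Blocks.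

(** * Long exact sequences *)

Section Triples.
Variable A : comNzRingType.
Implicit Types V W X : lmodType A.

(* An exact sequence H1 -> H -> H2 of subquotients. *)
Definition triple V1 V V2 (B1 Z1 : sub V1) (B Z : sub V) (B2 Z2 : sub V2) : Prop :=
  exists (i : V1 -> V) (p : V -> V2), [/\ lin i /\ lin p,
    forall v, B1 v -> B (i v),
    forall v, Z1 v -> Z (i v) /\ p (i v) = 0,
    forall v, (B v -> B2 (p v)) /\ (Z v -> Z2 (p v))
  & forall v, Z v -> B2 (p v) -> exists2 v1, Z1 v1 & B (v - i v1)].

Lemma triple_exact V1 V V2 (B1 Z1 : sub V1) (B Z : sub V) (B2 Z2 : sub V2) :
  triple B1 Z1 B Z B2 Z2 -> sle Z1 B1 -> sle Z2 B2 -> sle Z B.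
Proof.
move=> [i [p [[li lp] h1 h2 h3 h4]]] e1 e2 v Zv.
have [v1 /e1 /h1 Bv1 h] := h4 v Zv (e2 _ ((h3 v).2 Zv)).
exact: memBl Bv1 h.
Qed.

Lemma triple_kill V1 V V2 (B1 Z1 : sub V1) (B Z : sub V) (B2 Z2 : sub V2) (a b : A) :
  triple B1 Z1 B Z B2 Z2 -> (forall v, Z1 v -> B1 (a *: v)) ->
  (forall v, Z2 v -> B2 (b *: v)) -> forall v, Z v -> B ((a * b) *: v).
Proof.
move=> [i [p [[li lp] h1 h2 h3 h4]]] k1 k2 v Zv.
have [||v1 /k1 /h1 h Bh] := h4 (b *: v); first exact: memZ.
  by rewrite linZ //; apply: k2; apply: (h3 v).2.
rewrite linZ // in h; rewrite -scalerA; apply: memBl h _.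
by rewrite -scalerBr; apply: memZ.
Qed.

Lemma triple_ln V1 V V2 (B1 Z1 : sub V1) (B Z : sub V) (B2 Z2 : sub V2) :
  triple B1 Z1 B Z B2 Z2 -> sle B1 Z1 -> sle B Z -> sle B2 Z2 ->
  fin B1 Z1 -> fin B2 Z2 ->
  fin B Z /\ (ln B Z <= ln B1 Z1 + ln B2 Z2)%N.
Proof.
move=> [i [p [[li lp] h1 h2 h3 h4]]] BZ1 BZ BZ2 f1 f2.
pose Y := scap Z (spre lp B2).
have BY : sle B Y by move=> v Bv; split; [exact: BZ | exact: (h3 v).1].
have YZ : sle Y Z by move=> v [].
have [fY lY] : fin B Y /\ (ln B Y <= ln B1 Z1)%N.
  apply: (ln_iso_ge (f := i)) => //.
    by move=> v /h2 [Zv e]; split=> //; rewrite spreE e; apply: mem0.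
  by move=> w [Zw B2w]; apply: h4.
have [fZ lZ] : fin Y Z /\ (ln Y Z <= ln B2 Z2)%N.
  apply: (ln_inj_le (f := p)) => //; first by move=> v /(h3 v).2.
  by move=> v Zv; split=> [[]|].
have [f ->] := ln_add BY YZ fY fZ; split=> //; exact: leq_add.
Qed.

Variables (D1 D2 : cx A) (t : forall j, 'M[A]_(rk D2 j.+1, rk D1 j)).
Hypothesis ct : blk_comp t.

Lemma lf0 X a b : @lf A X a b 0 = 0.
Proof. by apply/ffunP => i; rewrite !ffunE. Qed.

Lemma rf0 X a b : @rf A X a b 0 = 0.
Proof. by apply/ffunP => i; rewrite !ffunE. Qed.

Lemma fcat_lin_l X a b : lin (fun y : {ffun 'I_a -> X} => fcat y (0 : {ffun 'I_b -> X})).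
Proof.
move=> c u v; apply: fcat_inj; rewrite ?(lf_lin, rf_lin) ?fcatK_l ?fcatK_r //.
by rewrite scaler0 addr0.
Qed.

Lemma fcat_lin_r X a b : lin (fun z : {ffun 'I_b -> X} => fcat (0 : {ffun 'I_a -> X}) z).
Proof.
move=> c u v; apply: fcat_inj; rewrite ?(lf_lin, rf_lin) ?fcatK_l ?fcatK_r //.
by rewrite scaler0 addr0.
Qed.

Lemma lfB X a b (x y : {ffun 'I_(a + b) -> X}) : lf (x - y) = lf x - lf y.
Proof. exact: linB (@lf_lin _ _ _ _). Qed.

Lemma rfB X a b (x y : {ffun 'I_(a + b) -> X}) : rf (x - y) = rf x - rf y.
Proof. exact: linB (@rf_lin _ _ _ _). Qed.

(** Dualizing exchanges subcomplex and quotient, so D1 and D2 trade places when [c] is false. *)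
Lemma blk_triple c j X :
  triple (spB c (if c then D1 else D2) j.+1 X) (spZ c (if c then D1 else D2) j.+1 X)
         (spB c (blk t) j.+1 X) (spZ c (blk t) j.+1 X)
         (spB c (if c then D2 else D1) j.+1 X) (spZ c (if c then D2 else D1) j.+1 X).
Proof.
have m0 p q (P : 'M[A]_(p, q)) : mxmap X P 0 = 0 by exact: lin0 (mxmap_lin _).
case: c.
- exists (fun y => fcat y 0), (@rf A X _ _); split.
  + by split; [exact: fcat_lin_l | exact: rf_lin].
  + move=> _ /spBP [u ->]; apply/spBP; exists (fcat u 0).
    by apply: fcat_inj; rewrite ?lf_mxmap ?rf_mxmap !fcatK_l !fcatK_r ?mxmap0l ?m0 !addr0.
  + move=> v /spZP /= h; split; last by rewrite fcatK_r.
    by apply/spZP/fcat_inj; rewrite /= ?lf_mxmap ?rf_mxmap fcatK_l fcatK_r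
      ?mxmap0l ?m0 ?h !addr0 ?lf0 ?rf0.
  + move=> v; split=> [/spBP [u ->]|/spZP /= h].
      by apply/spBP; exists (rf u); rewrite /= rf_mxmap mxmap0l add0r.
    by apply/spZP; have := congr1 (@rf _ _ _ _) h; rewrite rf_mxmap mxmap0l add0r rf0.
  + move=> v /spZP /= h /spBP [w /= e].
    exists (lf v - mxmap X (t j.+1) w).
      apply/spZP; rewrite (linB _ _ (mxmap_lin _)) -mxmapM ct mxmapNl opprK mxmapM -e.
      by have := congr1 (@lf _ _ _ _) h; rewrite lf_mxmap lf0.
    apply/spBP; exists (fcat 0 w); apply: fcat_inj => /=.
      by rewrite lfB lf_mxmap !fcatK_l fcatK_r opprB addrC subrK m0 add0r.
    by rewrite rfB rf_mxmap fcatK_l !fcatK_r m0 subr0 add0r.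
- exists (fun z => fcat 0 z), (@lf A X _ _); split.
  + by split; [exact: fcat_lin_r | exact: lf_lin].
  + move=> _ /spBP [u ->]; apply/spBP; exists (fcat 0 u); rewrite /= tr_block_mx.
    by apply: fcat_inj; rewrite ?lf_mxmap ?rf_mxmap !fcatK_l !fcatK_r ?trmx0 ?mxmap0l ?m0 !add0r.
  + move=> v /spZP /= h; split; last by rewrite fcatK_l.
    by apply/spZP/fcat_inj; rewrite /= tr_block_mx ?lf_mxmap ?rf_mxmap fcatK_l fcatK_r
      ?trmx0 ?mxmap0l ?m0 ?h !addr0 ?lf0 ?rf0.
  + move=> v; split=> [/spBP [u ->]|/spZP /=].
      by apply/spBP; exists (lf u); rewrite /= tr_block_mx lf_mxmap trmx0 mxmap0l addr0.
    rewrite tr_block_mx => h; apply/spZP.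
    by have := congr1 (@lf _ _ _ _) h; rewrite lf_mxmap trmx0 mxmap0l addr0 lf0.
  + move=> v /spZP /=; rewrite tr_block_mx => h /spBP [w /= e].
    exists (rf v - mxmap X (t j)^T w).
      apply/spZP; rewrite /= (linB _ _ (mxmap_lin _)) -mxmapM -trmx_mul.
      have -> : df D2 j.+1 *m t j = - (t j.+1 *m df D1 j) by rewrite ct opprK.
      rewrite linearN /= mxmapNl opprK trmx_mul mxmapM -e addrC.
      by have := congr1 (@rf _ _ _ _) h; rewrite rf_mxmap rf0.
    apply/spBP; exists (fcat w 0); rewrite /= tr_block_mx; apply: fcat_inj => /=.
      by rewrite lfB lf_mxmap !fcatK_l fcatK_r m0 subr0 addr0.
    by rewrite rfB rf_mxmap !fcatK_r fcatK_l opprB addrC subrK m0 addr0.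
Qed.

(* The connecting map H^r(D1) -> H^(r+1)(D2) has zero target. *)
Lemma blk_exact_sub r X : exact false (blk t) r.+1 X -> exact false D2 r.+2 X ->
  iscx D1 -> iscx D2 -> exact false D1 r.+1 X.
Proof.
have m0 p q (P : 'M[A]_(p, q)) : mxmap X P 0 = 0 by exact: lin0 (mxmap_lin _).
move=> e e2 c1 c2 y /spZP /= hy.
have /e2 /spBP [z /= ez] : spZ false D2 r.+2 X (mxmap X (t r.+1)^T y).
  apply/spZP; rewrite /= -mxmapM -trmx_mul.
  have -> : df D2 r.+2 *m t r.+1 = - (t r.+2 *m df D1 r.+1) by rewrite ct opprK.
  by rewrite linearN /= mxmapNl trmx_mul mxmapM hy m0 oppr0.
have /e /spBP [u] : spZ false (blk t) r.+1 X (fcat y (- z)).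
  apply/spZP; rewrite /= tr_block_mx; apply: fcat_inj.
    by rewrite lf_mxmap fcatK_l fcatK_r hy trmx0 mxmap0l addr0 lf0.
  by rewrite rf_mxmap fcatK_l fcatK_r ez (linN _ (mxmap_lin _)) subrr rf0.
move/(congr1 (@lf _ _ _ _)); rewrite fcatK_l /= tr_block_mx lf_mxmap trmx0 mxmap0l addr0.
by move=> ->; apply/spBP; exists (lf u).
Qed.

End Triples.

(** * Multiplication by a on homology, read off the cone *)

Section Cones.
Variables (A : comNzRingType) (D : cx A) (a : A).
Hypothesis cD : iscx D.
Implicit Types X : lmodType A.

(** A cocycle z of D gives the cocycle (0, z) of the dual cone. If that is a coboundary, z is a
    multiple of a by a cocycle, up to coboundaries; this prepares Nakayama. *)
Lemma cone_surj r X : exact false (cone D a) r.+1 X ->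
  sle (spZ false D r X) (sadd (spB false D r X) (sscale a (spZ false D r X))).
Proof.
have m0 p q (P : 'M[A]_(p, q)) : mxmap X P 0 = 0 by exact: lin0 (mxmap_lin _).
move=> e z /spZP hz.
have /e /spBP [u] : spZ false (cone D a) r.+1 X (fcat 0 z).
  apply/spZP; rewrite /= tr_block_mx; apply: fcat_inj.
    by rewrite lf_mxmap fcatK_l fcatK_r m0 trmx0 mxmap0l addr0 lf0.
  by rewrite rf_mxmap fcatK_l fcatK_r m0 add0r rf0; exact: hz.
rewrite /= tr_block_mx => h.
have := congr1 (@rf _ _ _ _) h; rewrite fcatK_r rf_mxmap tr_scalar_mx mxmap_scalar => ez.
have := congr1 (@lf _ _ _ _) h; rewrite fcatK_l lf_mxmap trmx0 mxmap0l addr0 => el.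
rewrite ez addrC; apply: saddI; first by apply/spBP; exists (rf u).
exists ((-1) ^+ r *: lf u); last by rewrite scalerA mulrC.
apply/spZP; rewrite (linZ _ _ (mxmap_lin _)) /= -el scaler0 //.
Qed.

Let Hc c j X := ln (spB c (cone D a) j X) (spZ c (cone D a) j X).

(** Multiplication by a identifies Z / K with C / B, so both sides are the length of Z / B minus the
    same number. *)
Lemma ln_ker_coker V (B Z : sub V) : sle B Z -> fin B Z ->
  ln B (scap Z (scol a B)) = ln (sadd B (sscale a Z)) Z.
Proof.
move=> BZ f; set K := scap Z _; set C := sadd B _.
have BK : sle B K by move=> v Bv; split; [exact: BZ | exact: memZ].
have KZ : sle K Z by move=> v [].
have BC : sle B C by apply: sadd_l.
have CZ : sle C Z by apply: sadd_lub => // _ [v Zv ->]; apply: memZ.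
have [_ e1] := ln_add BK KZ (fin_sub (@sle_refl _ _ _) KZ f) (fin_sub BK (@sle_refl _ _ _) f).
have [_ e2] := ln_add BC CZ (fin_sub (@sle_refl _ _ _) CZ f) (fin_sub BC (@sle_refl _ _ _) f).
have q : qiso (fun v => a *: v) K Z B C.
  split=> //; first exact: lin_scale.
  - by move=> v Zv; apply: sadd_r; exists v.
  - by move=> v Zv; split=> [[]|].
  - move=> w [s Bs [v Zv e]]; exists v => //; rewrite -e opprB addrC subrK //.
by apply/eqP; rewrite -(eqn_add2r (ln K Z)) -e1 e2 (qiso_ln q).2 addnC.
Qed.

(** For chains, the kernel of a is a quotient of the homology of the cone. For cochains it is the
    cokernel of a that embeds there, and [ln_ker_coker] passes to the kernel. *)
Lemma cone_lower c j X : fin (spB c D j.+1 X) (spZ c D j.+1 X) ->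
  fin (spB c (cone D a) j.+2 X) (spZ c (cone D a) j.+2 X) ->
  (ln (spB c D j.+1 X) (scap (spZ c D j.+1 X) (scol a (spB c D j.+1 X))) <= Hc c j.+2 X)%N.
Proof.
have m0 p q (P : 'M[A]_(p, q)) : mxmap X P 0 = 0 by exact: lin0 (mxmap_lin _).
move=> f fc; have BZ := spBZ (c := c) (j := j.+1) (X := X) cD.
have cc := cone_iscx a cD; have BZc := spBZ (c := c) (j := j.+2) (X := X) cc.
case: c f fc BZ BZc => f fc BZ BZc.
  rewrite /Hc; apply: (ln_iso_ge (f := @rf A X (rk D j.+2) (rk D j.+1)) _ BZc _ _ _ _ fc).2.
  - exact: rf_lin.
  - by move=> v Bv; split; [exact: BZ | exact: memZ].
  - by move=> _ /spBP [u ->]; rewrite /= rf_mxmap mxmap0l add0r; apply/spBP; exists (rf u).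
  - move=> v /spZP /= h; have := congr1 (@rf _ _ _ _) h; rewrite rf_mxmap mxmap0l add0r rf0 => hr.
    split; first exact/spZP.
    have := congr1 (@lf _ _ _ _) h; rewrite lf_mxmap lf0 mxmap_scalar => /eqP.
    rewrite addr_eq0 => /eqP hl; rewrite scolE; apply/spBP; exists (- (-1) ^+ j.+1 *: lf v).
    rewrite (linZ _ _ (mxmap_lin _)) /= hl scaleNr scalerN opprK scalerA mulrA.
    by rewrite -exprD addnn -signr_odd odd_double mul1r.
  - move=> w [/spZP /= Zw /spBP [y /= e]].
    exists (fcat (- ((-1) ^+ j.+1 *: y)) w).
      apply/spZP; apply: fcat_inj.
        rewrite /= lf_mxmap fcatK_l fcatK_r mxmap_scalar (linN _ (mxmap_lin _)).
        by rewrite (linZ _ _ (mxmap_lin _)) -e scalerA addNr lf0.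
      by rewrite /= rf_mxmap fcatK_r mxmap0l add0r Zw rf0.
    by rewrite fcatK_r subrr; apply: mem0.
rewrite ln_ker_coker // /Hc.
apply: (ln_inj_le (f := fun z => fcat (0 : {ffun 'I_(rk D j.+2) -> X}) z) _ _ BZc _ _ fc).2.
- exact: fcat_lin_r.
- by apply: sadd_lub => // _ [v Zv ->]; apply: memZ.
- move=> v /spZP h; apply/spZP; rewrite /= tr_block_mx; apply: fcat_inj.
    by rewrite lf_mxmap fcatK_l fcatK_r m0 trmx0 mxmap0l addr0 lf0.
  by rewrite rf_mxmap fcatK_l fcatK_r m0 add0r rf0.
move=> v Zv; split.
  move=> [s /spBP [w /= ew] [u /spZP /= Zu e]].
  apply/spBP; exists (fcat ((-1) ^+ j.+1 *: u) w); rewrite /= tr_block_mx; apply: fcat_inj.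
    by rewrite lf_mxmap !fcatK_l (linZ _ _ (mxmap_lin _)) Zu scaler0 trmx0 mxmap0l addr0.
  rewrite rf_mxmap !fcatK_r fcatK_l tr_scalar_mx mxmap_scalar scalerA mulrAC -exprD addnn.
  by rewrite -signr_odd odd_double mul1r -e -ew subrK.
move=> /spBP [u]; rewrite /= tr_block_mx => h.
have := congr1 (@rf _ _ _ _) h; rewrite fcatK_r rf_mxmap tr_scalar_mx mxmap_scalar => ez.
have := congr1 (@lf _ _ _ _) h; rewrite fcatK_l lf_mxmap trmx0 mxmap0l addr0 => el.
rewrite ez addrC; apply: saddI; first by apply/spBP; exists (rf u).
exists ((-1) ^+ j.+1 *: lf u); last by rewrite scalerA mulrC.
by apply/spZP; rewrite (linZ _ _ (mxmap_lin _)) /= -el scaler0.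
Qed.

(** Multiplication by a^n embeds ker a^(n+1) / ker a^n into ker a. *)
Lemma nilpotent_ln V (B Z : sub V) e : sle B Z -> fin B Z ->
  (forall v, Z v -> B (a ^+ e *: v)) ->
  (ln B Z <= e * ln B (scap Z (scol a B)))%N.
Proof.
move=> BZ f; set k := ln B (scap _ _).
suff H n : (ln B (scap Z (scol (a ^+ n) B)) <= n * k)%N.
  by move=> h; apply: leq_trans (H e); rewrite (_ : scap Z _ = Z) //;
    apply: sle_anti => [v []|v Zv] //; split=> //; apply: h.
elim: n => [|n IH].
  rewrite (_ : scap Z _ = B) ?(ln_id _).2 //; apply: sle_anti.
    by move=> v [_]; rewrite scolE expr0 scale1r.
  by move=> v Bv; split; [exact: BZ | exact: memZ].
set Y := scap Z _ in IH; set Y' := scap Z _.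
have BY : sle B Y by move=> v Bv; split; [exact: BZ | exact: memZ].
have YY' : sle Y Y'.
  by move=> v [Zv h]; split=> //; rewrite scolE exprS -scalerA; apply: memZ.
have Y'Z : sle Y' Z by move=> v [].
have fY : fin B Y by apply: fin_sub f => // v /YY' /Y'Z.
have fY' : fin Y Y' by apply: fin_sub f.
rewrite (ln_add BY YY' fY fY').2 mulSn addnC; apply: leq_add => //.
apply: (ln_inj_le (f := fun v => a ^+ n *: v) _ YY' _ _ _ _).2.
- exact: lin_scale.
- by move=> v Bv; split; [exact: BZ | exact: memZ].
- by move=> v [Zv h]; split; [exact: memZ | rewrite scolE scalerA -exprS].
- by move=> v [Zv _]; split=> [[]|].
- by apply: fin_sub f => // v [].
Qed.

End Cones.

(** * Passage between predicates and bundled submodules, maps and quotients *)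

Section Packing.
Variables (A : comNzRingType).

Section Lin.
Variables (V W : lmodType A) (f : V -> W) (lf : lin f).
Definition mkfun & lin f := f.
HB.instance Definition _ := GRing.isLinear.Build A V W _ (mkfun lf) lf.
Definition mklin : {linear V -> W} := mkfun lf.
End Lin.

Section Closed.
Variables (V : lmodType A) (S : sub V).
Definition subpred : {pred V} := [pred v | `[< S v >]].
Fact subpred_closed : submod_closed subpred.
Proof.
split; first by apply/asboolP/mem0.
by move=> a u v /asboolP Su /asboolP Sv; apply/asboolP/memP.
Qed.
HB.instance Definition _ := GRing.isSubmodClosed.Build A V subpred subpred_closed.
Definition toS : submodClosed V := subpred.
Lemma toSP v : reflect (S v) (v \in toS).
Proof. exact: asboolP. Qed.
End Closed.

Definition ofS (V : lmodType A) (S : submodClosed V) : sub V.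
Proof.
exists (fun v => v \in S); first exact: rpred0.
by move=> a u v Su Sv; rewrite rpredD ?rpredZ.
Defined.

End Packing.

Section Quotients.
Variables (A : comNzRingType) (V : lmodType A).
Local Open Scope quotient_scope.

Definition piq (S : submodClosed V) (v : V) : quotmod S := \pi_(quotmod S) v.

Lemma piq_lin (S : submodClosed V) : lin (piq S).
Proof. by move=> a u v; rewrite /piq quot_addE -quot_scaleE. Qed.

Lemma piq_eq0 (S : submodClosed V) v : piq S v = 0 <-> v \in S.
Proof.
rewrite -(lin0 (@piq_lin S)) /piq; split.
  by move/eqP; rewrite eqquotE /= /Quotient.equiv subr0.
by move=> h; apply/eqP; rewrite eqquotE /= /Quotient.equiv subr0.
Qed.

Lemma piq_surj (S : submodClosed V) (x : quotmod S) : exists v, x = piq S v.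
Proof. by exists (repr x); rewrite /piq reprK. Qed.

End Quotients.

(** * Totally acyclic complexes over a Gorenstein ring *)

Section ShortExact.
Variable A : comNzRingType.
Implicit Types V W X Y : lmodType A.

Record ses X1 X X2 (f : X1 -> X) (g : X -> X2) : Prop := Ses {
  ses_f : lin f; ses_g : lin g; ses_inj : injective f;
  ses_surj : forall y, exists x, y = g x;
  ses_exact : forall x, g x = 0 <-> exists y, x = f y }.

Section Steps.
Variables (X1 X X2 : lmodType A) (f : X1 -> X) (g : X -> X2).
Hypothesis fg : ses f g.
Variables (o p q r : nat).

Lemma fmap_surj n (y : {ffun 'I_n -> X2}) : exists x, y = fmap g x.
Proof.
have /choice [h hE] : forall i, exists x, y i = g x by move=> i; apply: ses_surj fg _.
by exists [ffun i => h i]; apply/ffunP => i; rewrite !ffunE hE.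
Qed.

Lemma fmap_inj n : injective (@fmap A X1 X f n).
Proof.
move=> x y e; apply/ffunP => i; apply: (ses_inj fg).
by have /ffunP/(_ i) := e; rewrite !ffunE.
Qed.

Lemma fmap_ker n (x : {ffun 'I_n -> X}) : fmap g x = 0 -> exists y, x = fmap f y.
Proof.
move=> e; have /choice [h hE] : forall i, exists y, x i = f y.
  by move=> i; apply/(ses_exact fg); have /ffunP/(_ i) := e; rewrite !ffunE.
by exists [ffun i => h i]; apply/ffunP => i; rewrite !ffunE hE.
Qed.

Lemma fmap_gf n (y : {ffun 'I_n -> X1}) : fmap g (fmap f y) = 0.
Proof. by apply/ffunP => i; rewrite !ffunE; apply/(ses_exact fg); exists (y i). Qed.

(** The stretch H(X) -> H(X2) -> H'(X1) of the long exact sequence of coefficients, with H' one spot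
    further on. *)
Lemma step_r (P : 'M[A]_(p, q)) (Q : 'M[A]_(q, r)) (R : 'M[A]_(r, o)) :
  Q *m R = 0 -> exact_on X P Q -> exact_on X1 Q R -> exact_on X2 P Q.
Proof.
have lf := ses_f fg; have lg := ses_g fg.
move=> QR eX e1 x; have [{}x ->] := fmap_surj x.
rewrite mxmap_fmap // => /fmap_ker [y ey].
have [|z ez] := e1 y.
  by apply: fmap_inj; rewrite -mxmap_fmap // -ey -mxmapM QR mxmap0l; apply/ffunP => i;
    rewrite !ffunE lin0.
have [|w ew] := eX (x - fmap f z).
  by rewrite (linB _ _ (mxmap_lin _)) ey ez mxmap_fmap // subrr.
exists (fmap g w); rewrite mxmap_fmap // -ew (linB _ _ (fmap_lin lg)) fmap_gf subr0 //.
Qed.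

(** The stretch H'(X2) -> H(X1) -> H(X), with H' one spot earlier. *)
Lemma step_l (O : 'M[A]_(o, p)) (P : 'M[A]_(p, q)) (Q : 'M[A]_(q, r)) :
  O *m P = 0 -> exact_on X P Q -> exact_on X2 O P -> exact_on X1 P Q.
Proof.
have lf := ses_f fg; have lg := ses_g fg.
move=> OP eX e2 x hx; have [|y ey] := eX (fmap f x).
  by rewrite mxmap_fmap // hx; apply/ffunP => i; rewrite !ffunE lin0.
have [|u eu] := e2 (fmap g y).
  by rewrite mxmap_fmap // -ey fmap_gf.
have [v ev] := fmap_surj u.
have [|w ew] := @fmap_ker _ (y - mxmap X O v).
  by rewrite (linB _ _ (fmap_lin lg)) eu ev mxmap_fmap // subrr.
exists w; apply: fmap_inj; rewrite -mxmap_fmap // -ew (linB _ _ (mxmap_lin _)) -mxmapM OP.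
by rewrite mxmap0l subr0 ey.
Qed.

End Steps.

(** Exactness for X2 one spot earlier makes a injective on the homology with coefficients in X; the
    last hypothesis says that a acts on it as zero. *)
Lemma step_kill X X2 (a : A) (g : X -> X2) o p q r (O : 'M[A]_(o, p)) (P : 'M[A]_(p, q))
    (Q : 'M[A]_(q, r)) : ses (fun x : X => a *: x) g ->
  O *m P = 0 -> exact_on X2 O P ->
  (forall x, mxmap X Q x = 0 -> exists y, a *: x = mxmap X P y) -> exact_on X P Q.
Proof.
move=> s OP e2 k x /k [y ey]; have lg := ses_g s.
have E n (z : {ffun 'I_n -> X}) : fmap (fun x : X => a *: x) z = a *: z.
  by apply/ffunP => i; rewrite !ffunE.
have [|u eu] := e2 (fmap g y).
  by rewrite mxmap_fmap // -ey -E (fmap_gf s).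
have [v ev] := fmap_surj s u.
have [|w ew] := @fmap_ker _ _ _ _ _ s _ (y - mxmap X O v).
  by rewrite (linB _ _ (fmap_lin lg)) eu ev mxmap_fmap // subrr.
exists w; apply: (fmap_inj s); rewrite !E ey -(subrK (mxmap X O v) y) ew.
rewrite (linD _ _ (mxmap_lin _)) -mxmapM OP mxmap0l addr0 E linZ //; exact: mxmap_lin.
Qed.

Lemma ses_quot V (S : sub V) (a : A) : (forall v, S (a *: v) -> S v) ->
  exists g : quotmod (toS S) -> quotmod (toS (sadd S (sscale a top))),
    ses (fun x => a *: x) g /\ forall v, g (piq (toS S) v) = piq _ v.
Proof.
move=> reg; set S' := sadd S _.
have SS' v : S v -> S' v by apply: sadd_l.
have gE v w : piq (toS S) v = piq (toS S) w -> piq (toS S') v = piq (toS S') w.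
  move=> /eqP; rewrite -subr_eq0 -(linB _ _ (@piq_lin _ _ _)) => /eqP /piq_eq0 /toSP h.
  apply/eqP; rewrite -subr_eq0 -(linB _ _ (@piq_lin _ _ _)); apply/eqP/piq_eq0/toSP.
  exact: SS'.
have /choice [rp rpE] := @piq_surj _ _ (toS S).
exists (fun x => piq (toS S') (rp x)).
have E v : piq (toS S') (rp (piq (toS S) v)) = piq (toS S') v by apply: gE; rewrite -rpE.
split=> //; split=> //.
- exact: lin_scale.
- move=> c x y; rewrite (rpE x) (rpE y) -(piq_lin (toS S)) !E; exact: piq_lin.
- move=> x y; rewrite (rpE x) (rpE y) => /eqP.
  rewrite -subr_eq0 -scalerBr -(linB _ _ (@piq_lin _ _ _)) -(linZ _ _ (@piq_lin _ _ _)).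
  move=> /eqP /piq_eq0 /toSP /reg h; apply/eqP.
  by rewrite -subr_eq0 -(linB _ _ (@piq_lin _ _ _)); apply/eqP/piq_eq0/toSP.
- by move=> y; have [v ->] := piq_surj y; exists (piq _ v); rewrite E.
- move=> x; rewrite (rpE x) E; split.
    move=> /piq_eq0 /toSP [s Ss [v _ e]]; exists (piq _ v).
    rewrite -(linZ _ _ (@piq_lin _ _ _)) -e (linB _ _ (@piq_lin _ _ _)).
    by rewrite (_ : piq _ s = 0) ?subr0 //; apply/piq_eq0/toSP.
  case=> y; have [v ->] := piq_surj y; rewrite -(linZ _ _ (@piq_lin _ _ _)) => /gE ->.
  by apply/piq_eq0/toSP; apply: sadd_r; exists v.
Qed.

End ShortExact.

Section Projectives.
Variable A : comNzRingType.
Implicit Types V W X Y : lmodType A.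

(** Pm is a direct summand of the free module on its own elements, by a section h of the evaluation
    [ev]. The image of x under h has finitely many coordinates, and exactness over A lifts each of
    them. *)
Lemma exact_on_proj Pm p q r (P : 'M[A]_(p, q)) (Q : 'M[A]_(q, r)) :
  projective Pm -> exact_on A^o P Q -> exact_on Pm P Q.
Proof.
move=> pP eA x Qx; pose F : lmodType A := {freeg Pm / A}.
pose ev (D : F) : Pm := \sum_(y <- dom D) (coeff y D) *: y.
have evE (D : F) s : uniq s -> {subset dom D <= s} -> ev D = \sum_(y <- s) (coeff y D) *: y.
  move=> us ds; rewrite [RHS](bigID (mem (dom D))) /= [X in _ + X]big1 ?addr0; last first.
    by move=> y; rewrite mem_dom negbK => /eqP ->; rewrite scale0r.
  rewrite -big_filter; apply: perm_big; apply: uniq_perm; rewrite ?uniq_dom ?filter_uniq //.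
  by move=> y; rewrite mem_filter; case: (boolP (y \in dom D)) => //= /ds ->.
have lev : lin ev.
  move=> a u v; pose s := undup (dom (a *: u + v) ++ dom u ++ dom v).
  have us : uniq s by apply: undup_uniq.
  rewrite !(evE _ s) //; try by move=> y yd; rewrite mem_undup !mem_cat yd ?orbT.
  rewrite scaler_sumr -big_split; apply: eq_bigr => y _ /=.
  by rewrite coeffD coeffZ scalerDl scalerA.
have [|h hE] := pP F Pm (mklin lev) (mklin (fun a u v => erefl (a *: u + v))).
  move=> y; exists (Freeg [:: (1, y)]).
  rewrite /= /mkfun /ev domU1 big_seq1 coeffU eqxx mulr1 scale1r //.
have lco y : lin (fun D : F => coeff y D : A^o).
  by move=> a u v; rewrite coeffD coeffZ.
have /choice [w hw] : forall y, exists w,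
    fmap (fun D : F => coeff y D : A^o) (fmap h x) = mxmap A^o P w.
  move=> y; apply: eA; rewrite !mxmap_fmap ?Qx //; last exact: linear_lin.
  by apply/ffunP => i; rewrite !ffunE linear0 coeff0.
pose s := undup (flatten [seq dom (h (x i)) | i <- enum 'I_q]).
exists (\sum_(y <- s) fmap (fun c : A^o => (c : A) *: y) (w y)).
have -> : mxmap Pm P (\sum_(y <- s) fmap (fun c : A^o => (c : A) *: y) (w y)) =
    \sum_(y <- s) fmap (fun c : A^o => (c : A) *: y) (mxmap A^o P (w y)).
  rewrite (big_morph _ (fun u v => linD u v (mxmap_lin P)) (lin0 (mxmap_lin P))); apply: eq_bigr => y _.
  by rewrite mxmap_fmap //; apply: lin_act.
apply/ffunP => i; rewrite sum_ffunE.
have <- : ev (h (x i)) = x i by have := hE (x i).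
rewrite (evE _ s) ?undup_uniq //.
  by apply: eq_bigr => y _; rewrite -hw !ffunE.
move=> y yd; rewrite mem_undup; apply/flattenP; exists (dom (h (x i))) => //.
by apply/mapP; exists i; rewrite ?mem_enum.
Qed.

(** As ker Q = im P, a vector x killed by P^T defines a linear map from the image of Q to E. Its
    extension to the whole free module, evaluated on the basis, is the preimage of x. *)
Lemma exact_on_inj E p q r (P : 'M[A]_(p, q)) (Q : 'M[A]_(q, r)) :
  injective_module E -> P *m Q = 0 -> exact_on A^o P Q -> exact_on E Q^T P^T.
Proof.
move=> iE PQ eA x Px.
have lcx (v : {ffun 'I_q -> A^o}) : mxmap A^o Q v = 0 -> lc x v = 0.
  move=> /eA [y ->]; rewrite lc_mxmap; apply: big1 => i _.
  have /ffunP/(_ i) := Px; rewrite !ffunE => e.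
  by rewrite [lc _ _](_ : _ = 0) ?scaler0 // -[RHS]e; apply: eq_bigr => j _; rewrite ffunE mxE.
pose X := submod (imsub (mxmap A^o Q)).
have /choice [rp rpE] : forall w : X, exists v, val w = mxmap A^o Q v.
  by move=> w; have /asboolP := valP w.
have lcE (w : X) v : val w = mxmap A^o Q v -> lc x (rp w) = lc x v.
  move=> e; apply/eqP; rewrite -subr_eq0 -(linB _ _ (lc_lin _)); apply/eqP/lcx.
  by rewrite (linB _ _ (mxmap_lin _)) -rpE e subrr.
have lfx : lin (fun w : X => lc x (rp w)).
  move=> a u v; rewrite -lc_lin; apply: lcE.
  by rewrite linearP /= !rpE mxmap_lin.
have lval : lin (fun w : X => val w) by move=> a u v; rewrite linearP.
have [|h hE] := iE _ _ (mklin lval) (mklin lfx).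
  exact: val_inj.
exists [ffun j => h (delta j 1)]; apply/ffunP => i; rewrite ffunE.
have Pi : mxmap A^o Q (delta i 1) \in imsub (mxmap A^o Q).
  by apply/asboolP; exists (delta i 1).
have <- : h (mxmap A^o Q (delta i 1)) = x i.
  by rewrite -(lc_delta x i) -(lcE (Submod Pi)) //; apply: (hE (Submod Pi)).
rewrite -rowf_delta (delta_sum (rowf Q i)) linear_sum; apply: eq_bigr => j _.
rewrite !ffunE mxE -linearZ /=; congr (h _).
by apply/ffunP => k; rewrite !ffunE; case: ifP; rewrite ?scaler0 // -[RHS]/(_ * _) mulr1.
Qed.

End Projectives.

Section Dimension.
Variable A : comNzRingType.
Implicit Types V W X Y : lmodType A.
Implicit Types D : cx A.

Lemma exact_trivial X c D j : (forall x : X, x = 0) -> exact c D j X.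
Proof.
move=> h x _; suff -> : x = 0 by apply: mem0.
by apply/ffunP => i; rewrite !ffunE.
Qed.

Lemma exact_on_trivial X p q r (P : 'M[A]_(p, q)) (Q : 'M[A]_(q, r)) :
  (forall x : X, x = 0) -> exact_on X P Q.
Proof.
move=> h x _; exists 0; rewrite (lin0 (mxmap_lin _)).
by apply/ffunP => i; rewrite !ffunE.
Qed.

Lemma ses_inj_res V n : injdim_le V n -> exists (E W : lmodType A) (f : V -> E) (g : E -> W),
  [/\ injective_module E, ses f g & if n is n'.+1 then injdim_le W n' else forall x : W, x = 0].
Proof.
case=> E [d [e [iE ie ex0 exS En]]].
pose W := submod (kersub (d 1%N)).
have dP (x : E 0%N) : d 0%N x \in kersub (d 1%N) by apply/eqP/exS; exists x.
pose g (x : E 0%N) : W := Submod (dP x).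
have lval : lin (fun w : W => val w) by move=> a u v; rewrite linearP.
exists (E 0%N), W, e, g; split=> //.
  split=> //; first exact: linear_lin.
  - by move=> a u v; apply: val_inj; rewrite /= linearP.
  - move=> y; have /eqP/exS [x ex] := valP y; exists x; exact: val_inj.
  - move=> x; rewrite -ex0; split=> [/(congr1 val)|h]; first by [].
    exact: val_inj.
case: n En => [|n] En.
  by move=> x; apply: val_inj; apply: En.
exists (fun i => E i.+1), (fun i => d i.+1), (mklin lval); split=> //.
- exact: val_inj.
- move=> v; split=> [h|[u ->]]; last by apply/eqP; exact: valP u.
  by have hv : v \in kersub (d 1%N); [apply/eqP | exists (Submod hv)].
- by move=> i x h; apply: En.
Qed.

(** Each dimension shift along the injective resolution moves one spot towards the end of the dual
    complex, so q > n leaves enough room. *)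
Lemma injdim_left V n D q : injdim_le V n -> acyc D -> (n < q)%N -> exact false D q V.
Proof.
elim: n V q => [|n IH] V q /ses_inj_res [E [W [f [g [iE s h]]]]] aD; case: q => // q.
  move=> _; apply/exactP/(step_l s (O := (df_in D q)^T)).
  - by rewrite /= -trmx_mul aD.1 trmx0.
  - exact: exact_on_inj iE (aD.1 q.+1) (aD.2 q).
  - exact: exact_on_trivial.
rewrite ltnS => nq; apply/exactP/(step_l s (O := (df_in D q)^T)).
- by rewrite /= -trmx_mul aD.1 trmx0.
- exact: exact_on_inj iE (aD.1 q.+1) (aD.2 q).
- by have /exactP := IH W q h aD nq.
Qed.

(** Here the sequence M is infinite in the direction of the shifts, so there is always room,
    whatever n is. *)
Lemma injdim_right V n (c : nat -> nat) (M : forall i, 'M[A]_(c i, c i.+1)) :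
  injdim_le V n -> (forall i, M i *m M i.+1 = 0) ->
  (forall i, exact_on A^o (M i) (M i.+1)) -> exact_on V (M 1%N)^T (M 0%N)^T.
Proof.
elim: n V c M => [|n IH] V c M /ses_inj_res [E [W [f [g [iE s h]]]]] M0 Mx.
all: apply: (step_l s (O := (M 2%N)^T)); [by rewrite -trmx_mul M0 trmx0 |
  exact: exact_on_inj iE (M0 0%N) (Mx 0%N) |].
- exact: exact_on_trivial.
- exact: (IH _ _ (fun i => M i.+1)).
Qed.

(* D is acyclic in positive degrees and so is its dual. *)
Definition tacyclic D := acyc D /\ forall j, exact false D j.+1 A^o.

(* Ext^j(M, X) = 0 for all j > 0 and all totally reflexive M. *)
Definition good X := forall D j, tacyclic D -> exact false D j.+1 X.

Lemma good_trivial X : (forall x : X, x = 0) -> good X.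
Proof. by move=> h D j _; apply: exact_trivial. Qed.

Lemma good_ring : good A^o.
Proof. by move=> D j []. Qed.

Lemma good_ses X1 X X2 (f : X1 -> X) (g : X -> X2) : ses f g ->
  good X1 -> good X -> good X2.
Proof.
move=> s g1 gX D j tD; apply/exactP/(step_r s (R := (df D j.+2)^T)).
- by rewrite /= -trmx_mul (tD.1.1 j.+2) trmx0.
- by apply/exactP/gX.
- by have /exactP := g1 D j.+1 tD.
Qed.

Lemma good_proj X : projective X -> good X.
Proof.
by move=> pX D j [_ h]; apply/exactP/exact_on_proj/exactP.
Qed.

Lemma ses_proj_res V n : projdim_le V n -> exists (P W : lmodType A) (f : W -> P) (g : P -> V),
  [/\ projective P, ses f g & if n is n'.+1 then projdim_le W n' else forall x : W, x = 0].
Proof.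
case=> P [d [e [pP se ex0 exS Pn]]].
pose W := submod (kersub e).
have lval : lin (fun w : W => val w) by move=> a u v; rewrite linearP.
have dP (x : P 1%N) : d 0%N x \in kersub e by apply/eqP/ex0; exists x.
have ldd : lin (fun x : P 1%N => Submod (dP x) : W).
  by move=> a u v; apply: val_inj; rewrite /= linearP.
have sdd (w : W) : exists x, Submod (dP x) = w.
  by have /eqP/ex0 [x ex] := valP w; exists x; apply: val_inj.
exists (P 0%N), W, val, e; split=> //.
  split=> //; [exact: linear_lin | exact: val_inj | by move=> y; have [x] := se y; exists x |].
  move=> x; split=> [/eqP h|[y ->]]; last by apply/eqP; exact: (valP y).
  by exists (Submod (S := kersub e) h).
case: n Pn => [|n] Pn.
  move=> w; have [x <-] := sdd w; apply: val_inj => /=.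
  by rewrite (Pn 1%N _ x) // linear0.
exists (fun i => P i.+1), (fun i => d i.+1), (mklin ldd); split=> //.
- move=> v; rewrite -exS; split=> [/(congr1 val)|h] //; exact: val_inj.
- by move=> i h x; apply: Pn.
Qed.

Lemma good_projdim X n : projdim_le X n -> good X.
Proof.
elim: n X => [|n IH] X /ses_proj_res [P [W [f [g [pP s h]]]]];
  apply: (good_ses s _ (good_proj pP)); [exact: good_trivial | exact: IH].
Qed.

Definition Hfin c D j X := fin (spB c D j X) (spZ c D j X).
Definition Hln c D j X := ln (spB c D j X) (spZ c D j X).

Definition sameH c D j c' D' j' := forall X,
  [/\ exact c D j X = exact c' D' j' X, Hfin c D j X = Hfin c' D' j' X
    & Hln c D j X = Hln c' D' j' X].

Lemma sameH_trans c D j c' D' j' c'' D'' j'' :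
  sameH c D j c' D' j' -> sameH c' D' j' c'' D'' j'' -> sameH c D j c'' D'' j''.
Proof.
by move=> h h' X; have [e f l] := h X; have [e' f' l'] := h' X; rewrite e f l.
Qed.

Definition trunc D : cx A := @Cx A (fun j => rk D j.+1) (fun j => df D j.+1).

Lemma trunc_acyc D : acyc D -> acyc (trunc D).
Proof.
move=> [cD h]; split=> [[|j]|j]; [by rewrite /= mulmx0 | exact: (cD j.+2) | exact: h].
Qed.

Lemma trunc_tacyclic D : tacyclic D -> tacyclic (trunc D).
Proof. by move=> [aD h]; split; [exact: trunc_acyc | move=> j; exact: (h j.+1)]. Qed.

Lemma trunc_same c D j : sameH c (trunc D) j.+1 c D j.+2.
Proof. by case: c => X. Qed.

(* D continued to the right by s : D_0 -> A^q. *)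
Definition extc D q (s : 'M[A]_(rk D 0%N, q)) : cx A :=
  @Cx A (fun j => if j is j'.+1 then rk D j' else q)
    (fun j => match j return 'M_(rk D j, if j is j'.+1 then rk D j' else q) with
       0%N => s | j'.+1 => df D j' end).

Lemma extc_same c D q (s : 'M[A]_(rk D 0%N, q)) j : sameH c (extc s) j.+2 c D j.+1.
Proof. by case: c => X. Qed.

Section Extension.
Variable n : nat.
Hypothesis nA : noeth A^o.
Hypothesis gor : injdim_le A^o n.

(* Exactness at D_0 of the extended complex is the vanishing of an Ext^q(-, A)
   with q arbitrarily large, as the dual complex is exact on its right. *)
Lemma tacyclic_ext D : tacyclic D -> exists q (s : 'M[A]_(rk D 0%N, q)), tacyclic (extc s).
Proof.
move=> [[cD aD] tD]; have [q [P [P0 Px]]] := ker_mx (df D 0%N)^T nA.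
have s0 : df D 0%N *m P^T = 0 by rewrite -[LHS]trmxK trmx_mul trmxK P0 trmx0.
exists q, P^T; split; [split|].
- by move=> [|[|j]]; [rewrite /= mulmx0 | exact: s0 | exact: (cD j.+1)].
- move=> [|j] //=.
  pose c := rk (extc P^T).
  pose M i : 'M[A]_(c i, c i.+1) := match i return 'M_(c i, c i.+1) with
     0%N => P | i'.+1 => (df D i')^T end.
  have := @injdim_right A^o n c M gor; rewrite /= trmxK; apply.
    by case=> [|i] //=; rewrite -trmx_mul (cD i.+1) trmx0.
  by case=> [|i] //=; have /exactP := tD i.
- move=> [|j]; first by apply/exactP; rewrite /= trmxK.
  by have [e _ _] := extc_same false P^T j A^o; rewrite e.
Qed.

(* D' is the dual of D, continued by the successive extensions of D. *)
Lemma tacyclic_dual D : tacyclic D -> exists D', tacyclic D' /\ forall c, sameH c D' 1 (~~ c) D 1.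
Proof.
move=> tD.
have nxt (x : {D | tacyclic D}) : {q & {s : 'M[A]_(rk (sval x) 0%N, q) | tacyclic (extc s)}}.
  by have /cid [q /cid [s ts]] := tacyclic_ext (svalP x); exists q, s.
pose ext x : {D | tacyclic D} := exist _ (extc (sval (projT2 (nxt x)))) (svalP (projT2 (nxt x))).
pose tw := fix tw k : {D | tacyclic D} := if k is k'.+1 then ext (tw k') else exist _ D tD.
pose D' := @Cx A (fun k => if k is k'.+1 then rk (sval (tw k')) 1 else rk D 2)
  (fun k => match k return 'M_(rk (sval (tw k)) 1,
      if k is k'.+1 then rk (sval (tw k')) 1 else rk D 2) with
    0%N => (df D 1%N)^T | k'.+1 => (df (sval (tw k')) 0%N)^T end).
have tw0 k : df (sval (tw k)) 1%N *m df (sval (tw k)) 0%N = 0 by apply: (svalP (tw k)).1.1 1%N.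
have cD' : iscx D'.
  case=> [|[|k]]; first by rewrite /= mulmx0.
    by rewrite /= -trmx_mul (tD.1.1 1%N) trmx0.
  by rewrite /= -trmx_mul (tw0 k.+1) trmx0.
exists D'; split; [split; [split=> //|]|].
- case=> [|k]; first by have /exactP := tD.2 0%N.
  by have /exactP := (svalP (tw k.+1)).2 0%N.
- case=> [|k]; apply/exactP; rewrite /= !trmxK.
    by have := tD.1.2 0%N.
  by have := (svalP (tw k.+1)).1.2 0%N.
by move=> [] X; rewrite /exact /Hfin /Hln /spB /spZ /= ?trmxK.
Qed.

(** Truncation lowers the index of a spot and extension to the right raises it, so homology at one
    positive index can be studied at any other. *)
Lemma tacyclic_move D i p : tacyclic D -> exists D', tacyclic D' /\ forall c, sameH c D i.+1 c D' p.+1.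
Proof.
move=> tD; have [D1 [t1 s1]] : exists D', tacyclic D' /\ forall c, sameH c D i.+1 c D' 1.
  elim: i D tD => [|i IH] D tD; first by exists D.
  have [D1 [t1 s1]] := IH _ (trunc_tacyclic tD); exists D1.
  split; first exact: t1.
  by move=> c; apply: sameH_trans (s1 c) => X; have [-> -> ->] := trunc_same c D i X.
suff [D2 [t2 s2]] : exists D', tacyclic D' /\ forall c, sameH c D1 1 c D' p.+1.
  by exists D2; split=> // c; apply: sameH_trans (s1 c) (s2 c).
elim: p => [|p [D2 [t2 s2]]]; first by exists D1.
have [q [s ts]] := tacyclic_ext t2; exists (extc s).
split=> [//|c]; apply: sameH_trans (s2 c) _ => X.
by have [-> -> ->] := extc_same c s p X.
Qed.

(** [good] concerns dual complexes; for D itself, [tacyclic_dual] presents its homology as that of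
    the dual of another totally acyclic complex. *)
Lemma good_exact X c D j : good X -> tacyclic D -> exact c D j.+1 X.
Proof.
move=> gX tD; case: c; last exact: gX.
have [D1 [t1 s1]] := tacyclic_move j 0 tD; have [D2 [t2 s2]] := tacyclic_dual t1.
have [-> _ _] := s1 true X; have [<- _ _] := s2 false X.
exact: gX.
Qed.

End Extension.

End Dimension.

(** * Maximal regular sequences of a Gorenstein local ring *)

Section LocalExt.
Variables (A : comNzRingType) (m : sub A^o).
Hypothesis m1 : ~ m 1.
Hypothesis m_unit : forall a : A, ~ m a -> exists b : A, b * a = 1.
Hypothesis nA : noeth A^o.
Implicit Types L V W X : lmodType A.
Implicit Types D : cx A.

Lemma sann_max V (S : sub V) v : ~ S v -> exists u, [/\ ~ S u, sle (sann S v) (sann S u)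
  & forall w, ~ S w -> sle (sann S u) (sann S w) -> sle (sann S w) (sann S u)].
Proof.
move=> Sv.
have [|J [u [Su ->]] vu mx] := @noeth_max _ _
    (fun J => exists u, [/\ ~ S u, J = sann S u & sle (sann S v) J]) nA.
  by exists (sann S v), v.
exists u; split=> // w Sw uw; apply: mx => //; exists w; split=> //; exact: sle_trans uw.
Qed.

Definition maxann V (S : sub V) u := ~ S u /\
  forall w, ~ S w -> sle (sann S u) (sann S w) -> sle (sann S w) (sann S u).

Lemma maxann_prime V (S : sub V) u : maxann S u -> prime_sub (sann S u).
Proof.
move=> [Su mx]; split=> [|a b Sab]; first by rewrite sannE scale1r.
have [Sb|Sb] := pselect (S (b *: u)); first by right.
left; apply: (mx (b *: u)) => //; last by rewrite sannE scalerA.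
by move=> c; rewrite !sannE scalerA mulrC -scalerA; exact: memZ.
Qed.

Lemma prime_avoid_prod V (S : sub V) (u : V) (l : seq V) : prime_sub (sann S u) ->
  (forall w, w \in l -> exists a, ~ (sann S w a -> sann S u a)) ->
  exists2 a : A, ~ sann S u a & forall w, w \in l -> sann S w a.
Proof.
move=> [pu1 pu]; elim: l => [|w l IH] h; first by exists 1.
have [v vl|a pa la] := IH; first by apply: h; rewrite inE vl orbT.
have [b /not_implyP [wb ub]] := h w (mem_head _ _).
exists (a * b); first by case/pu.
move=> v; rewrite inE => /orP[/eqP ->|/la va]; first exact: (memZ (S := sann S w)).
by rewrite mulrC; apply: (memZ (S := sann S v)).
Qed.

(** Take S + (l) maximal, with l consisting of elements of maximal annihilator. Any further such u
    lies in it, so (S : u) contains the intersection of the (S : w), w in l, and, being prime, one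
    of them. *)
Lemma maxann_finite V (S : sub V) : noeth V -> exists l : seq V,
  (forall u, u \in l -> maxann S u) /\
  forall v, ~ S v -> exists2 u, u \in l & sle (sann S v) (sann S u).
Proof.
move=> nV.
have [|T [l [lm ->]] mx] := @noeth_max _ _
    (fun T => exists l : seq V, (forall u, u \in l -> maxann S u) /\ T = sadd S (spn l)) nV.
  by exists (sadd S (spn [::])), [::].
exists l; split=> // v /sann_max [u [Su vu um]].
have um' : maxann S u by split.
suff [w wl wu] : exists2 w, w \in l & sle (sann S w) (sann S u).
  exists w => //; apply: sle_trans vu _; have [Sw wm] := lm w wl; exact: wm.
have Tu : sadd S (spn l) u.
  apply: (mx (sadd S (spn (u :: l)))).
  - exists (u :: l); split=> // w; rewrite inE => /orP[/eqP -> //|]; exact: lm.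
  - by apply: sadd_mono => //; apply: sadd_r.
  - by apply: sadd_r; apply: sadd_l; apply: scyc_mem.
have [pu1 pu] := maxann_prime um'; apply: contrapT => h.
have [a pa la] : exists2 a : A, ~ sann S u a & forall w, w \in l -> sann S w a.
  apply: prime_avoid_prod => [//|w wl]; apply/existsNP => hw.
  by apply: h; exists w => //; rewrite /sle.
apply: pa; rewrite sannE.
have : sle (sadd S (spn l)) (scol a S).
  by apply: sadd_lub => [v0 Sv0|]; [apply: memZ | apply: spn_le].
by apply.
Qed.

(* Prime avoidance for the maximal associated primes. *)
Lemma depth_pos V (S : sub V) : noeth V ->
  (forall u, ~ S u -> exists2 z : A, m z & ~ S (z *: u)) ->
  exists2 z : A, m z & forall v, S (z *: v) -> S v.
Proof.
move=> nV h; have [l [lm lv]] := maxann_finite S nV.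
suff [z mz hz] : exists2 z, m z & forall u, u \in l -> ~ sann S u z.
  exists z => // v Szv; apply: contrapT => /lv [u ul vu].
  by apply: (hz u ul); apply: vu.
elim: l lm {lv} => [|u l IH] lm; first by exists 0 => //; apply: mem0.
have [|z mz hz] := IH; first by move=> w wl; apply: lm; rewrite inE wl orbT.
have um := lm u (mem_head _ _); have [pu1 pu] := maxann_prime um.
have [uz|uz] := pselect (sann S u z); last first.
  by exists z => // w; rewrite inE => /orP[/eqP ->|/hz].
(* If some (S : w) were inside (S : u), they would be equal by maximality; but z lies in (S : u) and
   not in (S : w). *)
have [a pa la] : exists2 a : A, ~ sann S u a & forall w, w \in l -> sann S w a.
  apply: prime_avoid_prod => [//|w wl]; apply/existsNP => hw.
  have [Sw wm] : maxann S w by apply: lm; rewrite inE wl orbT.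
  apply: (hz w wl); apply: wm uz; first by case: um.
  by rewrite /sle => b; apply: contrapT => hb; apply: hb; apply: hw.
have [b mb ub] := h u um.1.
(* z lies in (S : u) and in no (S : w), while a * b lies in every (S : w) and not in (S : u): the
   sum avoids them all. *)
exists (z + a * b).
  by apply: memD => //; apply: (memZ (S := m)).
move=> w; rewrite inE => /orP[/eqP -> huz|wl huz].
  have : sann S u (a * b) by apply: memDr uz huz.
  by case/pu.
apply: (hz w wl).
have abw : sann S w (a * b) by rewrite mulrC; apply: (memZ (S := sann S w)); apply: la.
by apply: (memDr abw); rewrite addrC.
Qed.

Lemma res_zero L (S : sub L) : exists D, res S S D /\ forall c j X, exact c D j X.
Proof.
have z0 X (x : {ffun 'I_0 -> X}) : x = 0 by apply/ffunP => -[].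
exists (@Cx A (fun=> 0%N) (fun=> 0)); split.
  split; first by split=> [j|j x _]; [rewrite mul0mx | exists 0; rewrite [LHS]z0 [RHS]z0].
  exists (fun=> 0); split=> [[]//|x|v Sv].
    rewrite /lc big_ord0; split=> _; last exact: mem0.
    by exists 0; rewrite [LHS]z0 [RHS]z0.
  by exists 0; rewrite /lc big_ord0 subr0.
by move=> c j X x _; rewrite [x]z0; apply: mem0.
Qed.

Lemma res_ring : exists D, res (bot : sub A^o) top D /\ forall j, exact false D j.+1 A^o.
Proof.
have z0 X (x : {ffun 'I_0 -> X}) : x = 0 by apply/ffunP => -[].
exists (@Cx A (fun j => if j is _.+1 then 0%N else 1%N) (fun=> 0)); split.
  split.
    split=> [j|j x _]; first by rewrite mul0mx.
    by exists 0; rewrite [LHS]z0 [RHS]z0.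
  have E x : lc (fun _ : 'I_1 => (1 : A^o)) x = x ord0.
    by rewrite /lc big_ord1 -[RHS]mulr1.
  exists (fun=> 1); split=> // [x|v _].
    rewrite E; split=> [h|[u ->]]; last by rewrite mxmap0l ffunE.
    by exists 0; rewrite mxmap0l; apply/ffunP => i; rewrite [i]ord1 ffunE.
  by exists [ffun=> v]; rewrite E ffunE subrr.
by move=> j x _; rewrite [x]z0; apply: mem0.
Qed.

(* Ext^j(T / S, A) = 0 *)
Definition ext_zero j L (S T : sub L) := exists D, res S T D /\ exact false D j A^o.

Lemma ext_zero_exact j L (S T : sub L) D : res S T D -> ext_zero j S T -> exact false D j A^o.
Proof. by move=> r [D' [r' e]]; apply: hom_equiv_exact (res_equiv r r') e. Qed.

(** The vanishing of Ext^(j+1) of the quotient by y makes y surjective on Ext^j(T / S, A), which is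
    then zero by Nakayama. *)
Lemma ext_zero_cone_down j L (S T : sub L) (y : A) : noeth L -> sle S T -> m y ->
  (forall v, T v -> S (y *: v) -> S v) -> ext_zero j.+1 (sadd S (sscale y T)) T -> ext_zero j S T.
Proof.
move=> nL ST my reg ev; have [D rD] := res_exists S T nA nL.
have e := ext_zero_exact (cone_res ST reg rD) ev; exists D; split=> //.
by apply: (nakayama m1 m_unit (noeth_ffun nA nA) my); apply: cone_surj.
Qed.

Lemma ext_zero_cone_up j L (S T : sub L) (y : A) : sle S T ->
  (forall v, T v -> S (y *: v) -> S v) -> ext_zero j S T -> ext_zero j.+1 S T ->
  ext_zero j.+1 (sadd S (sscale y T)) T.
Proof.
move=> ST reg [D [rD e]] ev; exists (cone D y); split; first exact: cone_res.
exact: triple_exact (blk_triple (cone_comp D y) false j A^o) e (ext_zero_exact rD ev).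
Qed.

Lemma ext_zero_ext j L (S Y T : sub L) : sle S Y -> sle Y T ->
  ext_zero j.+1 S Y -> ext_zero j.+1 Y T -> ext_zero j.+1 S T.
Proof.
move=> SY YT [D1 [r1 e1]] [D2 [r2 e2]]; have [t [ct r]] := horseshoe SY YT r1 r2.
by exists (blk t); split=> //; apply: triple_exact (blk_triple ct false j A^o) e2 e1.
Qed.

Lemma ext_zero_sub j L (S Y T : sub L) : noeth L -> sle S Y -> sle Y T ->
  ext_zero j.+1 S T -> ext_zero j.+2 Y T -> ext_zero j.+1 S Y.
Proof.
move=> nL SY YT ev [D2 [r2 e2]]; have [D1 r1] := res_exists S Y nA nL.
have [t [ct r]] := horseshoe SY YT r1 r2; exists D1; split=> //.
by have := blk_exact_sub ct (ext_zero_exact r ev) e2 r1.1.1 r2.1.1.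
Qed.

Fixpoint sq (x : nat -> A) L k : sub L :=
  if k is k'.+1 then sadd (sq x L k') (sscale (x k') top) else bot.

Section MaxRegular.
Variables (n s : nat) (x : nat -> A).
Hypothesis gor : injdim_le A^o n.
Hypothesis xm : forall i, (i < s)%N -> m (x i).
Hypothesis xreg : forall i, (i < s)%N -> forall v, sq x A^o i (x i *: v) -> sq x A^o i v.
Hypothesis xmax : forall z : A, m z -> ~ forall v, sq x A^o s (z *: v) -> sq x A^o s v.

Let Xs k := sq x A^o k.

(** The iterated cone resolves A / (x_0, ..., x_(k-1)) in length k. *)
Lemma ext_zero_sq k j : (k <= s)%N -> (k < j)%N -> ext_zero j (Xs k) top.
Proof.
elim: k j => [|k IH] j; case: j => // j.
  by move=> _ _; have [D [r e]] := res_ring; exists D.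
move=> ks kj; apply: ext_zero_cone_up => //; first by move=> v _; apply: xreg.
  by apply: IH => //; apply: ltnW.
by apply: IH; [apply: ltnW | apply: ltnW].
Qed.

Lemma sq_le_m k : (k <= s)%N -> sle (Xs k) m.
Proof.
elim: k => [|k IH] ks; first by move=> v ->; apply: mem0.
apply: sadd_lub; first by apply: IH; apply: ltnW.
by move=> _ [v _ ->]; rewrite -[_ *: v]/(x k * v) mulrC; apply: memZ; apply: xm.
Qed.

(** As x is maximal, no element of m is regular on A / (x); by [depth_pos], k then embeds in A /
    (x). *)
Lemma socle : exists2 u, ~ Xs s u & forall z : A, m z -> Xs s (z *: u).
Proof.
apply: contrapT => h; have [|z mz hz] := @depth_pos _ (Xs s) nA.
  move=> u Su; apply: contrapT => hu; apply: h; exists u => // z mz.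
  by apply: contrapT => hz; apply: hu; exists z.
exact: xmax mz hz.
Qed.

Lemma qiso_cyc L (S : sub L) u :
  qiso (fun a : A^o => (a : A) *: u) (sann S u) top S (sadd S (scyc u)).
Proof.
split=> //; first exact: lin_act.
- by move=> v _; apply: sadd_r; apply/memZ/scyc_mem.
- by move=> w /sadd_cyc [a h]; exists a.
- exact: sadd_l.
Qed.

(* Descending induction on j, by devissage: a prime p <> m is handled by Nakayama,
   and k embeds in A / (x), whose projective dimension is s. *)
Theorem ext_vanish j L (S T : sub L) : (s < j)%N -> noeth L -> sle S T -> ext_zero j S T.
Proof.
(* k bounds the distance of r from the range r > n, where injective dimension gives the base
   case. *)
suff H k : forall r, (s < r)%N -> (n < r + k)%N ->
    forall L (S T : sub L), noeth L -> sle S T -> ext_zero r S T.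
  by move=> sj nL ST; apply: (H n.+1 j sj _ L S T nL ST); rewrite addnS ltnS leq_addl.
elim: k => [|k IHk] r sr nr {}L {}S {}T nL.
  move=> _; have [D rD] := res_exists S T nA nL; exists D; split=> //.
  by apply: injdim_left gor rD.1 _; rewrite addn0 in nr.
have IH := IHk r.+1 (ltnW sr); rewrite addSnnS in IH; have {IHk}IH := IH nr.
case: r sr nr IH => // r sr nr IH.
move: S; apply: noeth_ind => // S IHS ST.
have [TS|/(assoc_prime nA) [u [Tu Su pu]]] := pselect (sle T S).
  have -> : S = T by apply: sle_anti.
  by have [D [rD e]] := res_zero T; exists D.
have SuT : sle (sadd S (scyc u)) T by apply: sadd_lub => //; apply: scyc_le.
apply: (ext_zero_ext (Y := sadd S (scyc u))) => //; first exact: sadd_l; last first.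
  by apply: IHS => //; [exact: sadd_l | move/(_ _ (sadd_r (scyc_mem u)))].
suff [D [rD e]] : ext_zero r.+1 (sann S u) top.
  by exists D; split=> //; apply: res_push rD; apply: qiso_cyc.
have [mp|/existsNP [z /not_implyP [mz pz]]] := pselect (sle m (sann S u)).
  (* The prime is m. For k = A u0 inside A / (x), Ext^(r+1) lies between that of A / (x), zero as r
     + 1 > s, and Ext^(r+2) of the cokernel, zero by induction. *)
  have [u0 Xu0 mu0] := socle.
  have [D [rD e]] : ext_zero r.+1 (Xs s) (sadd (Xs s) (scyc u0)).
    apply: (ext_zero_sub (T := top)) => //; first exact: sadd_l.
      exact: ext_zero_sq.
    by apply: IH.
  exists D; split=> //; suff <- : sann (Xs s) u0 = sann S u.
    by apply: res_pull rD; apply: qiso_cyc.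
  apply: sle_anti; last by apply: sle_trans (proper_le_m m_unit pu.1) _ => z; apply: mu0.
  apply: sle_trans mp; apply: (proper_le_m m_unit); by rewrite sannE scale1r.
apply: (ext_zero_cone_down nA _ mz) => //; last exact: IH.
by move=> v _ h; case: pu => _ /(_ z v h) [].
Qed.

(** As a annihilates A / p, multiplication by a on the resolution lifts the zero map. *)
Lemma null_scale D (p : sub A^o) a : res p top D -> p a -> forall j, exists h k,
  a%:M = df_in D j *m h + k *m df D j.
Proof.
move=> [aD [e he]] pa; apply: (@null_homotopy _ D (fun j => a%:M) aD).
  by move=> j; rewrite mul_mx_scalar mul_scalar_mx.
apply: (aug_ker he) => i; rewrite rowf_delta mxmap_scalar (linZ _ _ (lc_lin _)).
by rewrite -[a *: _]/(a * _) mulrC; apply: (memZ (S := p)).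
Qed.

Lemma null_kill D a j X : iscx D -> (exists h k, a%:M = df_in D j *m h + k *m df D j) ->
  forall z, spZ false D j X z -> spB false D j X (a *: z).
Proof.
move=> cD [h [k e]] z /spZP /= hz; apply/spBP; exists (mxmap X h^T z).
rewrite -mxmapM -trmx_mul -mxmap_scalar -tr_scalar_mx e linearD /= mxmapDl.
by rewrite [in X in _ + X]trmx_mul [in X in _ + X]mxmapM hz (lin0 (mxmap_lin _)) addr0.
Qed.

Let C k : lmodType A := quotmod (toS (Xs k)).

Lemma ses_C k : (k < s)%N -> exists g : C k -> C k.+1, ses (fun v => x k *: v) g.
Proof. by move=> ks; have [g [h _]] := ses_quot (xreg ks); exists g. Qed.

(** x_k acts as zero on Ext^j(A / p, C k), since it lies in p, and injectively, since Ext^(j-1)(A /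
    p, C k.+1) vanishes by induction. *)
Lemma C_exact_low D (p : sub A^o) : res p top D -> (forall i, (i < s)%N -> p (x i)) ->
  forall i k j, (k + i)%N = s -> (j < i)%N -> exact false D j (C k).
Proof.
move=> rD px; elim=> // i IH k j ks; rewrite ltnS => ji.
have k_s : (k < s)%N by rewrite -ks -addSnnS leq_addr.
have [g sg] := ses_C k_s; apply/exactP.
have kl z : mxmap (C k) (outM false D j) z = 0 ->
    exists y, x k *: z = mxmap (C k) (inM false D j) y.
  move=> hz; apply/spBP; apply: (null_kill rD.1.1); last exact/spZP.
  exact: null_scale rD (px _ k_s) j.
case: j ji kl => [|j] ji kl.
  apply: (step_kill sg (O := (0 : 'M_(0, 0)))) kl; first by rewrite mul0mx.
  by move=> z _; exists 0; apply/ffunP => -[].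
apply: (step_kill sg (O := (df_in D j)^T)) kl.
  by rewrite /= -trmx_mul rD.1.1 trmx0.
by have /exactP := IH k.+1 j (etrans (addSnnS _ _) ks) ji.
Qed.

(** [C 0] is A / 0, isomorphic but not equal to A; this sequence with zero kernel carries results
    across. *)
Lemma ses_C0 : ses (fun _ : {ffun 'I_0 -> A^o} => 0 : A^o) (piq (toS (Xs 0))).
Proof.
split; [by move=> a u v; rewrite scaler0 addr0 | exact: piq_lin | | exact: piq_surj |].
  by move=> z z' _; apply/ffunP => -[].
move=> v; split=> [/piq_eq0 /toSP -> | [_ ->]]; first by exists 0.
by apply/piq_eq0/toSP.
Qed.

Lemma exact_C0 D j : iscx D -> exact false D j A^o -> exact false D j (C 0).
Proof.
move=> cD /exactP e; apply/exactP; apply: (step_r ses_C0 (R := (df D j.+1)^T)) => //.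
  by rewrite /= -trmx_mul (cD j.+1) trmx0.
by apply: exact_on_trivial => z; apply/ffunP => -[].
Qed.

Lemma good_C k : (k <= s)%N -> good (C k).
Proof.
elim: k => [|k IH] ks.
  apply: good_ses ses_C0 _ (@good_ring A); apply: good_trivial => z.
  by apply/ffunP => -[].
have [g sg] := ses_C ks; have gk := IH (ltnW ks); by apply: (good_ses sg).
Qed.

Lemma sq_mem i k : (i < k)%N -> Xs k (x i).
Proof.
elim: k => // k IH; rewrite ltnS leq_eqVlt => /orP[/eqP ->|/IH]; last exact: sadd_l.
by apply: sadd_r; exists 1 => //; rewrite -[_ *: _]/(_ * _) mulr1.
Qed.

(** Trades one degree for one x_k: Ext^i(A / p, C k.+1) lies between Ext^i and Ext^(i+1) of C k,
    down to Hom(A / p, A / (x)). *)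
Lemma C_exact D (p : sub A^o) : res p top D -> (forall i, (i < s)%N -> p (x i)) ->
  exact false D s A^o -> forall k i, (k + i)%N = s -> exact false D i (C k).
Proof.
move=> rD px es; elim=> [|k IH] i ks; first by apply: exact_C0 rD.1.1 _; rewrite -ks add0n in es.
have k_s : (k < s)%N by rewrite -ks leq_addr.
have [g sg] := ses_C k_s; apply/exactP/(step_r sg (R := (df D i.+1)^T)).
- by rewrite /= -trmx_mul (rD.1.1 i.+1) trmx0.
- by apply/exactP; apply: (C_exact_low rD px (i := i.+1)); rewrite // addnS -addSn.
- by have /exactP := IH i.+1 (etrans (addnS _ _) ks).
Qed.

(** An element u with p u inside (x) defines a map from A / p to A / (x), that is, the degree 0
    cocycle [z]. *)
Lemma C_hom D (p : sub A^o) (u : A) : res p top D -> exact false D 0 (C s) -> (forall a, p a -> Xs s (a * u)) ->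
  Xs s u.
Proof.
move=> [_ [e [_ ek eg]]] ex pu.
pose z : {ffun 'I_(rk D 0) -> C s} := [ffun i => piq (toS (Xs s)) ((e i : A) * u)].
have zE (v : {ffun 'I_(rk D 0) -> A^o}) :
    piq (toS (Xs s)) ((lc e v : A) * u) = \sum_i (v i : A) *: z i.
  rewrite /lc mulr_suml (big_morph _ (fun a b => linD a b (@piq_lin _ _ _)) (lin0 (@piq_lin _ _ _))).
  by apply: eq_bigr => i _; rewrite ffunE -(linZ _ _ (@piq_lin _ _ _)) -mulrA.
have : spZ false D 0 (C s) z.
  apply/spZP/ffunP => i; rewrite !ffunE.
  have := zE (rowf (df D 0%N) i).
  rewrite [LHS](_ : _ = 0); last first.
    by apply/piq_eq0/toSP/pu/ek; exists (delta i 1); rewrite rowf_delta.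
  by move=> {2}->; apply: eq_bigr => j _; rewrite !ffunE mxE.
move=> /ex /spBP [y]; rewrite /= trmx0 mxmap0l => z0.
have [v hv] := eg 1 I.
have := zE v; rewrite z0 big1 => [/piq_eq0 /toSP h|i _]; last by rewrite ffunE scaler0.
by have := memD (pu _ hv) h; rewrite -mulrDl subrK mul1r.
Qed.

(* Otherwise A / p embeds in A / (x) for some p on which z is regular modulo p; then
   Ext^s(A / p, A) = 0 by Nakayama, while Hom(A / p, A / (x)) embeds in it. *)
Lemma sq_radical (z : A) : m z -> exists e, Xs s (z ^+ e).
Proof.
move=> mz.
(* Once the colons (x : z^e) are stationary, z is regular modulo p = (x : z^e). *)
have [|e he] := noeth_acc (S := fun e => scol (z ^+ e) (Xs s)) nA.
  by move=> e v h; rewrite scolE exprS -scalerA; apply: memZ.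
exists e; apply: contrapT => hu; pose p := sann (Xs s) (z ^+ e : A^o).
have px i : (i < s)%N -> p (x i).
  by move=> /sq_mem h; rewrite /p sannE -[_ *: _]/(_ * _) mulrC; apply: (memZ (S := Xs s)).
have [D [rD es]] : ext_zero s p top.
  apply: (ext_zero_cone_down nA _ mz) => //; last exact: ext_vanish.
  move=> v _; rewrite /p !sannE => h; rewrite -[_ *: _]/(_ * _) mulrC; apply: (he e.+1).
  by rewrite scolE exprSr -scalerA -[_ *: _]/(_ * _) mulrC.
apply: hu; apply: (C_hom rD); first by apply: (C_exact rD px es); rewrite addn0.
by [].
Qed.

End MaxRegular.
End LocalExt.

(** * Comparison with the residue field *)

Section Core.
Variables (A : comNzRingType) (m : sub A^o).
Hypothesis m1 : ~ m 1.
Hypothesis m_unit : forall a : A, ~ m a -> exists b : A, b * a = 1.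
Hypothesis nA : noeth A^o.
Variables (n s : nat) (x : nat -> A).
Hypothesis gor : injdim_le A^o n.
Hypothesis xm : forall i, (i < s)%N -> m (x i).
Hypothesis xreg : forall i, (i < s)%N -> forall v, sq x A^o i (x i *: v) -> sq x A^o i v.
Hypothesis xmax : forall z : A, m z -> ~ forall v, sq x A^o s (z *: v) -> sq x A^o s v.
Implicit Types L V W : lmodType A.
Implicit Types D : cx A.

Lemma sq_sim V W (f : V -> W) (lf : lin f) k v : sq x V k v -> sq x W k (f v).
Proof.
elim: k v => [|k IH] v; first by move=> ->; rewrite lin0 //; apply: mem0.
move=> [u Su [w _ e]]; exists (f u); first exact: IH.
by exists (f w); rewrite // -linB // e linZ.
Qed.

Lemma sq_coord k p (v : {ffun 'I_p -> A^o}) :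
  (forall i, sq x A^o k (v i)) -> sq x {ffun 'I_p -> A^o} k v.
Proof.
move=> h; rewrite [v]delta_sum; apply: mem_sum => i _.
by apply: sq_sim (h i); apply: delta_lin.
Qed.

Lemma sq_act V k (a : A) (v : V) : sq x A^o k a -> sq x V k (a *: v).
Proof. by apply: sq_sim (lin_act v) _ _. Qed.

Section Koszul.
Variable D : cx A.
Hypothesis tD : tacyclic D.
Let L : lmodType A := {ffun 'I_(rk D 0) -> A^o}.

(* coker D_0 modulo (x_0, ..., x_(k-1)), as a quotient by ksub k, and its resolution
   by the k-fold cone. *)
Fixpoint ksub k : sub L :=
  if k is k'.+1 then sadd (ksub k') (sscale (x k') top)
  else sim (mxmap_lin (X := A^o) (df D 0%N)) top.

Fixpoint kos k : cx A := if k is k'.+1 then cone (kos k') (x k') else D.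

Lemma sq_ksub k : sle (sq x L k) (ksub k).
Proof.
elim: k => [|k IH]; first by move=> v ->; apply: mem0.
exact: sadd_mono.
Qed.

(* D extends to the right, so coker D_0 modulo (x_0, ..., x_(k-1)) embeds in a
   free module over A / (x_0, ..., x_(k-1)), on which x_k is regular. *)
Lemma ksub_reg k : (k < s)%N -> forall v, ksub k (x k *: v) -> ksub k v.
Proof.
have [q [t tE]] := tacyclic_ext nA gor tD.
have H j : (j <= s)%N -> forall v, ksub j v <-> forall i, sq x A^o j (mxmap A^o t v i).
  move=> js v; split.
    elim: j v {js} => [|j IH] v.
      by move=> [u _ ->] i; rewrite -mxmapM (tE.1.1 1%N) mxmap0l ffunE.
    move=> [u /IH hu [w _ e]] i; exists (mxmap A^o t u i); first exact: hu.
    exists (mxmap A^o t w i) => //.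
    have := congr1 (fun z => mxmap A^o t z i) e.
    by rewrite (linB _ _ (mxmap_lin _)) (linZ _ _ (mxmap_lin _)) !ffunE.
  move=> h; pose C := quotmod (toS (sq x A^o j)) : lmodType A.
  (* A / (x_0, ..., x_(j-1)) is [good], so the extended complex stays exact at D_0 over it. *)
  have /exactP := @good_exact A n nA gor _ true _ 0 (good_C xreg js) tE => ex.
  have [|u eu] := ex (fmap (piq (toS (sq x A^o j))) v).
    rewrite /= mxmap_fmap; last exact: piq_lin.
    by apply/ffunP => i; rewrite !ffunE; apply/piq_eq0/toSP; have := h i; rewrite ffunE.
  have /choice [w hw] : forall i, exists a : A^o, u i = piq (toS (sq x A^o j)) a.
    by move=> i; apply: piq_surj.
  have E : u = fmap (piq (toS (sq x A^o j))) [ffun i => w i].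
    by apply/ffunP => i; rewrite !ffunE hw.
  rewrite E /= mxmap_fmap in eu; last exact: piq_lin.
  set u' := mxmap A^o (df D 0%N) _ in eu.
  have k1 : ksub j (v - u').
    apply/sq_ksub/sq_coord => i; apply/toSP/piq_eq0; rewrite !ffunE (linB _ _ (@piq_lin _ _ _)).
    by have /ffunP/(_ i) := eu; rewrite !ffunE => ->; rewrite subrr.
  apply: memBl k1; have : ksub 0 u' by exists [ffun i => w i].
  by elim: (j) => // l IHl /IHl; apply: sadd_l.
move=> ks v /(H _ (ltnW ks)) h; apply/(H _ (ltnW ks)) => i.
by apply: (xreg ks); have := h i; rewrite (linZ _ _ (mxmap_lin _)) ffunE.
Qed.

Lemma kos_res k : (k <= s)%N -> res (ksub k) top (kos k).
Proof.
elim: k => [_|k IH ks]; last first.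
  by apply: cone_res (IH (ltnW ks)) => // v _; apply: ksub_reg.
split; first exact: tD.1.
have E v : lc (fun i => delta i (1 : A^o)) v = v.
  rewrite [RHS]delta_sum; apply: eq_bigr => i _; rewrite -(linZ _ _ (delta_lin i)).
  by rewrite -[_ *: 1]/(_ * _) mulr1.
exists (fun i => delta i 1); split=> // [v|v _].
  by rewrite E; split=> [[u _ ->]|[u ->]]; exists u.
by exists v; rewrite E subrr; apply: mem0.
Qed.

End Koszul.

(** X i will be N / I^i N. In [Xkill] the exponent e comes before i, which makes the constants below
    uniform. *)
Variable X : nat -> lmodType A.
Hypothesis Xfin : forall c D j i, Hfin c D j (X i).
Hypothesis Xkill : forall c D j, tacyclic D -> forall z, m z -> exists e, forall i v,
  spZ c D j.+1 (X i) v -> spB c D j.+1 (X i) (z ^+ e *: v).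

(** Exponents add along the long exact sequence of a cone. Each cone involves the previous complex
    at two neighbouring spots, so k cones require k <= j. *)
Lemma kos_kill D k c j z : tacyclic D -> m z -> (k <= j)%N -> exists e, forall i v,
  spZ c (kos D k) j.+1 (X i) v -> spB c (kos D k) j.+1 (X i) (z ^+ e *: v).
Proof.
move=> tD mz; elim: k j => [|k IH] j; first by move=> _; apply: Xkill.
case: j => // j kj.
have [e1 h1] := IH j.+1 (leqW kj); have [e2 h2] := IH j kj.
exists (e1 + e2)%N => i v; rewrite exprD.
case: c h1 h2 IH => h1 h2 _; last rewrite mulrC.
  exact: (triple_kill (blk_triple (cone_comp (kos D k) (x k)) true j.+1 (X i)) (h1 i) (h2 i)).
exact: (triple_kill (blk_triple (cone_comp (kos D k) (x k)) false j.+1 (X i)) (h2 i) (h1 i)).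
Qed.

(** [nilpotent_ln] followed by [cone_lower]: each cone costs a factor e and raises the index by
    one. *)
Lemma kos_lower D c p k : tacyclic D -> (k <= s)%N -> exists C, forall i,
  (Hln c D p.+1 (X i) <= C * Hln c (kos D k) (p + k).+1 (X i))%N.
Proof.
move=> tD; elim: k => [_|k IH ks]; first by exists 1%N => i; rewrite addn0 mul1n.
have [C hC] := IH (ltnW ks).
have [e he] := kos_kill c tD (xm ks) (leq_addl p k).
have cK := (kos_res tD (ltnW ks)).1.1.
exists (C * e)%N => i; apply: leq_trans (hC i) _; rewrite -mulnA leq_mul2l; apply/orP; right.
apply: leq_trans (nilpotent_ln (spBZ cK) (Xfin _ _ _ _) (he i)) _.
rewrite leq_mul2l addnS; apply/orP; right.
by apply: (cone_lower cK); apply: Xfin.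
Qed.

Variable K : cx A.
Hypothesis rK : res m top K.

(** All primes (S : u) that occur are equal to m, so each step adds one copy of the resolution K of
    k by the horseshoe lemma, and C counts the copies. *)
Lemma devissage c q L (S : sub L) : noeth L ->
  (forall z, m z -> exists e, forall v : L, S (z ^+ e *: v)) ->
  exists D, res S top D /\ exists C, forall i,
    (Hln c D q.+1 (X i) <= C * Hln c K q.+1 (X i))%N.
Proof.
move=> nL; move: S; apply: noeth_ind => // S IH h.
have [TS|/(assoc_prime nA) [u [_ Su pu]]] := pselect (sle top S).
  have -> : S = top by apply: sle_anti.
  have [D [rD e]] := res_zero (@top _ L); exists D; split=> //; exists 0%N => i.
  rewrite mul0n leqn0 /Hln (_ : spB _ _ _ _ = spZ c D q.+1 (X i)) ?(ln_id _).2 //.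
  by apply: sle_anti; [apply: spBZ; case: rD => -[] | apply: e].
have Em : sann S u = m.
  apply: sle_anti; first exact: (proper_le_m m_unit pu.1).
  by move=> z /h [e he]; apply: (prime_exp (e := e) pu); apply: he.
have rK' : res S (sadd S (scyc u)) K by apply: res_push rK; rewrite -Em; apply: qiso_cyc.
have [||D [rD [C hC]]] := IH (sadd S (scyc u)) (@sadd_l _ _ _ _).
- by move/(_ _ (sadd_r (scyc_mem u))).
- by move=> z /h [e he]; exists e => v; apply: sadd_l.
have [t [ct r]] := horseshoe (@sadd_l _ _ S (scyc u)) (@sle_top _ _ _) rK' rD.
exists (blk t); split=> //; exists C.+1 => i.
have cK := rK'.1.1; have cD := rD.1.1; have cB := r.1.1.
rewrite mulSn; case: c hC {IH} => hC.
  have [_ le] := triple_ln (blk_triple ct true q (X i)) (spBZ cK) (spBZ cB) (spBZ cD)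
    (Xfin _ _ _ _) (Xfin _ _ _ _).
  by apply: leq_trans le _; rewrite leq_add2l; apply: hC.
have [_ le] := triple_ln (blk_triple ct false q (X i)) (spBZ cD) (spBZ cB) (spBZ cK)
    (Xfin _ _ _ _) (Xfin _ _ _ _).
by apply: leq_trans le _; rewrite addnC leq_add2l; apply: hC.
Qed.

(* Each x_k acts nilpotently on the homology, so passing to the cone of x_k loses
   at most a constant factor; the last cone resolves a module filtered by k. *)
Theorem core D c j p : tacyclic D -> exists C, forall i,
  (Hln c D j.+1 (X i) <= C * Hln c K (p + s).+1 (X i))%N.
Proof.
move=> tD; have [D1 [t1 e1]] := tacyclic_move nA gor j p tD.
have [C1 h1] := kos_lower c p t1 (leqnn s).
have rk := kos_res t1 (leqnn s).
have [||D2 [r2 [C2 h2]]] := @devissage c (p + s)%N _ (ksub D1 s).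
- exact: noeth_ffun.
- move=> z mz; have [e he] := sq_radical m1 m_unit nA gor xreg xmax mz.
  by exists e => v; apply/sq_ksub/sq_act.
exists (C1 * C2)%N => i; have [_ _ ->] := e1 c (X i).
apply: leq_trans (h1 i) _; rewrite -mulnA leq_mul2l; apply/orP; right.
apply: leq_trans (h2 i).
exact: (hom_equiv_ln rk.1.1 r2.1.1 (res_equiv rk r2) (Xfin _ _ _ _)).2.
Qed.

End Core.

(** * Tor and Ext with coefficients in N / I^n N *)

Section Translation.
Variable A : comNzRingType.
Implicit Types V W X L : lmodType A.

Lemma lin_sum V W (f : V -> W) I (r : seq I) (P : pred I) (F : I -> V) : lin f ->
  f (\sum_(i <- r | P i) F i) = \sum_(i <- r | P i) f (F i).
Proof. by move=> lf; rewrite (big_morph _ (fun u v => linD u v lf) (lin0 lf)). Qed.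

Lemma val_lin V (S : submodClosed V) : lin (fun w : submod S => val w).
Proof. by move=> a u v; rewrite linearP. Qed.

Lemma noetherian_noeth : noetherian A -> noeth A^o.
Proof.
move=> nA S; have [n [g hg]] := nA (toS S).
exists [seq val (g i) | i <- enum 'I_n]; apply: sle_anti => [v Sv|].
  have hv : v \in toS S by apply/toSP.
  have [c e] := hg (Submod hv); have -> : v = val (\sum_i c i *: g i) by rewrite -e.
  rewrite (lin_sum _ _ _ (@val_lin _ _)); apply: mem_sum => i _.
  by rewrite (linZ _ _ (@val_lin _ _)); apply/memZ/spn_mem/map_f; rewrite mem_enum.
by apply: spn_le => _ /mapP[i _ ->]; apply/toSP/valP.
Qed.

Lemma fin_gen_noeth V : noeth A^o -> fin_gen V -> noeth V.
Proof.
move=> nA [n [g hg]]; apply: noeth_fg => //; exists (codom g) => v.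
have [c ->] := hg v; apply: mem_sum => i _; apply/memZ/spn_mem/codom_f.
Qed.

(** A nonunit lies in some maximal proper ideal, found by the ascending chain condition, and
    locality identifies that ideal with m. *)
Lemma local_facts (m : ideal A) : noeth A^o -> local_ring m ->
  ~ ofS m 1 /\ forall a : A, ~ ofS m a -> exists b : A, b * a = 1.
Proof.
move=> nA [[m1 mm] ml]; split; first exact/negP.
move=> a ma; apply: contrapT => nb.
have [|J [J1 Ja] Jm] := @noeth_max _ _ (fun J : sub A^o => ~ J 1 /\ J a) nA.
  exists (scyc (a : A^o)); split; last exact: scyc_mem.
  by move=> /scycP [b e]; apply: nb; exists b.
apply: ma; suff e : toS J =i m by rewrite -[ofS m a]/(is_true ((a : A^o) \in m)) -e; apply/toSP.
apply: ml; split=> [|J' JJ' J'1 v J'v]; first by apply/negP => /toSP.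
apply/toSP; apply: (Jm (ofS J')) => //; last by move=> w /toSP/JJ'.
by split; [apply/negP | apply: JJ'; apply/toSP].
Qed.

Lemma length_geE V l : length_ge V l <-> clen (bot : sub V) l top.
Proof.
split.
  case=> S hS; suff H k : (k <= l)%N -> clen (bot : sub V) k (ofS (S k)).
    by apply: clen_mono (H l (leqnn _)).
  elim: k => [_ v ->|k IH kl]; first exact: mem0.
  have [h1 h2] := hS k kl; exists (ofS (S k)); split=> //; exact: IH (ltnW kl).
move=> h; suff [S [_ hS]] : exists S : nat -> sub V, S l = top /\
    forall i, (i < l)%N -> sle (S i) (S i.+1) /\ ~ sle (S i.+1) (S i).
  exists (fun i => toS (S i)) => i il; have [h1 h2] := hS i il; split.
    by move=> v /toSP/h1/toSP.
  by move=> h3; apply: h2 => v /toSP/h3/toSP.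
move: top h => T; elim: l T => [|l IH] T; first by move=> _; exists (fun=> T).
move=> [Y [/IH [S [Sl hS]] YT TY]].
exists (fun i => if (i <= l)%N then S i else T); rewrite ltnn; split=> // i il.
have [->|ne] := eqVneq i l; first by rewrite leqnn ltnn Sl.
have il' : (i < l)%N by rewrite ltn_neqAle ne -ltnS.
by rewrite il' (ltnW il'); apply: hS.
Qed.

Lemma has_lengthE V l : has_length V l <-> is_len (bot : sub V) top l.
Proof.
rewrite /has_length; split=> [[/length_geE c n]|[c m]].
  split=> // k ck; rewrite leqNgt; apply/negP => lk; apply/n/length_geE.
  exact: clen_pred ck.
split; first exact/length_geE.
by move=> /length_geE /m; rewrite ltnn.
Qed.

Lemma qiso_is_len V W (f : V -> W) B Z B' Z' l : qiso f B Z B' Z' ->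
  is_len B Z l <-> is_len B' Z' l.
Proof.
move=> /qiso_clen h; split=> -[/h c m]; split=> // k /h; exact: m.
Qed.

(** Strips the two layers of [homology]: the type of cycles and the quotient by boundaries. *)
Lemma homology_len (U V W : lmodType A) (f : {linear U -> V}) (g : {linear V -> W}) l :
  (forall u, g (f u) = 0) ->
  has_length (homology f g) l <->
  is_len (sim (linear_lin f) top) (spre (linear_lin g) bot) l.
Proof.
move=> gf; rewrite has_lengthE; pose S : submodClosed _ := @bdsub A U V W f g.
rewrite -(@qiso_is_len _ _ (piq S) (ofS S) top).
  apply: (@qiso_is_len _ _ (fun w : submod (kersub g) => val w)); split=> //.
  - by move=> v _; have /eqP := valP v.
  - move=> v _; split=> [/asboolP [u e]|[u _ e]]; first by exists u.
    by apply/asboolP; exists u.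
  - move=> w /eqP hw; exists (Submod (hw : w \in kersub g)) => //=.
    by rewrite subrr; apply: mem0.
  - by move=> _ [u _ ->]; apply: gf.
split=> //; first exact: piq_lin.
- by move=> v _; split=> [h|h]; apply/piq_eq0.
- by move=> w _; have [v ->] := piq_surj w; exists v => //; rewrite subrr.
Qed.

Definition fr_cx V (F : free_resolution V) : cx A := @Cx A (fr_rank F) (fr_diff F).

Lemma mx0P p q (M : 'M[A]_(p, q)) : (forall v, mxmap A^o M v = 0) -> M = 0.
Proof.
move=> h; apply: rowf_inj => i; rewrite rowf_delta h.
by apply/ffunP => j; rewrite !ffunE mxE.
Qed.

Lemma fr_res V (F : free_resolution V) : res (bot : sub V) top (fr_cx F).
Proof.
split.
  split=> [[|j]|j]; first by rewrite /= mulmx0.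
    apply: mx0P => v; rewrite mxmapM; apply/(@fr_exactS _ _ F j); by exists v.
  by move=> v /(@fr_exactS _ _ F j) [u ->]; exists u.
exists (fun i => fr_aug F (delta i 1)).
have E x : lc (fun i => fr_aug F (delta i 1)) x = fr_aug F x.
  have := lc_fmap (fun i : 'I_(fr_rank F 0) => delta i (1 : A^o)) x (linear_lin (fr_aug F)).
  move=> <-; congr (fr_aug F _); rewrite [RHS]delta_sum; apply: eq_bigr => i _.
  by rewrite -(linZ _ _ (delta_lin i)) -[_ *: 1]/(_ * _) mulr1.
split=> // [x|v _].
  by rewrite E; exact: (@fr_exact0 _ _ F x).
by have [x <-] := fr_aug_surj F v; exists x; rewrite E subrr; apply: mem0.
Qed.

Lemma tor_len V (F : free_resolution V) j X l :
  has_length (Tor F j.+1 X) l <->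
  is_len (spB true (fr_cx F) j.+1 X) (spZ true (fr_cx F) j.+1 X) l.
Proof.
have cF := (fr_res F).1.1.
rewrite homology_len; last first.
  move=> u; have := cF j.+1 => /= h; apply: (etrans (esym (mxmapM _ _ u))).
  by rewrite h mxmap0l.
suff -> : sim (linear_lin (mxmap X (fr_diff F j.+1))) top = spB true (fr_cx F) j.+1 X.
  suff -> : spre (linear_lin (mxmap X (fr_diff F j))) bot = spZ true (fr_cx F) j.+1 X by [].
  by apply: subE.
exact: subE.
Qed.

Lemma ext_len V (F : free_resolution V) j X l :
  has_length (Ext F j.+1 X) l <->
  is_len (spB false (fr_cx F) j.+1 X) (spZ false (fr_cx F) j.+1 X) l.
Proof.
have cF := (fr_res F).1.1.
rewrite homology_len; last first.
  move=> u; have := cF j.+1 => /= h; apply: (etrans (esym (mxmapM _ _ u))).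
  by rewrite -trmx_mul h trmx0 mxmap0l.
suff -> : sim (linear_lin (mxmap X (fr_diff F j)^T)) top = spB false (fr_cx F) j.+1 X.
  suff -> : spre (linear_lin (mxmap X (fr_diff F j.+1)^T)) bot = spZ false (fr_cx F) j.+1 X by [].
  by apply: subE.
exact: subE.
Qed.

Definition truncn D d : cx A := @Cx A (fun j => rk D (j + d)) (fun j => df D (j + d)).

Lemma truncn_same c D d j : sameH c (truncn D d) j.+1 c D (j + d).+1.
Proof. by case: c => X. Qed.

Lemma truncn_acyc D d : acyc D -> acyc (truncn D d).
Proof.
move=> [cD h]; split=> [[|j]|j]; [by rewrite /= mulmx0 | exact: (cD (j.+1 + d)%N) | exact: h].
Qed.

Lemma syzygy_res V (K : free_resolution V) d :
  res (bot : sub (syzygy K d.+1)) top (truncn (fr_cx K) d.+1).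
Proof.
have aK := (fr_res K).1; split; first exact: truncn_acyc.
set Q := mxmap A^o (fr_diff K d).
have Qi i : rowf (fr_diff K d) i \in imsub Q.
  by apply/asboolP; exists (delta i 1); rewrite rowf_delta.
pose e (i : 'I_(fr_rank K d.+1)) : syzygy K d.+1 := Submod (Qi i).
have E x : val (lc e x) = Q x.
  rewrite /Q mxmap_rowf /lc (lin_sum _ _ _ (@val_lin _ _)); apply: eq_bigr => i _.
  by rewrite (linZ _ _ (@val_lin _ _)).
exists e; split=> // [x|v _].
  split=> [h|[u ->]].
    have hx : lc e x = 0 by exact: h.
    by apply: (aK.2 d); rewrite -[LHS]/(Q x) -E hx.
  apply: val_inj; rewrite E; have := aK.1 d.+1 => /= h.
  by rewrite /Q -mxmapM h mxmap0l.
have /asboolP [x ex] := valP v; exists x.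
suff -> : v = lc e x by rewrite subrr; apply: mem0.
by apply: val_inj; rewrite E.
Qed.

Lemma in_seqmodE V (x : nat -> A) k v : in_seqmod x k v <-> sq x V k v.
Proof.
elim: k v => [|k IH] v.
  by split=> [[y ->]|->]; [rewrite big_ord0 | exists (fun=> 0); rewrite big_ord0].
split=> [[y ->]|].
  rewrite big_ord_recr /=; apply: saddI; last by exists (y k).
  by apply/IH; exists y.
case=> s /IH [y ->] [w _ e].
exists (fun j => if (j < k)%N then y j else w).
rewrite big_ord_recr /= ltnn -e [LHS](_ : v = \sum_(j < k) x j *: y j + (v - \sum_(j < k) x j *: y j)).
  by congr (_ + _); apply: eq_bigr => j _; rewrite ltn_ord.
by rewrite addrC subrK.
Qed.

End Translation.

(** * Homology with coefficients in N / I^n N *)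

Section AdicQuotients.
Variables (A : comNzRingType) (I : ideal A) (l : seq A).
Hypothesis Il : ofS I = @spn A A^o l.
Implicit Types V W N L : lmodType A.
Implicit Types D : cx A.

Lemma mulsub_gen V (S : submodClosed V) : ofS (mulsub I S) = gen l (ofS S).
Proof.
apply: sle_anti => [v /asboolP [n [a [y [aI yS ->]]]]|].
  apply: mem_sum => i _; have : sle (@spn A A^o l) (spre (lin_act (y i)) (gen l (ofS S))).
    by apply: spn_le => b bl; rewrite spreE; apply: gen_in => //; apply: yS.
  by apply; rewrite -Il; apply: aI.
apply: gen_le => a v al Sv; apply/asboolP; exists 1%N, (fun=> a), (fun=> v).
split=> //; last by rewrite big_ord1.
by move=> _; rewrite -[is_true _]/(ofS I a) Il; apply: spn_mem.
Qed.

Lemma idealX_pow n : ofS (idealX I n) = pow l n (@top A A^o).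
Proof.
elim: n => [|n IH]; first exact: subE.
by rewrite powS -IH -mulsub_gen.
Qed.

Lemma mulsub_pow N n : ofS (mulsub (idealX I n) (@fullsub A N)) = pow l n (@top A N).
Proof.
apply: sle_anti => [v /asboolP [k [a [y [aI _ ->]]]]|].
  apply: mem_sum => i _; have : sim (lin_act (y i)) (pow l n top) (a i *: y i).
    by exists (a i) => //; rewrite -idealX_pow; apply: aI.
  by rewrite pow_sim; apply: pow_mono.
elim: n => [|n IH].
  by move=> v _; apply/asboolP; exists 1%N, (fun=> 1), (fun=> v);
    split=> //; rewrite big_ord1 scale1r.
rewrite powS; apply: gen_le => a v al /IH /asboolP [k [b [y [bI _ ->]]]].
apply/asboolP; exists k, (fun i => a * b i), y; split=> //.
  move=> i; rewrite -[is_true _]/(ofS (idealX I n.+1) (a * b i)) idealX_pow powS.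
  by apply: gen_in => //; rewrite -idealX_pow; apply: bI.
by rewrite scaler_sumr; apply: eq_bigr => i _; rewrite scalerA.
Qed.

Lemma pow_coord N n p (v : {ffun 'I_p -> N}) :
  pow l n top v <-> forall i, pow l n (@top A N) (v i).
Proof.
split=> [h i|h].
  have lev : lin (fun x : {ffun 'I_p -> N} => x i) by move=> a x y; rewrite !ffunE.
  have : sim lev (pow l n top) (v i) by exists v.
  by rewrite pow_sim; apply: pow_mono.
rewrite [v]delta_sum; apply: mem_sum => i _.
have : sim (@delta_lin A N p i) (pow l n top) (delta i (v i)) by exists (v i).
by rewrite pow_sim; apply: pow_mono.
Qed.

Variable N : lmodType A.
Let X n : lmodType A := N %/m idealX I n.
Let pr n : N -> X n := piq (mulsub (idealX I n) (@fullsub A N)).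

Lemma pr_lin n : lin (@pr n).
Proof. exact: piq_lin. Qed.

Lemma pr_eq0 n v : pr n v = 0 <-> pow l n top v.
Proof. by rewrite -mulsub_pow; apply: piq_eq0. Qed.

Lemma fpr_eq0 n p (v : {ffun 'I_p -> N}) : fmap (@pr n) v = 0 <-> pow l n top v.
Proof.
rewrite pow_coord; split=> [/ffunP h i|h].
  by apply/pr_eq0; have := h i; rewrite !ffunE.
by apply/ffunP => i; rewrite !ffunE; apply/pr_eq0.
Qed.

Lemma fpr_surj n p (y : {ffun 'I_p -> X n}) : exists x, y = fmap (@pr n) x.
Proof.
have /choice [f hf] : forall i, exists x, y i = pr n x by move=> i; apply: piq_surj.
by exists [ffun i => f i]; apply/ffunP => i; rewrite !ffunE.
Qed.

Variable m : sub A^o.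
Hypothesis m_unit : forall a : A, ~ m a -> exists b : A, b * a = 1.
Hypothesis nA : noeth A^o.
Hypothesis nN : noeth N.
Hypothesis nilN : nilmod m l (bot : sub N).

Lemma nilmod_ffun p : nilmod m l (bot : sub {ffun 'I_p -> N}).
Proof.
move=> z /nilN [e [c [lc h]]]; exists e, c; split=> // w.
by apply/ffunP => i; rewrite !ffunE; apply: h.
Qed.

Lemma adic_fin c D j n : Hfin c D j (X n).
Proof.
have q : qiso (fmap (@pr n)) (pow l n top) top (bot : sub {ffun 'I_(rk D j) -> X n}) top.
  split=> //; first by apply: fmap_lin; apply: pr_lin.
  - by move=> v _; split=> h; apply/fpr_eq0.
  - by move=> w _; have [x ->] := fpr_surj w; exists x => //; rewrite subrr.
have f := (qiso_ln q).1.1 (pow_fin m_unit nA (noeth_ffun nA nN) (nilmod_ffun _) (leq0n n)).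
by apply: fin_sub f => // v ->; apply: mem0.
Qed.

Section Spot.
Variables (c : bool) (D : cx A) (j : nat).
Hypothesis cD : iscx D.
Hypothesis eN : exact c D j N.
Let U := sim (mxmap_lin (X := N) (outM c D j)) top.

Let Z1 n := spre (fmap_lin (n := rk D j) (@pr_lin n)) (spZ c D j (X n)).
Let B1 n := spre (fmap_lin (n := rk D j) (@pr_lin n)) (spB c D j (X n)).

Lemma spot_pr n : qiso (fmap (@pr n)) (B1 n) (Z1 n) (spB c D j (X n)) (spZ c D j (X n)).
Proof.
split=> //; first exact: fmap_lin (@pr_lin n).
- move=> w Zw; have [x e] := fpr_surj w; exists x; first by rewrite /Z1 spreE -e.
  by rewrite e subrr; apply: mem0.
- by move=> v; apply: spBZ.
- exact: spBZ.
Qed.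

(* By exactness over N, the boundary map identifies the homology over N / I^n N
   with (U \cap I^n V) / I^n U, U being its image in V = N^r. *)
Lemma spot_rees n :
  qiso (mxmap N (outM c D j)) (B1 n) (Z1 n) (pow l n U) (scap U (pow l n top)).
Proof.
have PQ := inM_outM c j cD.
have ZE v : Z1 n v <-> pow l n top (mxmap N (outM c D j) v).
  by rewrite -fpr_eq0 -mxmap_fmap //; exact: pr_lin.
split; first exact: mxmap_lin.
- by move=> v /ZE h; split=> //; exists v.
- move=> v _; rewrite -(pow_sim (mxmap_lin (X := N) (outM c D j))); split.
    move=> /spBP [y]; have [y' ->] := fpr_surj y.
    rewrite mxmap_fmap; last exact: pr_lin.
    move=> e; exists (v - mxmap N (inM c D j) y'); last first.
      by rewrite (linB _ _ (mxmap_lin _)) -[in X in _ - X]mxmapM PQ mxmap0l subr0.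
    by apply/fpr_eq0; rewrite (linB _ _ (fmap_lin (@pr_lin n))) e subrr.
  move=> [w pw e]; have /eN /spBP [y ey] : spZ c D j N (v - w).
    by apply/spZP; rewrite (linB _ _ (mxmap_lin _)) e subrr.
  apply/spBP; exists (fmap (@pr n) y); rewrite mxmap_fmap; last exact: pr_lin.
  rewrite -ey (linB _ _ (fmap_lin (@pr_lin n))).
  by have /fpr_eq0 -> := pw; rewrite subr0.
- move=> w [[v _ ->] h]; exists v; first by apply/ZE.
  by rewrite subrr; apply: mem0.
- by move=> v; apply: spBZ.
- exact: rees_le.
Qed.

Lemma spot_ln n : Hln c D j (X n) = ln (pow l n U) (scap U (pow l n top)).
Proof. by rewrite /Hln -(qiso_ln (spot_pr n)).2 (qiso_ln (spot_rees n)).2. Qed.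

Lemma spot_kill z : m z -> exists e, forall n v,
  spZ c D j (X n) v -> spB c D j (X n) (z ^+ e *: v).
Proof.
move=> mz; have [e he] := rees_kill U (noeth_ffun nA nN) (nilmod_ffun _) mz.
exists e => n v Zv; have [v' e'] := fpr_surj v.
have Zv' : Z1 n v' by rewrite /Z1 spreE -e'.
have [_ h1 h2 _ _ _] := spot_rees n.
have : B1 n (z ^+ e *: v').
  apply/h2; first exact: memZ.
  by rewrite (linZ _ _ (mxmap_lin _)); apply: he; apply: h1.
by rewrite /B1 spreE (linZ _ _ (fmap_lin (@pr_lin n))) -e'.
Qed.

End Spot.
End AdicQuotients.

(** * Nilpotence of m modulo ann N + I, for an ideal of definition I *)

Section Nilpotence.
Variables (A : comNzRingType) (m : sub A^o) (l : seq A).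
Hypothesis m1 : ~ m 1.
Hypothesis m_unit : forall a : A, ~ m a -> exists b : A, b * a = 1.
Implicit Types V W N L : lmodType A.

Let I := gen l (@top A A^o).

Lemma congM (a b a' b' : A) : I (a - b) -> I (a' - b') -> I (a * a' - b * b').
Proof.
move=> h h'; have -> : a * a' - b * b' = a' * (a - b) + b * (a' - b').
  by rewrite !mulrBr [a' * a]mulrC [a' * b]mulrC addrA subrK.
by apply: memD; apply: (memZ (S := I)).
Qed.

Lemma congX (a b : A) k : I (a - b) -> I (a ^+ k - b ^+ k).
Proof.
by move=> h; elim: k => [|k IH]; [rewrite subrr; apply: mem0 | rewrite !exprS; apply: congM].
Qed.

(* The determinant trick, by induction on the number of generators. *)
Lemma det_trick V (us : seq V) (z : A) :
  (forall u, u \in us -> gen l (spn us) (z *: u)) ->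
  exists k (b : A), I (z ^+ k - b) /\ forall u, u \in us -> b *: u = 0.
Proof.
elim: us z => [|u us IH] z h; first by exists 0%N, 1; rewrite subrr; split=> //; apply: mem0.
have dec v : gen l (spn (u :: us)) v -> exists c : A, I c /\ gen l (spn us) (v - c *: u).
  rewrite /= gen_sadd => -[w gw gv].
  have : sle (gen l (scyc u)) (sim (lin_act u) I).
    by rewrite /I gen_sim; apply: gen_mono => _ /scycP [a ->]; exists a.
  by move=> /(_ w gw) [c Ic e]; exists c; rewrite -e.
have [c [Ic hc]] := dec _ (h u (mem_head _ _)).
(* Subtracting c moves a u into I (us). As z w differs from a multiple of u by an element of I (us),
   a z maps (us) into I (us). *)
pose a := z - c.
have au : gen l (spn us) (a *: u) by rewrite scalerBl.
have [w wus|k [b [Ib hb]]] := IH (a * z).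
  have [|c' [Ic' hc']] := dec (z *: w); first by apply: h; rewrite inE wus orbT.
  rewrite -scalerA -(subrK (c' *: u) (z *: w)) scalerDr; apply: memD; first exact: memZ.
  by rewrite scalerA mulrC -scalerA; apply: memZ.
have Ia : I (z - a) by rewrite /a opprB addrC subrK.
(* Modulo I, b is (a z)^k and z is a, so z^(2k+1) is b a. The factor a moves u into (us), which b
   annihilates. *)
exists (k * 2 + 1)%N, (b * a); split.
  rewrite exprD expr1; apply: congM => //.
  rewrite mulnC exprM -(subrK ((a * z) ^+ k) (_ ^+ k)) -addrA; apply: memD => //.
  by apply: congX; rewrite expr2; apply: congM => //; rewrite subrr; apply: mem0.
have hs v : spn us v -> b *: v = 0.
  have : sle (spn us) (scol b bot) by apply: spn_le => w; apply: hb.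
  by move=> h' /h'.
move=> w; rewrite inE => /orP[/eqP ->|wus].
  by rewrite -scalerA; apply/hs/(gen_sub au).
by rewrite mulrC -scalerA hb // scaler0.
Qed.

Lemma desc_stable V (B : sub V) (S : nat -> sub V) : fin B top ->
  (forall i, sle B (S i)) -> (forall i, sle (S i.+1) (S i)) -> exists i, sle (S i) (S i.+1).
Proof.
move=> [M hM] BS dS; apply: contrapT => /forallNP h.
have c k : forall i, clen B k (S i) by elim: k => [|k IH] i; [apply: BS | exists (S i.+1)].
by have := hM M.+1 (clen_mono (@sle_top _ _ _) (c M.+1 0%N)); rewrite ltnn.
Qed.

(** As N / IN has finite length, the submodules IN + z^i N become stationary; Nakayama then gives
    z^i N <= IN, and the determinant trick turns this into an identity modulo ann N. *)
Lemma nilmod_of_fin N : noeth N -> fin (gen l (@top A N)) top -> nilmod m l (bot : sub N).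
Proof.
move=> nN f z mz; pose B := gen l (@top A N).
pose S i := sadd B (sscale (z ^+ i) top).
have [||i hi] := @desc_stable N B S f.
- by move=> i; apply: sadd_l.
- move=> i; apply: sadd_mono => // _ [v _ ->]; rewrite exprSr -scalerA.
  by exists (z *: v).
have ZB : sle (sscale (z ^+ i) (@top A N)) B.
  apply: (nakayama m1 m_unit nN mz) => v Zv.
  have [b Bb [w _ e]] := hi v (sadd_r Zv); exists b => //.
  by exists (z ^+ i *: w); [exists w | rewrite e exprS scalerA].
have [us hus] := nN top.
have [u _|k [b [Ib hb]]] := @det_trick N us (z ^+ i).
  by rewrite -hus; apply: ZB; exists u.
exists (i * k)%N, (z ^+ (i * k) - b); split; first by rewrite exprM.
move=> w; rewrite opprB addrC subrK.
have : sle (spn us) (scol b bot) by apply: spn_le => u; apply: hb.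
by apply; rewrite -hus.
Qed.

End Nilpotence.

(** * Chains of primes and regular sequences *)

Section PrimeChains.
Variable A : comNzRingType.

Section PrimePred.
Variables (p : sub A^o) (hp : prime_sub p).
Definition primepred & prime_sub p : {pred A} := [pred a | `[< p a >]].
Fact primepred_closed : idealr_closed (primepred hp).
Proof.
split; first exact/asboolP/mem0.
  by apply/negP => /asboolP; case: hp.
move=> a u v /asboolP pu /asboolP pv; apply/asboolP.
by rewrite -[a * u]/(a *: (u : A^o)); apply: memP.
Qed.
Fact primepred_prime : prime_idealr_closed (primepred hp).
Proof.
by move=> u v /asboolP /(hp.2) [h|h]; apply/orP; [left|right]; apply/asboolP.
Qed.
HB.instance Definition _ := isIdealr.Build A (primepred hp) primepred_closed.
HB.instance Definition _ := isPrimeIdealrClosed.Build A (primepred hp) primepred_prime.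
Definition prime_pack : prime_idealr A := primepred hp.
End PrimePred.

Lemma chain_dim (V : lmodType A) k c (J : sub A^o) :
  (forall a : A, a \in ann V -> J a) -> prime_chain J k c -> dim_ge V k.
Proof.
move=> VJ [Jc cp ci]; have cp' i : prime_sub (c (minn i k)) by apply: cp; apply: geq_minr.
exists (fun i => prime_pack (cp' i)); split.
  by move=> a /VJ /Jc h; apply/asboolP; rewrite min0n.
move=> i ik; have [h1 h2] := ci i ik; split.
  by move=> a /asboolP; rewrite (minn_idPl (ltnW ik)) => /h1 h; apply/asboolP; rewrite (minn_idPl ik).
move=> h; apply: h2 => a ha.
have : a \in primepred (cp' i) by apply: h; apply/asboolP; rewrite (minn_idPl ik).
by move=> /asboolP; rewrite (minn_idPl (ltnW ik)).
Qed.

Hypothesis nA : noeth A^o.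

(* p is maximal among the ideals containing J and disjoint from the
   multiplicative set of the x^e y, with y not in q. *)
Lemma prime_below (J q : sub A^o) (x : A) : prime_sub q -> sle J q ->
  (forall v : A, J (x * v) -> J v) -> exists p, [/\ prime_sub p, sle J p, sle p q & ~ p x].
Proof.
move=> [q1 qM] Jq xJ.
have [|p [Jp hp] pm] := @noeth_max _ _ (fun p : sub A^o => sle J p /\
    forall e (y : A), ~ q y -> ~ p (x ^+ e * y)) nA.
  exists J; split=> // e y qy; elim: e => [|e IH]; first by rewrite expr0 mul1r => /Jq.
  by rewrite exprS -mulrA => /xJ.
have p1 : ~ p 1 by have := hp 0%N 1 q1; rewrite expr0 mulr1.
have meet a : ~ p a -> exists e (y b : A), ~ q y /\ p (x ^+ e * y - b * a).
  move=> pa; apply: contrapT => h; apply: pa.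
  apply: (pm (sadd p (scyc (a : A^o)))); last by apply: sadd_r; apply: scyc_mem.
    split; first by apply: sle_trans Jp _; apply: sadd_l.
    move=> e y qy /sadd_cyc [b rk_in]; apply: h; by exists e, y, b.
  exact: sadd_l.
exists p; split=> //.
- split=> // a b pab; apply: contrapT => /not_orP [/meet [e [y [c [qy pc]]]]].
  move=> /meet [f [w [d [qw pd]]]].
  apply: (hp (e + f)%N (y * w)); first by case/qM.
  have -> : x ^+ (e + f) * (y * w) = (x ^+ f * w) * (x ^+ e * y - c * a) +
      ((c * a) * (x ^+ f * w - d * b) + (c * d) * (a * b)).
    by rewrite exprD; move: (x ^+ e) (x ^+ f) => xe xf; ring.
  by apply: memD; [|apply: memD]; apply: (memZ (S := p)).
- by move=> a pa; apply: contrapT => qa; apply: (hp 0%N a qa); rewrite expr0 mul1r.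
- by have := hp 1%N 1 q1; rewrite expr1 mulr1.
Qed.

(** The chain grows downwards from m: under a prime containing (x_0, ..., x_i), [prime_below] finds
    one that contains (x_0, ..., x_(i-1)) and misses the regular element x_i. *)
Lemma regular_chain (m : sub A^o) (x : nat -> A) s : prime_sub m ->
  (forall i, (i < s)%N -> m (x i)) ->
  (forall i, (i < s)%N -> forall v, sq x A^o i (x i *: v) -> sq x A^o i v) ->
  exists c, prime_chain (bot : sub A^o) s c.
Proof.
move=> pm xm xreg.
have sqm k : (k <= s)%N -> sle (sq x A^o k) m by apply: sq_le_m.
suff H k i : (i + k)%N = s -> exists c, prime_chain (sq x A^o i) k c.
  exact: (H s 0%N (add0n s)).
elim: k i => [|k IH] i ik.
  exists (fun=> m); split=> //; by apply: sqm; rewrite -ik addn0.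
have [|c [Jc cp ci]] := IH i.+1; first by rewrite addSnnS.
have i_s : (i < s)%N by rewrite -ik addnS ltnS leq_addr.
have [|p [pp Jp pc px]] := prime_below (J := sq x A^o i) (x := x i) (cp 0%N (leq0n _)) _ (xreg i i_s).
  by apply: sle_trans Jc; apply: sadd_l.
exists (fun j => if j is j'.+1 then c j' else p); split=> //.
  by case=> // j jk; apply: cp.
case=> [_|j jk]; last exact: ci.
split=> // h; apply: px; apply: h; apply: Jc.
exact: sq_mem.
Qed.

End PrimeChains.

(** * Degrees of length functions and the choice of a maximal regular sequence *)

Section Degrees.
Import Num.Theory.
Variable A : comNzRingType.

Lemma length_degreeE (L : nat -> lmodType A) (f : nat -> nat) (p : {poly rat}) n0 :
  (forall n, has_length (L n) (f n)) ->
  (forall n, (n0 <= n)%N -> (f n)%:R = p.[n%:R]) ->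
  length_degree L = (size p)%:Z - 1.
Proof.
move=> Lf fp; rewrite /length_degree; case: xgetP => [r -> [q [[n1 h] ->]]|/(_ ((size p)%:Z - 1))].
  suff -> : q = p by [].
  apply: (@poly_nat_eq _ _ (maxn n0 n1)) => n; rewrite geq_max => /andP[/fp <- /h [k Lk <-]].
  by move: (Lf n) Lk => /has_lengthE h1 /has_lengthE h2; rewrite (is_len_uniq h1 h2).
case; exists p; split=> //; exists n0 => n /fp e; by exists (f n).
Qed.

Lemma dim_ge_le (V : lmodType A) n k : (k <= n)%N -> dim_ge V n -> dim_ge V k.
Proof.
move=> kn [p [Vp hp]]; exists p; split=> // i ik; apply: hp; exact: leq_trans kn.
Qed.

Lemma has_dim_uniq (V : lmodType A) n k : has_dim V n -> has_dim V k -> n = k.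
Proof.
move=> [n1 n2] [k1 k2]; apply/eqP; rewrite eqn_leq; apply/andP.
by split; rewrite leqNgt; apply/negP => h; [apply: k2 | apply: n2]; apply: dim_ge_le h _.
Qed.

Lemma sq_eq (x y : nat -> A) (V : lmodType A) k : (forall i, (i < k)%N -> x i = y i) ->
  sq x V k = sq y V k.
Proof.
elim: k => //= k IH h; rewrite h // IH // => i ik; apply: h; exact: ltnW.
Qed.

(** A regular sequence in m yields a chain of primes of the same length, so d bounds the lengths; a
    longest sequence cannot be extended by any z in m. *)
Lemma max_regular (m : ideal A) d : noeth A^o -> local_ring m -> ring_dim A d ->
  exists s (x : nat -> A), [/\ (s <= d)%N, forall i, (i < s)%N -> ofS m (x i),
    forall i, (i < s)%N -> forall v, sq x A^o i (x i *: v) -> sq x A^o i v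
  & forall z : A, ofS m z -> ~ forall v, sq x A^o s (z *: v) -> sq x A^o s v].
Proof.
move=> nA /(local_facts nA) [m1 m_unit] [_ dd].
have reg s : grade_ge m A^o s -> exists x : nat -> A,
    (forall i, (i < s)%N -> ofS m (x i)) /\
    forall i, (i < s)%N -> forall v, sq x A^o i (x i *: v) -> sq x A^o i v.
  case=> x [xm [xr _]]; exists x; split=> // i hi v /in_seqmodE h.
  by apply/in_seqmodE; apply: xr.
have bd s : `[< grade_ge m A^o s >] -> (s <= d)%N.
  move=> /asboolP /reg [x [xm xr]]; rewrite leqNgt; apply/negP => ds; apply: dd.
  have [c hc] := regular_chain nA (m_prime m1 m_unit) xm xr.
  apply: dim_ge_le ds (chain_dim _ hc) => a /asboolP h.
  by have := h 1; rewrite -[_ *: _]/(_ * _) mulr1.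
have ex : exists s, `[< grade_ge m A^o s >].
  exists 0%N; apply/asboolP; exists (fun=> 0); split=> //; split=> // h.
  have /in_seqmodE h1 := h 1; have /eqP := h1 : (1 : A) = 0; by rewrite oner_eq0.
have [s /asboolP gs ms] := ex_maxnP ex bd; have [x [xm xr]] := reg s gs.
exists s, x; split; [exact/bd/asboolP | exact: xm | exact: xr |].
move=> z mz hz; suff : (s.+1 <= s)%N by rewrite ltnn.
apply: ms; apply/asboolP; pose y i := if (i < s)%N then x i else z.
have ym i : (i < s.+1)%N -> y i \in m by rewrite /y; case: ifP => // h _; apply: xm.
have yx k : (k <= s)%N -> sq y A^o k = sq x A^o k.
  by move=> ks; apply: sq_eq => i ik; rewrite /y (leq_trans ik ks).
exists y; split=> //; split.
  move=> i; rewrite ltnS => hi v /in_seqmodE; rewrite yx // => h; apply/in_seqmodE; rewrite yx //.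
  move: h; rewrite /y; case: ltnP => [h|h]; first exact: xr.
  have -> : i = s by apply/eqP; rewrite eqn_leq hi h.
  exact: hz.
move=> h; apply: m1; have /in_seqmodE := h 1.
by have := sq_le_m (x := y) (s := s.+1) (m := ofS m) ym (leqnn _); apply.
Qed.

End Degrees.

Import Num.Theory.

Theorem theoremI (A : comNzRingType) (m : ideal A) (d : nat)
    (A_noeth : noetherian A) (A_local : local_ring m)
    (A_gor : gorenstein A) (A_nonreg : ~ regular_local m)
    (A_dim : ring_dim A d) (d_ge1 : (1 <= d)%N)
    (* a minimal free resolution K of k = A / m, and Omega = Omega^d k *)
    (K : free_resolution (quotmod m)) (K_min : minimal_resolution m K)
    (N : lmodType A) (t : nat) (N_perfect : perfect N)
    (N_dim : has_dim N t) (t_ge1 : (1 <= t)%N)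
    (I : ideal A) (I_def : ideal_of_definition m I N)
    (M : lmodType A) (M_fg : fin_gen M) (M_mcm : max_cohen_macaulay m M)
    (* free resolutions computing Tor and Ext *)
    (F : free_resolution M) (G : free_resolution (syzygy K d))
    (i : nat) (i_ge1 : (1 <= i)%N) :
  [/\ tor_degree I N G i = tor_degree I N G 1,
      ext_degree I N G i = ext_degree I N G 1,
      tor_degree I N G 1 = ext_degree I N G 1,
      tor_degree I N F i <= tor_degree I N G 1 <= t%:Z - 1
    & ext_degree I N F i <= ext_degree I N G 1 <= t%:Z - 1].
Proof.
have nA := noetherian_noeth A_noeth; have [m1 m_unit] := local_facts nA A_local.
have [n gor] := A_gor.
have [s [x [sd xm xr xmax]]] := max_regular nA A_local A_dim.
pose mS := ofS m.
have rK : res mS top (fr_cx K).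
  apply: res_pull (fr_res K); split=> //; first exact: piq_lin.
  - by move=> v _; split=> h; apply/piq_eq0.
  - by move=> w _; have [v ->] := piq_surj w; exists v => //; rewrite subrr.
have vanish := ext_vanish m1 m_unit nA gor xr xmax.
(* M is totally reflexive: for an M-regular sequence y of length d, Ext^j(M / (y) M, A) = 0 for j >
   d >= s, and removing one y_e at a time lowers the bound to j > 0. *)
have tF : tacyclic (fr_cx F).
  split; first exact: (fr_res F).1.
  have nM := fin_gen_noeth nA M_fg.
  case: M_mcm => d' [_ [[y [ym [yr _]]] _] /(has_dim_uniq A_dim) e]; rewrite -{}e in ym yr.
  have H k : forall j e, (e + k)%N = d -> (e < j)%N -> ext_zero j (sq y M e) top.
    elim: k => [|k IH] j e ek ej; first by apply: vanish => //; apply: leq_ltn_trans ej; rewrite -[e]addn0 ek.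
    have e_d : (e < d)%N by rewrite -ek addnS ltnS leq_addr.
    apply: (ext_zero_cone_down m1 m_unit nA nM _ (ym e e_d)) => //; last by apply: (IH j.+1 e.+1); rewrite // addSnnS.
    by move=> v _ /in_seqmodE /(yr e e_d) /in_seqmodE.
  by move=> j; apply: ext_zero_exact (fr_res F) (H d j.+1 0%N (add0n d) _).
(* d is exposed as a successor, so that [syzygy] reduces to the image of a differential. *)
case: d d_ge1 A_dim K_min G sd {vanish M_mcm tF} (vanish) (tF) => // d _ A_dim K_min G sd vanish tF.
pose T := truncn (fr_cx K) d.+1.
have rT : res (bot : sub (syzygy K d.+1)) top T by apply: syzygy_res.
have rG := fr_res G; have eGT := res_equiv rG rT; have eTG := res_equiv rT rG.
(* Ext^(j+1)(Omega^d k, A) is Ext^(j+1+d)(k, A), which vanishes because s <= d. *)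
have tG : tacyclic (fr_cx G).
  split; first exact: rG.1; move=> j; apply: hom_equiv_exact eGT _.
  have [-> _ _] := truncn_same false (fr_cx K) d.+1 j A^o.
  by apply: ext_zero_exact rK _; apply: vanish => //; rewrite ltnS; apply: leq_trans sd (leq_addl _ _).
have [l0 Il0] := nA (ofS I); pose l : seq A := l0.
have Il : ofS I = @spn A A^o l by [].
have [Nfg _ [pd [[Npd _] _]]] := N_perfect.
have nN := fin_gen_noeth nA Nfg.
have nilN : nilmod mS l (bot : sub N).
  apply: (nilmod_of_fin m1 m_unit nN); have [_ [len /has_lengthE [_ h]]] := I_def.
  have q : qiso (piq (mulsub I (@fullsub A N))) (gen l (@top A N)) top bot top.
    split=> //; first exact: piq_lin.
    - move=> v _; have := mulsub_gen Il (@fullsub A N).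
      rewrite (_ : ofS (@fullsub A N) = top) => [<-|]; last exact: subE.
      by split=> hv; apply/piq_eq0.
    - by move=> w _; have [v ->] := piq_surj w; exists v => //; rewrite subrr.
  by apply/(qiso_ln q).1; exists len.
have gN : good N by apply: good_projdim Npd.
pose X k : lmodType A := N %/m idealX I k.
have Xfin c D j k : Hfin c D j (X k) by apply: (adic_fin Il m_unit nA nN nilN).
have Nex c D j : tacyclic D -> exact c D j.+1 N by move=> tD; apply: (good_exact nA gor).
have Xkill c D j : tacyclic D -> forall z, mS z -> exists e, forall k v,
    spZ c D j.+1 (X k) v -> spB c D j.+1 (X k) (z ^+ e *: v).
  by move=> tD z; apply: (spot_kill Il nA nN nilN tD.1.1 (Nex c D j tD)).
have core c D j p tD := core m1 m_unit nA gor xm xr xmax Xfin Xkill rK c j p (D := D) tD.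
have hilb c D j : tacyclic D -> exists p : {poly rat}, (size p <= t)%N /\
    exists n0, forall k, (n0 <= k)%N -> (Hln c D j.+1 (X k))%:R = p.[k%:R].
  move=> tD; have [|p [sp [n0 hp]]] := rees_hilbert m1 m_unit nA
      (sim (mxmap_lin (X := N) (outM c D j.+1)) top) (noeth_ffun nA nN)
      (@nilmod_ffun _ _ _ _ nilN _) (t := t).
    move=> ch hch; apply: N_dim.2; apply: chain_dim hch => a /asboolP h w.
    by apply/ffunP => k; rewrite !ffunE h.
  by exists p; split=> //; exists n0 => k /hp <-; rewrite (spot_ln Il tD.1.1 (Nex c D j tD)).
have tor V (E : free_resolution V) j : tacyclic (fr_cx E) -> exists p : {poly rat},
    [/\ (size p <= t)%N, tor_degree I N E j.+1 = (size p)%:Z - 1 &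
    exists n0, forall k, (n0 <= k)%N -> (Hln true (fr_cx E) j.+1 (X k))%:R = p.[k%:R]].
  move=> tE; have [p [sp [n0 hp]]] := hilb true _ j tE; exists p; split=> //; last by exists n0.
  apply: (length_degreeE (f := fun k => Hln true (fr_cx E) j.+1 (X k))) hp => k.
  by apply/tor_len/ln_len; [apply: spBZ; apply: tE.1.1 | apply: Xfin].
have ext V (E : free_resolution V) j : tacyclic (fr_cx E) -> exists p : {poly rat},
    [/\ (size p <= t)%N, ext_degree I N E j.+1 = (size p)%:Z - 1 &
    exists n0, forall k, (n0 <= k)%N -> (Hln false (fr_cx E) j.+1 (X k))%:R = p.[k%:R]].
  move=> tE; have [p [sp [n0 hp]]] := hilb false _ j tE; exists p; split=> //; last by exists n0.
  apply: (length_degreeE (f := fun k => Hln false (fr_cx E) j.+1 (X k))) hp => k.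
  by apply/ext_len/ln_len; [apply: spBZ; apply: tE.1.1 | apply: Xfin].
have cmp (f g : nat -> nat) (p q : {poly rat}) :
    (exists C, forall k, (f k <= C * g k)%N) ->
    (exists n0, forall k, (n0 <= k)%N -> (f k)%:R = p.[k%:R]) ->
    (exists n0, forall k, (n0 <= k)%N -> (g k)%:R = q.[k%:R]) -> (size p <= size q)%N.
  move=> [C h] [n0 hp] [n1 hq]; apply: (@size_dominated _ _ C (maxn n0 n1)) => k.
  rewrite geq_max => /andP[/hp <- /hq <-]; rewrite ler0n -natrM ler_nat; exact: h.
have HG c j k : Hln c (fr_cx G) j.+1 (X k) = Hln c (fr_cx K) (j + d.+1).+1 (X k).
  have [_ _ <-] := truncn_same c (fr_cx K) d.+1 j (X k).
  apply/eqP; rewrite eqn_leq; apply/andP; split.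
    exact: (hom_equiv_ln rG.1.1 rT.1.1 eGT (Xfin _ _ _ _)).2.
  exact: (hom_equiv_ln rT.1.1 rG.1.1 eTG (Xfin _ _ _ _)).2.
(* The free index p of [core] is chosen so that p + s is the position in K which computes Omega^d k
   at j'; this uses s <= d. *)
have coreG c D j j' : tacyclic D -> exists C, forall k,
    (Hln c D j.+1 (X k) <= C * Hln c (fr_cx G) j'.+1 (X k))%N.
  move=> tD; have [C hC] := core c D j (j' + d.+1 - s)%N tD; exists C => k.
  by rewrite HG; have := hC k; rewrite subnK // (leq_trans sd) // leq_addl.
case: i i_ge1 => // i _.
have [pF [spF -> hF]] := tor _ F i tF; have [qF [sqF -> kF]] := ext _ F i tF.
have [p1 [sp1 -> h1]] := tor _ G 0%N tG; have [q1 [sq1 -> k1]] := ext _ G 0%N tG.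
have [pi [spi -> hi]] := tor _ G i tG; have [qi [sqi -> ki]] := ext _ G i tG.
have [G' [tG' dG]] := tacyclic_dual nA gor tG.
(* The dual G' of G has the Ext of G as its Tor and conversely, so comparing G' with G bounds each
   by the other. *)
have swap c : exists C, forall k,
    (Hln c (fr_cx G) 1 (X k) <= C * Hln (~~ c) (fr_cx G) 1 (X k))%N.
  have [C hC] := coreG (~~ c) G' 0%N 0%N tG'; exists C => k.
  by have := hC k; have [_ _ ->] := dG (~~ c) (X k); rewrite negbK.
have eqi : size pi = size p1.
  by apply/eqP; rewrite eqn_leq (cmp _ _ _ _ (coreG _ _ _ _ tG) hi h1) (cmp _ _ _ _ (coreG _ _ _ _ tG) h1 hi).
have eqk : size qi = size q1.
  by apply/eqP; rewrite eqn_leq (cmp _ _ _ _ (coreG _ _ _ _ tG) ki k1) (cmp _ _ _ _ (coreG _ _ _ _ tG) k1 ki).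
have eqs : size p1 = size q1.
  by apply/eqP; rewrite eqn_leq (cmp _ _ _ _ (swap true) h1 k1) (cmp _ _ _ _ (swap false) k1 h1).
rewrite eqi eqk eqs; split=> //; rewrite !lerD2r !lez_nat sq1 andbT.
  by rewrite -eqs; apply: cmp (coreG _ _ _ _ tF) hF h1.
exact: cmp (coreG _ _ _ _ tF) kF k1.
Qed.
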